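(* Let $n\in\mathbb{N}$, let $[\cdot]_\beta$ be the unnormalised expectation of the $\mathbb{R}^n$ model on $\Lambda$, and let $\mathbb{E}_{i,\boldsymbol{\ell}}$ be the expectation of the simple random walk with its local times. Let $f\colon\Lambda\times\mathbb{R}^\Lambda\to\mathbb{R}$ be smooth with rapid decay, and let $\rho\colon(\mathbb{R}^n)^\Lambda\to\mathbb{R}$ be smooth with moderate growth. Then $$-\sum_{j\in\Lambda}\Big[\rho(\boldsymbol{u})\,u_j^1\,(\mathcal{L}f)\big(j,\tfrac12|\boldsymbol{u}|^2\big)\Big]_\beta=\sum_{j\in\Lambda}\Big[(T_j\rho)(\boldsymbol{u})\,f\big(j,\tfrac12|\boldsymbol{u}|^2\big)\Big]_\beta.$$ In particular, the following integrated version holds for all $f\colon\Lambda\times\mathbb{R}^\Lambda\to\mathbb{R}$ with rapid decay (and all smooth $\rho\colon(\mathbb{R}^n)^\Lambda\to\mathbb{R}$ with moderate growth): $$\sum_{j\in\Lambda}\Big[\rho(\boldsymbol{u})\,u_j^1\,f\big(j,\tfrac12|\boldsymbol{u}|^2\big)\Big]_\beta=\sum_{j\in\Lambda}\Big[(T_j\rho)(\boldsymbol{u})\int_0^\infty\mathbb{E}_{j,\frac12|\boldsymbol{u}|^2}\big(f(X_t,\boldsymbol{L}_t)\big)\,dt\Big]_\beta.$$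
   Context: $\Lambda$ is a finite set and $\beta=(\beta_{ij})_{i,j\in\Lambda}$ are edge weights with $\beta_{ij}=\beta_{ji}\ge0$ such that the graph with vertex set $\Lambda$ and edge set $\{\{i,j\}\mid\beta_{ij}>0\}$ is connected. Bold symbols denote objects indexed by $\Lambda$; functions are Borel measurable. For $\boldsymbol{u}=(u_i)_{i\in\Lambda}\in(\mathbb{R}^n)^\Lambda$, $u_i=(u_i^1,\dots,u_i^n)$, let $|\boldsymbol{u}|^2=(u_i\cdot u_i)_{i\in\Lambda}$, $H_\beta(\boldsymbol{u})=\frac14\sum_{i,j\in\Lambda}\beta_{ij}|u_i-u_j|^2$, and $[F]_\beta=\int_{(\mathbb{R}^n)^\Lambda}F(\boldsymbol{u})e^{-H_\beta(\boldsymbol{u})}\,d\boldsymbol{u}$ (Lebesgue measure). $T_j=\partial/\partial u_j^1$. Simple random walk: $X_t$ is the Markov jump process on $\Lambda$ jumping from $i$ to $j$ at rate $\beta_{ij}$; $L_t^i=L_0^i+\int_0^t1_{X_s=i}\,ds$; under $\mathbb{E}_{i,\boldsymbol{\ell}}$, $X_0=i$ and $\boldsymbol{L}_0=\boldsymbol{\ell}$. The generator of $(X_t,\boldsymbol{L}_t)$ is $(\mathcal{L}f)(i,\boldsymbol{\ell})=\sum_{j\in\Lambda}\beta_{ij}\big(f(j,\boldsymbol{\ell})-f(i,\boldsymbol{\ell})\big)+\frac{\partial f(i,\boldsymbol{\ell})}{\partial\ell_i}$. Conventions: $f(i,\boldsymbol{\ell})$ is smooth / rapidly decaying if it is so in $\boldsymbol{\ell}$.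 A function $f$ has rapid decay if it has rapid decay in some coordinate $\ell_k$, uniformly in the other coordinates: for each $i$ there is $k\in\Lambda$ such that for every $p\ge0$, $\sup_{\boldsymbol{\ell}}(1+|\ell_k|)^p|f(i,\boldsymbol{\ell})|<\infty$, and, if $f$ is smooth, the same for all partial derivatives of $f$. A smooth $\rho$ has moderate growth if there are $q$ and $C_k$ with $|\nabla^k\rho(\boldsymbol{u})|\le C_k(1+|\boldsymbol{u}|)^q$ for all $k\geq 0$. *)

(* Defs.v *)
From HB Require Import structures.
From mathcomp Require Import all_boot all_order all_algebra.
From mathcomp Require Import all_classical all_reals all_analysis.

Set Implicit Arguments.
Unset Strict Implicit.
Unset Printing Implicit Defensive.
Import Order.TTheory GRing.Theory Num.Theory.
Import numFieldNormedType.Exports.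

Local Open Scope classical_set_scope.
Local Open Scope ring_scope.

Section lebesgue_tuple.
Context {R : realType}.

Definition cons_pair n (p : n.-tuple R * R) : n.+1.-tuple R :=
  [tuple of p.2 :: p.1].

Lemma measurable_cons_pair n :
  measurable_fun [set: n.-tuple R * R] (@cons_pair n).
Proof. exact: measurable_cons. Qed.

Fixpoint lebesgue_tuple n : set (n.-tuple R) -> \bar R :=
  match n with
  | 0 => dirac [tuple]
  | m.+1 => pushforward (lebesgue_tuple (n := m) \x lebesgue_measure)%E
                        (@cons_pair m)
  end.

Lemma lebesgue_tuple_measure n :
  exists mu : {measure set (n.-tuple R) -> \bar R},
    mu = @lebesgue_tuple n :> (set (n.-tuple R) -> \bar R).
Proof.
elim: n => [|n [mu muE]]; first by exists (dirac [tuple]).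
pose nu : {measure set (n.-tuple R * measurableTypeR R) -> \bar R} :=
  (mu \x @lebesgue_measure R)%E.
pose mu' : {measure set (n.+1.-tuple R) -> \bar R} :=
  pushforward nu (@cons_pair n).
by exists (mu' (@measurable_cons_pair n)); rewrite /= -muE.
Qed.

Let lebesgue_tuple0 n : @lebesgue_tuple n set0 = 0%E.
Proof. by have [mu <-] := lebesgue_tuple_measure n; exact: measure0. Qed.

Let lebesgue_tuple_ge0 n A : (0 <= @lebesgue_tuple n A)%E.
Proof. by have [mu <-] := lebesgue_tuple_measure n; exact: measure_ge0. Qed.

Let lebesgue_tuple_sigma_additive n : semi_sigma_additive (@lebesgue_tuple n).
Proof.
by have [mu <-] := lebesgue_tuple_measure n; exact: measure_semi_sigma_additive.
Qed.

HB.instance Definition _ n := isMeasure.Build _ _ _ (@lebesgue_tuple n)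
  (lebesgue_tuple0 n) (@lebesgue_tuple_ge0 n) (@lebesgue_tuple_sigma_additive n).

Lemma lebesgue_tuple_box n (A : 'I_n -> set R) :
  (forall i, measurable (A i)) ->
  lebesgue_tuple [set x | forall i, A i (tnth x i)] =
  (\prod_(i < n) lebesgue_measure (A i))%E.
Proof.
elim: n A => [|n IH] A mA.
  rewrite big_ord0 /= diracE mem_set//; by case.
rewrite big_ord_recl /= /pushforward.
have mbox : measurable [set x : n.-tuple R | forall i, A (lift ord0 i) (tnth x i)].
  have -> : [set x : n.-tuple R | forall i, A (lift ord0 i) (tnth x i)] =
      \bigcap_(i in [set: 'I_n]) ((@tnth n R ^~ i) @^-1` A (lift ord0 i)).
    apply/seteqP; split => x /= xA i; first by move=> _; exact: xA.
    exact: (xA i Logic.I).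
  apply: fin_bigcap_measurable => // i _.
  by rewrite -[X in measurable X]setTI; exact: measurable_tnth.
have -> : @cons_pair n @^-1` [set x | forall i, A i (tnth x i)] =
    [set x : n.-tuple R | forall i, A (lift ord0 i) (tnth x i)] `*` A ord0.
  apply/seteqP; split => [[x t] /= h|[x t] /= [hx ht] i].
    split; last exact: (h ord0).
    by move=> i; have := h (lift ord0 i); rewrite /cons_pair tnthS.
  by case: (unliftP ord0 i) => [j ->|->] //; rewrite /cons_pair tnthS; exact: hx.
rewrite [LHS](product_measure1E [the measure _ _ of @lebesgue_tuple n])//;
  last exact: mA.
rewrite muleC; congr *%E.
by apply: (IH (fun i => A (lift ord0 i))) => i; exact: mA.
Qed.

End lebesgue_tuple.

Section calculus.
Context {R : realType} {I : finType}.
Implicit Types (g : (I -> R) -> R) (x : I -> R).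

(* The enumeration of I identifies R^I with the tuples of length #|I|; both
   Borel measurability and integration on R^I are transported along it. *)
Definition coords (t : #|I|.-tuple R) : I -> R := fun i => tnth t (enum_rank i).

Definition borel g := measurable_fun [set: #|I|.-tuple R] (g \o coords).

Definition pderivable (i : I) g x :=
  derivable (fun t : R => g (dfwith x i t)) (x i) 1.

Definition pderiv (i : I) g : (I -> R) -> R :=
  fun x => (fun t : R => g (dfwith x i t))^`()%classic (x i).

Definition pderivs (s : seq I) g : (I -> R) -> R := foldr pderiv g s.

Definition smooth g := forall s : seq I,
  continuous (pderivs s g : {ptws I -> R} -> R) /\
  forall i x, pderivable i (pderivs s g) x.

Definition enorm x : R := Num.sqrt (\sum_i x i ^+ 2).

(* |nabla^k g|: Euclidean norm of the array of all k-th order partials. *)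
Definition nabla_norm k g x : R :=
  Num.sqrt (\sum_(s : k.-tuple I) pderivs s g x ^+ 2).

Definition moderate_growth g := exists (q : R) (C : nat -> R),
  forall k x, nabla_norm k g x <= C k * (1 + enorm x) `^ q.

Definition decays_in (k : I) g := forall p : R, 0 <= p ->
  exists C : R, forall x, (1 + `|x k|) `^ p * `|g x| <= C.

End calculus.

Section model.
Context {R : realType} {L : finType}.
Implicit Types (beta : L -> L -> R) (f : L -> (L -> R) -> R).

(* The second clause is empty for f that are not smooth. *)
Definition rapid_decay f := forall i, exists k, decays_in k (f i) /\
  ((forall j, smooth (f j)) -> forall s : seq L, decays_in k (pderivs s (f i))).

Definition generator beta f (i : L) (l : L -> R) : R :=
  \sum_j beta i j * (f j l - f i l) + pderiv i (f i) l.

Section spins.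
Variable n : nat.
(* A spin configuration u in (R^n)^L is a function on L * 'I_n. *)
Implicit Types (u : L * 'I_n -> R) (F : (L * 'I_n -> R) -> R).

Definition half_sq u : L -> R := fun i => 2^-1 * \sum_(a < n) u (i, a) ^+ 2.

Definition energy beta u : R :=
  4^-1 * \sum_i \sum_j beta i j * \sum_(a < n) (u (i, a) - u (j, a)) ^+ 2.

(* [Rintegral] is a total function, with value 0 on infinite integrals; that
   [F]_beta is well defined is this separate predicate. *)
Definition bracket_integrable beta F : Prop :=
  (lebesgue_tuple (n := #|{: L * 'I_n}|)).-integrable setT
    (fun t => (F (coords t) * expR (- energy beta (coords t)))%:E).

Definition bracket beta F : R :=
  \int[lebesgue_tuple (n := #|{: L * 'I_n}|)]_t
    (F (coords t) * expR (- energy beta (coords t))).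

End spins.

(* X is a Markov jump process on L, started from i under P i, which jumps from
   i to j at rate beta i j. Only times t >= 0 matter. *)
Record jump_process beta d (W : measurableType d) (P : L -> probability W R)
    (X : R -> W -> L) : Prop := JumpProcess {
  jp_measurable : forall (t : R) i, 0 <= t -> measurable (X t @^-1` [set i]);
  jp_right_continuous : forall w (t : R), 0 <= t ->
    \forall s \near t^'+, X s w = X t w;
  jp_left_limit : forall w (t : R), 0 < t ->
    exists i, \forall s \near t^'-, X s w = i;
  jp_start : forall i, P i (X 0 @^-1` [set i]) = 1%E;
  (* The past prescribes the values p.2 at finitely many times p.1 <= t. *)
  jp_markov : forall i (past : seq (R * L)) (t h : R) j k,
    (forall p, p \in past -> 0 <= p.1 <= t) -> 0 <= t -> 0 <= h ->
    let A := [set w | forall p, p \in past -> X p.1 w = p.2] `&`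
             X t @^-1` [set j] in
    P i (A `&` X (t + h) @^-1` [set k]) = (P i A * P j (X h @^-1` [set k]))%E;
  jp_rate : forall i j, i != j ->
    fine (P i (X h @^-1` [set j])) / h @[h --> 0^'+] --> beta i j
}.

Section local_time.
Context d {W : measurableType d} (P : L -> probability W R) (X : R -> W -> L).

(* L_t for initial local times L_0 = l. *)
Definition local_time (l : L -> R) (t : R) (w : W) : L -> R := fun i =>
  l i + \int[lebesgue_measure]_(s in `[0, t]) (X s w == i)%:R.

(* E_{j,l}(f(X_t, L_t)) *)
Definition walk_expect (j : L) (l : L -> R) f (t : R) : R :=
  fine 'E_(P j)[fun w => f (X t w) (local_time l t w)].

Definition walk_integrable (j : L) (l : L -> R) f : Prop :=
  (forall t, 0 <= t ->
    (P j).-integrable setT (fun w => (f (X t w) (local_time l t w))%:E)) /\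
  lebesgue_measure.-integrable `[0, +oo[ (fun t => (walk_expect j l f t)%:E).

End local_time.

End model.

(* Main.v *)
Require Import Defs.
From HB Require Import structures.
From mathcomp Require Import all_boot all_order all_algebra.
From mathcomp Require Import all_classical all_reals all_analysis.
From mathcomp Require Import measurable_realfun ring lra.

Set Implicit Arguments.
Unset Strict Implicit.
Unset Printing Implicit Defensive.
Import Order.TTheory GRing.Theory Num.Theory.
Import numFieldNormedType.Exports.

Local Open Scope classical_set_scope.
Local Open Scope ring_scope.

(**
The Ward identity is integration by parts in each [u_j^1], the integral of a
partial derivative of a rapidly decreasing function being zero by translation
invariance of Lebesgue measure. Connectedness bounds [|u|^2] by a multiple of
[(1 + |u_k|^2) * (1 + H_beta(u))], so that decay of [f] in a single [l_k]
together with the weight [exp(- H_beta)] makes every integrand rapidly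
decreasing.

For the integrated identity write [K_i h (j, l)] for the integral over time of
[E_{j,l}(1_{X_t = i} h(L_t))]. If [h(l) = exp(- lam . l)] with all [lam_m > 0],
then [K_i h (j, l) = h(l) V_j], where [V] is a resolvent of the walk with killing
rates [lam]; sampling the walk on a grid and letting the mesh tend to 0 gives
[lam_j V_j - sum_k beta_{jk} (V_k - V_j) = 1_{i = j}], that is
[generator (K_i h) = - 1_i h], and the Ward identity for [K_i h] is the
claim for [1_i h]. The Dirichlet form bounds the resolvent by [B / s] for
[lam = eps + s 1_k], whence [(1 + occupation_k)^-2] is integrable and [K_i h]
decays in [l_k] as soon as [h] does. Finally the functions [h] all of whose
products with exponentials satisfy the claim are closed under linear
combinations, products with exponentials and dominated limits; since
[1_{x <= a} = lim_n 1 - (1 - exp(- n x))^(M_n)] with [M_n ~ n exp(n a)], they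
contain all products of a Borel indicator with [exp(- sum l)], and hence every
Borel [h] with decay.
*)

(** * Integration of rapidly decreasing functions *)

Section lebesgue_tuple_theory.
Context {R : realType}.

(** For a Borel [f] there is nothing to differentiate, and for a smooth one differentiation under
    the time integral would still have to be justified. Exponentials avoid both: additivity of local
    time turns the generator equation for [K_i h] into a finite linear system in [V]. States [i] are
    treated one at a time because rapid decay may use a different coordinate [k] for each [f i]. An
    exponential decays only on the orthant l >= 0, which contains every |u|^2 / 2 and is never left
    as local times grow; hence the estimates are phrased with [orthant_decay]. The walk is known
    only through its Markov property at finitely many times and its jump rates at time 0+, so the
    resolvent equation comes from a grid rather than from holding times. The power -2 of 1 +
    occupation_k is chosen so that the scales s = 2^-n, weighted by 4^-n, meet the bound B / s in a
    convergent series. *)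

Lemma measurable_box n (A : 'I_n -> set R) : (forall i, measurable (A i)) ->
  measurable [set x : n.-tuple R | forall i, A i (tnth x i)].
Proof.
move=> mA; have -> : [set x : n.-tuple R | forall i, A i (tnth x i)] =
    \bigcap_(i in [set: 'I_n]) ((@tnth n R ^~ i) @^-1` A i).
  by apply/seteqP; split => x /= xA i; [move=> _; exact: xA|exact: (xA i Logic.I)].
apply: fin_bigcap_measurable => // i _.
by rewrite -[X in measurable X]setTI; exact: measurable_tnth.
Qed.

Lemma lebesgue_tuple_sigma_finite n :
  sigma_finite [set: n.-tuple R] (@lebesgue_tuple R n).
Proof.
exists (fun k => [set x | forall i, `[- k%:R, k%:R]%classic (tnth x i)]).
  apply/seteqP; split => // x _.
  have [k kx] : exists k : nat, forall i, `|tnth x i| <= k%:R.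
    exists (\max_(i < n) (Num.truncn `|tnth x i|).+1)%N => i.
    apply: (@le_trans _ _ (Num.truncn `|tnth x i|).+1%:R); first exact/ltW/truncnS_gt.
    by rewrite ler_nat (@leq_bigmax _ (fun i => (Num.truncn `|tnth x i|).+1)).
  by exists k => // i /=; rewrite in_itv /= -ler_norml.
move=> k; split.
  by apply: (@measurable_box _ (fun=> `[- k%:R, k%:R]%classic)) => i; exact: measurable_itv.
rewrite (@lebesgue_tuple_box _ _ (fun=> `[- k%:R, k%:R]%classic)); last by move=> i; exact: measurable_itv.
have H : lebesgue_measure (`[- k%:R, k%:R]%classic : set R) \is a fin_num.
  by rewrite lebesgue_measure_itv /=; case: ifP => // _; rewrite -EFinN -EFinD.
rewrite -ge0_fin_numE; last by apply: prode_ge0.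
by elim/big_ind: _ => // x y; exact: fin_numM.
Qed.

HB.instance Definition _ n := Measure_isSigmaFinite.Build _ _ _ (@lebesgue_tuple R n)
  (@lebesgue_tuple_sigma_finite n).

Local Open Scope ereal_scope.

Lemma ge0_integral_lebesgue_tupleS n (f : n.+1.-tuple R -> \bar R) :
  measurable_fun [set: n.+1.-tuple R] f -> (forall x, 0 <= f x) ->
  \int[@lebesgue_tuple R n.+1]_x f x =
  \int[@lebesgue_tuple R n]_x \int[lebesgue_measure]_t f (cons_pair (x, t)).
Proof.
move=> mf f0.
transitivity (\int[(lebesgue_tuple (n := n) \x lebesgue_measure)]_z f (@cons_pair R n z)).
  rewrite -[LHS]/(\int[pushforward (lebesgue_tuple (n := n) \x lebesgue_measure)%E
                        (@cons_pair R n)]_x f x).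
  rewrite ge0_integral_pushforward//; exact: measurable_cons_pair.
have := @fubini_tonelli1 _ _ _ _ R (@lebesgue_tuple R n) (@lebesgue_measure R) (f \o @cons_pair R n).
move=> H; apply: (H _ (fun z => f0 (cons_pair z))).

by apply: measurableT_comp => //; exact: measurable_cons_pair.
Qed.

(** The pushforward of Lebesgue measure under the translation gives every half-open interval its
    length, hence is Lebesgue measure by uniqueness. *)
Lemma ge0_integral_lebesgue_shift (f : R -> \bar R) (a : R) :
  measurable_fun setT f -> (forall x, 0 <= f x) ->
  \int[lebesgue_measure]_t f (t + a)%R = \int[lebesgue_measure]_t f t.
Proof.
move=> mf f0; pose s := (fun t => t + a)%R : measurableTypeR R -> measurableTypeR R.
have ma : measurable_fun [set: measurableTypeR R] s.
  by apply: measurable_funD => //; exact: measurable_cst.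
pose mu : {measure set (measurableTypeR R) -> \bar R} := pushforward lebesgue_measure s.
rewrite -[RHS](_ : \int[mu ma]_t f t = _); first by rewrite ge0_integral_pushforward.
apply: eq_measure_integral => A mA _; apply/esym/lebesgue_measure_unique => //.
move=> X [[x y] _ <-] /=; rewrite /mu/= /pushforward.
have -> : (fun t => t + a)%R @^-1` `]x, y] = `](x - a)%R, (y - a)%R]%classic.
  by apply/seteqP; split=> t /=; rewrite !in_itv/= ltrBlDr lerBrDr.
rewrite !lebesgue_measure_itv/= !lte_fin ltrBlDr subrK -!EFinD.
by case: ifP => // _; congr (_%:E); ring.
Qed.

Definition shift_tuple n (v : 'I_n -> R) (x : n.-tuple R) : n.-tuple R :=
  [tuple tnth x i + v i | i < n]%R.

Lemma measurable_shift_tuple n (v : 'I_n -> R) :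
  measurable_fun [set: n.-tuple R] (shift_tuple v).
Proof.
apply/measurable_fun_tnthP => i.
rewrite (_ : _ \o _ = fun x => tnth x i + v i)%R; last first.
  by apply/funext => x /=; rewrite /shift_tuple tnth_mktuple.
by apply: measurable_funD; [exact: measurable_tnth|exact: measurable_cst].
Qed.

Lemma ge0_integral_lebesgue_tuple_shift n (v : 'I_n -> R) (f : n.-tuple R -> \bar R) :
  measurable_fun [set: n.-tuple R] f -> (forall x, 0 <= f x) ->
  \int[@lebesgue_tuple R n]_x f (shift_tuple v x) = \int[@lebesgue_tuple R n]_x f x.
Proof.
elim: n v f => [|n IH] v f mf f0.
  by apply: eq_integral => x _; congr (f _); apply: eq_from_tnth => -[].
rewrite ge0_integral_lebesgue_tupleS//; last first.
  by apply: measurableT_comp => //; exact: measurable_shift_tuple.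
rewrite ge0_integral_lebesgue_tupleS//.
pose g x := \int[lebesgue_measure]_t f (cons_pair (x, t)).
have mg : measurable_fun [set: n.-tuple R] g.
  apply: (@measurable_fun_fubini_tonelli_F _ _ _ _ R (@lebesgue_measure R)
    (f \o @cons_pair R n) _ (fun z => f0 (cons_pair z))).
  by apply: measurableT_comp => //; exact: measurable_cons_pair.
rewrite -(IH (fun i => v (lift ord0 i)) g)//; last by move=> x; exact: integral_ge0.
apply: eq_integral => x _; rewrite /g.
set y := shift_tuple _ x.
rewrite -(ge0_integral_lebesgue_shift (f := fun t => f (cons_pair (y, t))) (v ord0))//; last first.
  have mcons : measurable_fun [set: R] (fun t => @cons_pair R n (y, t)).
    by apply: (measurableT_comp (@measurable_cons_pair R n)); exact: pair1_measurable.
  exact: (measurableT_comp mf mcons).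
apply: eq_integral => t _; congr f; apply: eq_from_tnth => i.
rewrite tnth_mktuple; case: (unliftP ord0 i) => [j ->|->].
  by rewrite /cons_pair !tnthS tnth_mktuple.
by rewrite /cons_pair !tnth0.
Qed.

End lebesgue_tuple_theory.

Section envelope.
Context {R : realType}.
Local Open Scope ereal_scope.

Lemma oneDsqr_integral_fin :
  \int[lebesgue_measure]_x ((1 + (x : R) ^+ 2)^-1)%:E < +oo.
Proof.
rewrite [X in X < _](_ : _ = \int[lebesgue_measure]_x ((oneDsqr (x : R))^-1)%:E)//.
rewrite ge0_symfun_integralT//=.
- rewrite -set_itvcy integral0y_oneDsqr -EFinM; exact: ltry.
- exact: continuous_oneDsqrV.
- by move=> x; rewrite /= /oneDsqr sqrrN.
Qed.

Lemma prod_oneDsqr_integral_fin n :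
  \int[@lebesgue_tuple R n]_x (\prod_(i < n) (1 + tnth x i ^+ 2)^-1)%:E < +oo.
Proof.
have pos m (x : m.-tuple R) : (0 <= \prod_(i < m) (1 + tnth x i ^+ 2)^-1)%R.
  by apply: prodr_ge0 => i _; rewrite invr_ge0 addr_ge0 ?sqr_ge0.
have ms m : measurable_fun [set: m.-tuple R]
    (fun x : m.-tuple R => \prod_(i < m) (1 + tnth x i ^+ 2)^-1)%R.
  apply: measurable_prod => i _.
  apply: (@measurableT_comp _ _ _ _ _ _ (fun y : R => (1 + y ^+ 2)^-1)%R); last first.
    exact: measurable_tnth.
  exact: (continuous_measurable_fun (@continuous_oneDsqrV R)).
elim: n => [|n IH].
  have -> : @lebesgue_tuple R 0 = dirac [tuple] by [].
  rewrite integral_dirac//; last by apply/measurable_EFinP; exact: ms.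
  by rewrite diracE mem_set// mul1e ltry.
rewrite ge0_integral_lebesgue_tupleS//; last 2 first.
- by apply/measurable_EFinP; exact: ms.
- by move=> x; rewrite lee_fin.
pose c := \int[lebesgue_measure]_x ((1 + (x : R) ^+ 2)^-1)%:E.
have c0 : 0 <= c by apply: integral_ge0 => x _; rewrite lee_fin invr_ge0 addr_ge0 ?sqr_ge0.
rewrite (eq_integral (fun x : n.-tuple R => (\prod_(i < n) (1 + tnth x i ^+ 2)^-1)%:E * c)); last first.
  move=> x _; rewrite -ge0_integralZl//.
  - by apply: eq_integral => t _; rewrite -EFinM big_ord_recl mulrC /cons_pair tnth0/=;
      congr (_ * _)%:E; apply: eq_bigr => i _; rewrite tnthS.
  - by apply/measurable_EFinP; exact: (continuous_measurable_fun (@continuous_oneDsqrV R)).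
  - by move=> t _; rewrite lee_fin invr_ge0 addr_ge0 ?sqr_ge0.
  - by rewrite lee_fin.
rewrite ge0_integralZr//; last 2 first.
- by apply/measurable_EFinP; exact: ms.
- by move=> x _; rewrite lee_fin.
have cf : c \is a fin_num by rewrite ge0_fin_numE// oneDsqr_integral_fin.
rewrite -ge0_fin_numE; last by apply: mule_ge0 => //; apply: integral_ge0 => x _; rewrite lee_fin.
rewrite fin_numM// ge0_fin_numE//.
by apply: integral_ge0 => x _; rewrite lee_fin.
Qed.

End envelope.

Section rapidly_decreasing.
Context {R : realType} {I : finType}.
Implicit Types (F G : (I -> R) -> R) (x : I -> R).

(** The square of the Japanese bracket of x; leaving out the square root keeps all weights
    polynomial. *)
Definition japanese x : R := 1 + \sum_i x i ^+ 2.

Lemma japanese_ge1 x : 1 <= japanese x.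
Proof. by rewrite lerDl sumr_ge0// => i _; exact: sqr_ge0. Qed.

Lemma japanese_gt0 x : 0 < japanese x.
Proof. exact: lt_le_trans ltr01 (japanese_ge1 x). Qed.

Lemma sqr_le_japanese x i : x i ^+ 2 <= japanese x.
Proof.
rewrite /japanese (bigD1 i)//= addrCA lerDl addr_ge0// sumr_ge0// => j _.
exact: sqr_ge0.
Qed.

Definition rapidly_decreasing F := forall N : nat,
  exists C : R, forall x, `|F x| * japanese x ^+ N <= C.

Definition poly_bounded F := exists (N : nat) (C : R),
  forall x, `|F x| <= C * japanese x ^+ N.

Lemma rapidly_decreasingM F G :
  poly_bounded F -> rapidly_decreasing G -> rapidly_decreasing (F \* G).
Proof.
move=> [m [C FC]] dG N; have [D GD] := dG (m + N)%N.
have C0 : 0 <= C.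
  have := le_trans (normr_ge0 _) (FC (fun=> 0)).
  by rewrite pmulr_lge0// exprn_gt0// japanese_gt0.
exists (C * D) => x; rewrite normrM.
apply: (@le_trans _ _ (C * (`|G x| * japanese x ^+ (m + N)))).
  rewrite exprD (_ : C * _ = (C * japanese x ^+ m) * (`|G x| * japanese x ^+ N)); last by ring.
  rewrite -[leLHS]mulrA ler_wpM2r// mulr_ge0// exprn_ge0// ltW// japanese_gt0//.
by rewrite ler_wpM2l.
Qed.

Lemma rapidly_decreasingD F G : rapidly_decreasing F -> rapidly_decreasing G ->
  rapidly_decreasing (F \+ G).
Proof.
move=> dF dG N; have [C FC] := dF N; have [D GD] := dG N.
exists (C + D) => x; apply: le_trans (lerD (FC x) (GD x)).
by rewrite -mulrDl ler_wpM2r ?ler_normD// exprn_ge0// ltW// japanese_gt0.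
Qed.

Lemma poly_boundedM F G : poly_bounded F -> poly_bounded G -> poly_bounded (F \* G).
Proof.
move=> [m [C FC]] [n [D GD]]; exists (m + n)%N, (C * D) => x.
by rewrite normrM exprD mulrACA ler_pM.
Qed.

Lemma poly_boundedD F G : poly_bounded F -> poly_bounded G -> poly_bounded (F \+ G).
Proof.
move=> [m [C FC]] [n [D GD]]; exists (m + n)%N, (`|C| + `|D|) => x.
apply: le_trans (ler_normD _ _) _; rewrite mulrDl lerD//.
  apply: le_trans (FC x) _; apply: le_trans (ler_wpM2r _ (ler_norm C)) _.
    by rewrite exprn_ge0// ltW// japanese_gt0.
  by rewrite ler_wpM2l// ler_weXn2l ?leq_addr// japanese_ge1.
apply: le_trans (GD x) _; apply: le_trans (ler_wpM2r _ (ler_norm D)) _.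
  by rewrite exprn_ge0// ltW// japanese_gt0.
by rewrite ler_wpM2l// ler_weXn2l ?leq_addl// japanese_ge1.
Qed.

Lemma poly_bounded_cst a : poly_bounded (fun=> a).
Proof. by exists 0%N, `|a| => x; rewrite expr0 mulr1. Qed.

Lemma poly_bounded_sum (J : Type) (s : seq J) (F : J -> (I -> R) -> R) :
  (forall j, poly_bounded (F j)) -> poly_bounded (fun x => \sum_(j <- s) F j x).
Proof.
move=> pF; elim: s => [|j s IH].
  have := poly_bounded_cst 0.
  by congr poly_bounded; apply/funext => x; rewrite big_nil.
have := poly_boundedD (pF j) IH.
by congr poly_bounded; apply/funext => x; rewrite big_cons.
Qed.

Lemma poly_bounded_coord i : poly_bounded (fun x => x i).
Proof.
exists 1%N, 1 => x; rewrite mul1r expr1.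
have := sqr_le_japanese x i; have := japanese_ge1 x.
by rewrite ler_norml => ? ?; apply/andP; split; nra.
Qed.

(** A product of unnormalised Cauchy densities. Each factor 1 + x_i^2 is at most [japanese x], so
    decay of order [#|I|] already gives integrability; this is the dominating function behind every
    integral over R^I of a rapidly decreasing function. *)
Definition japanese_dominator : #|I|.-tuple R -> \bar R :=
  fun t => (\prod_(i < #|I|) (1 + tnth t i ^+ 2)^-1)%:E.

Lemma japanese_coords (t : #|I|.-tuple R) :
  (japanese (coords t) ^+ #|I|)^-1 <= \prod_(i < #|I|) (1 + tnth t i ^+ 2)^-1.
Proof.
rewrite prodfV lef_pV2 ?posrE; last 2 first.
- by rewrite exprn_gt0 ?japanese_gt0.
- by rewrite prodr_gt0// => i _; rewrite ltr_pwDl// sqr_ge0.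
rewrite -[X in _ <= _ ^+ X]card_ord -prodr_const ler_prod// => i _.
rewrite addr_ge0 ?sqr_ge0//= lerD2l.
rewrite (bigD1 (enum_val i))//= /coords enum_valK lerDl sumr_ge0// => j _.
exact: sqr_ge0.
Qed.

Lemma japanese_dominator_integrable :
  (@lebesgue_tuple R #|I|).-integrable setT japanese_dominator.
Proof.
apply/integrableP; split.
  apply/measurable_EFinP; apply: measurable_prod => i _.
  apply: (@measurableT_comp _ _ _ _ _ _ (fun y : R => (1 + y ^+ 2)^-1)%R).
    exact: (continuous_measurable_fun (@continuous_oneDsqrV R)).
  exact: measurable_tnth.
apply: le_lt_trans (@prod_oneDsqr_integral_fin R #|I|); rewrite le_eqVlt; apply/orP; left.
apply/eqP; apply: eq_integral => t _; rewrite abse_EFin ger0_norm//.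
by apply: prodr_ge0 => i _; rewrite invr_ge0 addr_ge0 ?sqr_ge0.
Qed.

Lemma rapidly_decreasing_integrable F : borel F -> rapidly_decreasing F ->
  (@lebesgue_tuple R #|I|).-integrable setT (fun t => (F (coords t))%:E).
Proof.
move=> mF dF; have [C FC] := dF #|I|.
have C0 : 0 <= C.
  by apply: le_trans (FC (fun=> 0)); rewrite mulr_ge0// exprn_ge0// ltW// japanese_gt0.
apply: (@le_integrable _ _ _ _ _ measurableT _ (fun t => (C%:E * japanese_dominator t)%E)).
- by apply/measurable_EFinP.
- move=> t _; rewrite -EFinM !abse_EFin lee_fin.
  rewrite [leRHS]ger0_norm; last first.
    by rewrite mulr_ge0// prodr_ge0// => i _; rewrite invr_ge0 addr_ge0 ?sqr_ge0.
  apply: le_trans (ler_wpM2l C0 (japanese_coords t)).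
  by rewrite ler_pdivlMr ?FC// exprn_gt0// japanese_gt0.
- by apply: integrableZl => //; exact: japanese_dominator_integrable.
Qed.

End rapidly_decreasing.

(** * Borel functions on R^I *)

Section borel_functions.
Context {R : realType} {I : finType}.
Implicit Types (g : (I -> R) -> R).

Lemma measurable_coord (i : I) : measurable_fun [set: #|I|.-tuple R] (fun t => coords t i).
Proof. exact: measurable_tnth. Qed.

(** [borel] speaks of tuples; rebuilding the tuple from its coordinates allows a Borel function to
    be composed with any family that is measurable coordinate by coordinate, in particular with
    random local times. *)
Lemma measurable_fun_borel d (T : measurableType d) (phi : T -> I -> R) g :
  (forall i, measurable_fun [set: T] (phi ^~ i)) -> borel g ->
  measurable_fun [set: T] (fun x => g (phi x)).
Proof.
move=> mphi mg.
pose tau x : #|I|.-tuple R := [tuple phi x (enum_val k) | k < #|I|].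
have coordsK x : coords (tau x) = phi x.
  by apply/funext => i; rewrite /coords tnth_mktuple enum_rankK.
have mtau : measurable_fun [set: T] tau.
  apply/measurable_fun_tnthP => k.
  rewrite (_ : _ \o _ = phi ^~ (enum_val k)); first exact: mphi.
  by apply/funext => x /=; rewrite tnth_mktuple.
rewrite (_ : (fun x => _) = (g \o coords) \o tau); first exact: measurableT_comp.
by apply/funext => x /=; rewrite coordsK.
Qed.

Lemma borel_comp (J : finType) (phi : (J -> R) -> I -> R) g :
  (forall i, borel (phi ^~ i)) -> borel g -> borel (g \o phi).
Proof. by move=> mphi; apply: measurable_fun_borel => i; exact: mphi. Qed.

Lemma measurable_countable_range d (T : measurableType d) (K : countType) (k : T -> K)
    (h : K -> R) :
  (forall a, measurable (k @^-1` [set a])) -> measurable_fun [set: T] (h \o k).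
Proof.
move=> mk _ Y mY; rewrite setTI.
have -> : (h \o k) @^-1` Y = \bigcup_n (if unpickle n is Some a then
    k @^-1` ([set a] `&` (h @^-1` Y)) else set0).
  apply/seteqP; split=> [x Yx|x [n _]] /=.
    by exists (pickle (k x)) => //=; rewrite pickleK.
  by case: unpickle => //= a [/= _ ?].
apply: bigcupT_measurable => n; case: unpickle => // a.
have [Yha|Yha] := pselect (Y (h a)).
  rewrite (_ : _ `&` _ = [set a])//; apply/seteqP; split=> b /=; first by case.
  by move=> ->.
by rewrite (_ : _ `&` _ = set0) ?preimage_set0//; apply/seteqP; split=> b //= -[->].
Qed.

Lemma cvg_ptws (x_ : nat -> I -> R) (x : I -> R) :
  (forall i, x_ n i @[n --> \oo] --> x i) ->
  (x_ n : {ptws I -> R}) @[n --> \oo] --> (x : {ptws I -> R}).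
Proof.
move=> xx; apply/(@pointwise_cvgP (discrete_topology I) R) => i; exact: xx.
Qed.

(** Rounding every coordinate down to a multiple of 1 / (n + 1) gives functions of a measurable map
    with countable range; they converge pointwise to [g] because [g] is continuous for
    coordinatewise convergence. *)
Lemma borel_continuous g : continuous (g : {ptws I -> R} -> R) -> borel g.
Proof.
move=> cg.
pose k (n : nat) (t : #|I|.-tuple R) : {ffun I -> int} := [ffun i => Num.floor (n.+1%:R * coords t i)].
pose h (n : nat) (z : {ffun I -> int}) : R := g (fun i => (z i)%:~R / n.+1%:R).
apply: (@measurable_fun_cvg _ _ _ _ (fun n => h n \o k n)) => [n|t _].
  apply: measurable_countable_range => a.
  rewrite (_ : _ @^-1` _ = [set t | forall m : 'I_#|I|,
      [set y : R | Num.floor (n.+1%:R * y) = a (enum_val m)] (tnth t m)]).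
    apply: (@measurable_box _ _ (fun m => [set y : R | Num.floor (n.+1%:R * y) = a (enum_val m)])) => m.
    have mf : measurable_fun [set: R] (fun y : R => (Num.floor (n.+1%:R * y))%:~R : R).
      apply: nondecreasing_measurable => // x y xy.
      by rewrite ler_int le_floor// ler_pM2l.
    rewrite -[X in measurable X]setTI.
    rewrite (_ : [set _ | _] = (fun y : R => (Num.floor (n.+1%:R * y))%:~R : R) @^-1`
        [set (a (enum_val m))%:~R]).
      exact: (mf measurableT).
    by apply/seteqP; split => y /= => [->//|/intr_inj].
  apply/seteqP; split => s /=.
    by move=> + m => <-; rewrite ffunE /coords enum_valK.
  by move=> s_a; apply/ffunP => i; rewrite ffunE /coords s_a enum_rankK.
pose xn (n : nat) (i : I) : R := (k n t i)%:~R / n.+1%:R.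
have xnt : (xn n : {ptws I -> R}) @[n --> \oo] --> (coords t : {ptws I -> R}); last first.
  have H := @cvg_comp _ _ _ (xn : nat -> {ptws I -> R}) (g : {ptws I -> R} -> R) _ _ _ xnt (cg (coords t)).
  exact: H.
apply: cvg_ptws => i; rewrite /xn.
rewrite /k /=; set y := coords t i.
apply: (@squeeze_cvgr _ _ _ _ (fun n => y - n.+1%:R^-1) (fun=> y)); last exact: cvg_cst.
  apply: nearW => n; rewrite ffunE lerBlDr -[X in _ + X]mul1r -mulrDl ler_pdivlMr// ler_pdivrMr//.
  by rewrite mulrC -[_ + 1](@intrD _ _ 1) floor_le andbT ltW// floorD1_gt.
by rewrite -[X in _ --> X]subr0; apply: cvgB; [exact: cvg_cst|exact: cvg_harmonic].
Qed.

End borel_functions.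

(** * Vanishing integrals of partial derivatives *)

Section integration_by_parts.
Context {R : realType} {I : finType}.
Implicit Types (G : (I -> R) -> R) (x : I -> R).

Lemma dfwith_dfwith x c (s t : R) : dfwith (dfwith x c s) c t = dfwith x c t.
Proof.
apply/funext => i; case: (dfwithP (dfwith x c s) t i) => [|j cj]; first by rewrite dfwithin.
by rewrite !dfwithout.
Qed.

Lemma dfwith_id x c : dfwith x c (x c) = x.
Proof. by apply/funext => i; case: (dfwithP x (x c) i). Qed.

Lemma integral_lebesgue_tuple_shift n (v : 'I_n -> R) (f : n.-tuple R -> \bar R) :
  measurable_fun [set: n.-tuple R] f ->
  (\int[@lebesgue_tuple R n]_x f (shift_tuple v x) = \int[@lebesgue_tuple R n]_x f x)%E.
Proof.
move=> mf; rewrite integralE [RHS]integralE.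
rewrite -(@ge0_integral_lebesgue_tuple_shift _ _ v f^\+%E)//; last exact: measurable_funepos.
rewrite -(@ge0_integral_lebesgue_tuple_shift _ _ v f^\-%E)//; last exact: measurable_funeneg.
by congr (_ - _)%E; apply: eq_integral => x _; rewrite ?funeposE ?funenegE.
Qed.

(** With y = x c, the bound y^2 <= 2 (y + s)^2 + 2 s^2 and |s| <= 1 give the factor 3. It makes the
    bound on difference quotients uniform over all steps of length at most 1. *)
Lemma japanese_shift x c (s : R) : `|s| <= 1 ->
  japanese x <= 3 * japanese (dfwith x c (x c + s)).
Proof.
rewrite ler_norml => /andP[s1 s2].
rewrite /japanese !(bigD1 (P := predT) c)//= dfwithin.
have -> : \sum_(i | i != c) dfwith x c (x c + s) i ^+ 2 = \sum_(i | i != c) x i ^+ 2.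
  by apply: eq_bigr => i ic; rewrite dfwithout// eq_sym.
have : 0 <= \sum_(i | i != c) x i ^+ 2 by apply: sumr_ge0 => i _; exact: sqr_ge0.
move: (\sum_(i | i != c) x i ^+ 2) (x c) => S y S0.
have := sqr_ge0 (y + 2 * s); have := sqr_ge0 (y + s).
have : s ^+ 2 <= 1 by nra.
rewrite !expr2; nra.
Qed.

Lemma pderivable_is_derive G x c (t : R) : (forall y, pderivable c G y) ->
  is_derive t 1 (fun s => G (dfwith x c s)) (pderiv c G (dfwith x c t)).
Proof.
move=> dG; have := dG (dfwith x c t); rewrite /pderivable /pderiv dfwithin.
rewrite (_ : (fun s => G (dfwith (dfwith x c t) c s)) = (fun s => G (dfwith x c s))); last first.
  by apply/funext => s; rewrite dfwith_dfwith.
by move=> dGt; rewrite derive1E; exact: derivableP.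
Qed.

Lemma pderiv_mean_value G x c (h : R) : 0 < h -> (forall y, pderivable c G y) ->
  exists2 s, 0 < s < h &
    G (dfwith x c (x c + h)) - G x = pderiv c G (dfwith x c (x c + s)) * h.
Proof.
move=> h0 dG.
have [|y _||r] := @MVT R (fun s => G (dfwith x c s)) (fun s => pderiv c G (dfwith x c s)) (x c) (x c + h).
- by rewrite ltrDl.
- exact: pderivable_is_derive.
- apply: derivable_within_continuous => y _.
  by have [] := pderivable_is_derive x y dG.
rewrite in_itv /= => /andP[r1 r2]; rewrite dfwith_id addrAC subrr add0r => Gr.
exists (r - x c); first by rewrite subr_gt0 r1/= ltrBlDl.
by rewrite [x c + (r - _)]addrC subrK.
Qed.

Lemma cvg_difference_quotient G x c : pderivable c G x ->
  n.+1%:R * (G (dfwith x c (x c + n.+1%:R^-1)) - G x) @[n --> \oo] --> pderiv c G x.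
Proof.
move=> dG; rewrite /pderiv derive1E.
have /cvg_at_rightP := cvg_dnbhs_at_right dG.
move=> /(_ (fun n => n.+1%:R^-1)) /=.
have h0 : (forall n, 0 < n.+1%:R^-1 :> R) /\ (n.+1%:R^-1 : R) @[n --> \oo] --> (0 : R).
  by split=> [n|]; [rewrite invr_gt0 ltr0n|exact: cvg_harmonic].
move=> /(_ h0); apply: cvg_trans; apply: near_eq_cvg; apply: nearW => n.
by rewrite invrK dfwith_id /= /shift /= [_ *: 1]mulr1 [_ + x c]addrC.
Qed.

(** The difference quotients [D n] have integral zero by translation invariance. By the mean value
    theorem each is a value of the derivative at a point within distance 1, so rapid decay of the
    derivative dominates all of them at once and the limit passes under the integral. *)
Lemma integral_pderiv_eq0 G c : (forall x, pderivable c G x) ->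
  borel G -> borel (pderiv c G) ->
  rapidly_decreasing G -> rapidly_decreasing (pderiv c G) ->
  \int[@lebesgue_tuple R #|I|]_t pderiv c G (coords t) = 0.
Proof.
move=> dG mG mdG rG rdG.
pose S (n : nat) (t : #|I|.-tuple R) :=
  shift_tuple (fun k => if k == enum_rank c then n.+1%:R^-1 else 0) t.
have coordsS n t : coords (S n t) = dfwith (coords t) c (coords t c + n.+1%:R^-1).
  apply/funext => i; rewrite /coords tnth_mktuple.
  case: (dfwithP (coords t) _ i) => [|j cj]; first by rewrite eqxx.
  by rewrite (inj_eq enum_rank_inj) eq_sym (negbTE cj) addr0.
pose D (n : nat) (t : #|I|.-tuple R) : R :=
  n.+1%:R * (G (coords (S n t)) - G (coords t)).
have iG : (@lebesgue_tuple R #|I|).-integrable setT (fun t => (G (coords t))%:E).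
  exact: rapidly_decreasing_integrable.
have mGS n : measurable_fun [set: #|I|.-tuple R] (fun t => (G (coords (S n t)))%:E).
  apply/measurable_EFinP.
  exact: (measurableT_comp mG (measurable_shift_tuple _)).
have iGS n : (@lebesgue_tuple R #|I|).-integrable setT (fun t => (G (coords (S n t)))%:E).
  apply/integrableP; split => //.
  rewrite (@integral_lebesgue_tuple_shift _ _ (fun t => `|(G (coords t))%:E|)%E).
    by have /integrableP[] := iG.
  by apply: measurableT_comp => //; apply/measurable_EFinP.
have D0 n : (\int[@lebesgue_tuple R #|I|]_t (D n t)%:E = 0)%E.
  rewrite /D; under eq_integral do rewrite EFinM EFinB.
  rewrite integralZl//; last exact: integrableB.
  rewrite integralB// (@integral_lebesgue_tuple_shift _ _ (fun t => (G (coords t))%:E)).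
    by rewrite subee ?mule0// integrable_fin_num.
  exact/measurable_EFinP.
have [C FC] := rdG #|I|.
have C0 : 0 <= C.
  by apply: le_trans (FC (fun=> 0)); rewrite mulr_ge0// exprn_ge0// ltW// japanese_gt0.
have Dle n t : `|D n t| <= C * 3 ^+ #|I| * (japanese (coords t) ^+ #|I|)^-1.
  rewrite /D coordsS.
  have n0 : 0 < n.+1%:R^-1 :> R by [].
  have [s /andP[s0 sn] ->] := pderiv_mean_value (coords t) n0 dG.
  rewrite mulrCA mulfV// mulr1.
  have s1 : `|s| <= 1.
    by rewrite gtr0_norm// (le_trans (ltW sn))// invf_le1// ler1n.
  rewrite ler_pdivlMr ?exprn_gt0 ?japanese_gt0//.
  apply: le_trans (ler_wpM2r _ (FC (dfwith (coords t) c (coords t c + s)))); last exact: exprn_ge0.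
  rewrite -mulrA ler_wpM2l// -exprMn lerXn2r// ?nnegrE ?mulr_ge0 ?(ltW (japanese_gt0 _))//.
  by rewrite mulrC japanese_shift.
have := @dominated_convergence _ _ _ (@lebesgue_tuple R #|I|) setT measurableT
  (fun n t => (D n t)%:E) (fun t => (pderiv c G (coords t))%:E)
  (fun t => ((C * 3 ^+ #|I|)%:E * japanese_dominator t)%E).
case.
- move=> n; apply/measurable_EFinP; apply: measurable_funM => //.
  by apply: measurable_funB; [by apply/measurable_EFinP; exact: mGS|exact: mG].
- by apply/measurable_EFinP; exact: mdG.
- apply: aeW => t _; apply: cvg_EFin; first exact: nearW.
  rewrite (_ : _ \o _ = (fun n => D n t)); last by apply/funext.
  rewrite /D; under eq_fun do rewrite coordsS.
  exact: cvg_difference_quotient.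
- by apply: integrableZl => //; exact: japanese_dominator_integrable.
- apply: aeW => t n _; rewrite -EFinM abse_EFin lee_fin.
  apply: le_trans (Dle n t) _; rewrite ler_wpM2l ?mulr_ge0//.
  exact: japanese_coords.
move=> _ _; rewrite (_ : (fun n => _) = cst 0%E); last by apply/funext => n; rewrite D0.
by move=> /(cvg_lim (@ereal_hausdorff R)); rewrite lim_cst// /Rintegral => <-.
Qed.

End integration_by_parts.

(** * Coercivity of the energy and the Ward identity *)

Section coercivity.
Context {R : realType} {L : finType} (beta : L -> L -> R).
Hypothesis beta_ge0 : forall i j, 0 <= beta i j.
Hypothesis beta_connected : forall i j, connect (fun i j => 0 < beta i j) i j.

Definition dirichlet_form (x : L -> R) : R := \sum_i \sum_j beta i j * (x i - x j) ^+ 2.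

Lemma dirichlet_form_ge0 x : 0 <= dirichlet_form x.
Proof. by do 2!(apply: sumr_ge0 => ? _); rewrite mulr_ge0// sqr_ge0. Qed.

Lemma dirichlet_form_edge x i j : beta i j * (x i - x j) ^+ 2 <= dirichlet_form x.
Proof.
rewrite /dirichlet_form (bigD1 i)//= (bigD1 j)//= -addrA lerDl addr_ge0//.
  by apply: sumr_ge0 => k _; rewrite mulr_ge0// sqr_ge0.
by do 2!(apply: sumr_ge0 => ? _); rewrite mulr_ge0// sqr_ge0.
Qed.

(** Along a path from i to k, (a + b)^2 <= 2 a^2 + 2 b^2 splits off one edge at a time, and an edge
    difference costs at most 1 / beta times the form. Adding the constants of all pairs makes the
    bound uniform in i and k. *)
Lemma dirichlet_form_poincare : exists2 C : R, 0 <= C &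
  forall x i k, (x i - x k) ^+ 2 <= C * dirichlet_form x.
Proof.
have conn (p : L * L) : exists C : R, 0 <= C /\
    forall x, (x p.1 - x p.2) ^+ 2 <= C * dirichlet_form x.
  case: p => i k /=; have /connectP[s] := beta_connected i k.
  elim: s i => [|m s IH] i /= => [_ ->|/andP[bim /IH{}IH] /IH [C [C0 Cx]]].
    by exists 0; split => // x; rewrite subrr expr0n mul0r.
  exists (2 * (beta i m)^-1 + 2 * C); split.
    by rewrite addr_ge0// mulr_ge0// invr_ge0.
  move=> x; have := Cx x.
  have : (x i - x m) ^+ 2 <= (beta i m)^-1 * dirichlet_form x.
    by rewrite ler_pdivlMl// dirichlet_form_edge.
  have := sqr_ge0 ((x i - x m) - (x m - x k)).
  by rewrite !expr2; nra.
have [C_ C_P] := choice conn.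
exists (\sum_p C_ p); first by apply: sumr_ge0 => p _; have [] := C_P p.
move=> x i k; have [_ /(_ x) /le_trans] := C_P (i, k); apply.
rewrite ler_wpM2r ?dirichlet_form_ge0// (bigD1 (i, k))//= lerDl.
by apply: sumr_ge0 => p _; have [] := C_P p.
Qed.

End coercivity.

Section gaussian_weight.
Context {R : realType} {L : finType} (beta : L -> L -> R).
Hypothesis beta_ge0 : forall i j, 0 <= beta i j.
Hypothesis beta_connected : forall i j, connect (fun i j => 0 < beta i j) i j.
Variable n : nat.
Implicit Types (u : L * 'I_n -> R) (h : (L -> R) -> R).

Lemma energyE u : energy beta u = 4^-1 * \sum_(a < n) dirichlet_form beta (fun i => u (i, a)).
Proof.
rewrite /energy /dirichlet_form; congr (_ * _).
rewrite [RHS]exchange_big; apply: eq_bigr => i _.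
rewrite [RHS]exchange_big; apply: eq_bigr => j _.
by rewrite mulr_sumr.
Qed.

Lemma energy_ge0 u : 0 <= energy beta u.
Proof.
rewrite energyE mulr_ge0// sumr_ge0// => a _; exact: dirichlet_form_ge0.
Qed.

Lemma half_sq_ge0 u i : 0 <= half_sq u i.
Proof. by rewrite mulr_ge0// sumr_ge0// => a _; exact: sqr_ge0. Qed.

Lemma japanese_energy : exists2 A : R, 0 <= A & forall u k,
  japanese u <= A * ((1 + half_sq u k) * (1 + energy beta u)).
Proof.
have [C C0 CP] := dirichlet_form_poincare beta_ge0 beta_connected.
pose l : R := #|L|%:R; have l0 : 0 <= l by rewrite ler0n.
exists (1 + 4 * l + 8 * l * C); first by rewrite !addr_ge0// !mulr_ge0.
move=> u k.
(* The inequality u_i^2 <= 2 u_k^2 + 2 (u_i - u_k)^2 is summed over components: [half_sq] carries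
   1/2, whence 4, and the energy carries 1/4, whence 8 C. The sum over i contributes [l]. *)
have : \sum_p u p ^+ 2 <= 4 * l * half_sq u k + 8 * l * C * energy beta u.
  rewrite (eq_bigr (fun p => u (p.1, p.2) ^+ 2)); last by move=> [].
  rewrite -(pair_bigA _ (fun i a => u (i, a) ^+ 2))/=.
  apply: (@le_trans _ _ (\sum_(i : L) (4 * half_sq u k + 8 * C * energy beta u))).
    apply: ler_sum => i _.
    rewrite /half_sq energyE mulrA (_ : 8 * C * _ =
        \sum_(a < n) 2 * (C * dirichlet_form beta (fun i => u (i, a)))); last first.
      by rewrite -!mulr_sumr; field.
    rewrite mulr_sumr -big_split; apply: ler_sum => a _ /=.
    have := CP (fun i => u (i, a)) i k.
    by have := sqr_ge0 (u (i, a) - 2 * u (k, a)); rewrite !expr2; nra.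
  by rewrite sumr_const -mulr_natl -/l le_eqVlt; apply/orP; left; apply/eqP; ring.
have := half_sq_ge0 u k; have := energy_ge0 u.
rewrite /japanese; move: (\sum_p _) (energy _ _) (half_sq _ _) => S E h E0 h0 Sle.
have lC : 0 <= l * C by exact: mulr_ge0.
apply: (le_trans (lerD (lexx 1) Sle)).
rewrite -subr_ge0 (_ : _ - _ = (h + E + h * E) + 4 * l * (1 + E + h * E) + 8 * (l * C) * (1 + h + h * E)).
  by rewrite !addr_ge0// ?mulr_ge0// ?addr_ge0// ?mulr_ge0.
by ring.
Qed.

(** 1 + y <= (N + 1) (1 + y / (N + 1)) <= (N + 1) exp(y / (N + 1)); the N-th power leaves an
    exponent at most y. *)
Lemma expR_ge_pow (N : nat) (y : R) : 0 <= y -> (1 + y) ^+ N <= N.+1%:R ^+ N * expR y.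
Proof.
move=> y0.
apply: (@le_trans _ _ (N.+1%:R ^+ N * (1 + y / N.+1%:R) ^+ N)).
  rewrite -exprMn lerXn2r ?nnegrE ?addr_ge0 ?mulr_ge0 ?addr_ge0 ?mulr_ge0 ?invr_ge0//.
  rewrite mulrDr mulr1 mulrCA mulfV// mulr1 lerD2r ler1n//.
rewrite ler_wpM2l// ?exprn_ge0//.
apply: (@le_trans _ _ (expR (y / N.+1%:R) ^+ N)).
  by rewrite lerXn2r ?nnegrE ?expR_ge0 ?expR_ge1Dx// addr_ge0// divr_ge0.
rewrite -expRM_natl ler_expR mulrCA ler_piMr// ler_pdivrMr// mul1r ler_nat//.
Qed.

(* Only nonnegative local times occur, and on the orthant exponentials
   [exp (- lam . l)] decay although they grow on the rest of [R^L]. *)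
Definition orthant_decay (k : L) h := forall N : nat,
  exists C : R, forall l, (forall i, 0 <= l i) -> `|h l| * (1 + l k) ^+ N <= C.

Lemma decays_in_orthant k h : decays_in k h -> orthant_decay k h.
Proof.
move=> dh N; have [C CP] := dh N%:R (ler0n _ _); exists C => l l0.
by have := CP l; rewrite [`|l k|]ger0_norm// powR_mulrn ?addr_ge0// mulrC.
Qed.

Lemma rapidly_decreasing_weight k h : orthant_decay k h ->
  rapidly_decreasing (fun u => h (half_sq u) * expR (- energy beta u)).
Proof.
move=> dh N; have [C CP] := dh N; have [A A0 AP] := japanese_energy.
exists (A ^+ N * N.+1%:R ^+ N * C) => u.
have hu := half_sq_ge0 u; have E0 := energy_ge0 u.
rewrite normrM [`|expR _|]gtr0_norm ?expR_gt0//.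
apply: (@le_trans _ _ (`|h (half_sq u)| * expR (- energy beta u) *
    (A ^+ N * ((1 + half_sq u k) ^+ N * (N.+1%:R ^+ N * expR (energy beta u)))))).
  rewrite ler_wpM2l ?mulr_ge0 ?expR_ge0//.
  apply: (@le_trans _ _ ((A * ((1 + half_sq u k) * (1 + energy beta u))) ^+ N)).
    by rewrite lerXn2r ?nnegrE// ?(ltW (japanese_gt0 u))// !mulr_ge0// addr_ge0.
  rewrite !exprMn ler_wpM2l ?exprn_ge0// ler_wpM2l ?exprn_ge0 ?addr_ge0//.
  exact: expR_ge_pow.
rewrite [leLHS](_ : _ = (expR (- energy beta u) * expR (energy beta u)) *
  (A ^+ N * N.+1%:R ^+ N * (`|h (half_sq u)| * (1 + half_sq u k) ^+ N))); last by ring.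
rewrite -expRD addNr expR0 mul1r ler_wpM2l ?mulr_ge0 ?exprn_ge0//.
exact: CP.
Qed.

End gaussian_weight.

(** * Derivatives of the energy and of functions of |u|^2 / 2 *)

Section derivatives.
Context {R : realType} {L : finType} (beta : L -> L -> R) (n : nat).
Hypothesis beta_sym : forall i j, beta i j = beta j i.
Implicit Types (u : L * 'I_n -> R).

Lemma is_derive_big_sum (T : Type) (s : seq T) (h : T -> R -> R) (dh : T -> R) (x : R) :
  (forall i, is_derive x 1 (h i) (dh i)) ->
  is_derive x 1 (fun t => \sum_(i <- s) h i t) (\sum_(i <- s) dh i).
Proof.
move=> dhi; elim: s => [|i s IH].
  rewrite big_nil (_ : (fun t => _) = cst 0); first exact: is_derive_cst.
  by apply/funext => t; rewrite big_nil.
rewrite big_cons (_ : (fun t => _) = h i + (fun t => \sum_(i <- s) h i t)).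
  exact: is_deriveD.
by apply/funext => t; rewrite big_cons.
Qed.

Lemma is_derive_dfwith (I : finType) (x : I -> R) (c i : I) (t : R) :
  is_derive t 1 (fun s => dfwith x c s i) (c == i)%:R.
Proof.
have [<-|ci] := eqVneq c i.
  rewrite (_ : (fun s => _) = id); first exact: is_derive_id.
  by apply/funext => s; rewrite dfwithin.
rewrite (_ : (fun s => _) = cst (x i)); first exact: is_derive_cst.
by apply/funext => s; rewrite dfwithout.
Qed.

(** The prefactor 1/4 is cancelled twice: squaring contributes a factor 2, and every edge at j is
    met once from each end. *)
Lemma is_derive_energy u j e (t : R) :
  is_derive t 1 (fun s => energy beta (dfwith u (j, e) s))
    (\sum_i beta j i * (dfwith u (j, e) t (j, e) - dfwith u (j, e) t (i, e))).
Proof.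
set v := dfwith u (j, e) t.
pose dv p : R := ((j, e) == p)%:R.
have H : is_derive t 1 (fun s => energy beta (dfwith u (j, e) s))
   (4^-1 * \sum_i \sum_k beta i k * \sum_(a < n) (2 * (v (i, a) - v (k, a)) * (dv (i, a) - dv (k, a)))).
  rewrite /energy.
  apply: is_deriveZ; apply: is_derive_big_sum => i; apply: is_derive_big_sum => k.
  apply: is_deriveZ; apply: is_derive_big_sum => a.
  have := is_deriveX 2 (is_deriveB (is_derive_dfwith u (j, e) (i, a) t) (is_derive_dfwith u (j, e) (k, a) t)).
  by rewrite expr1.
apply: is_derive_eq H _.
rewrite mulr_sumr.
pose d (a : 'I_n) i k := v (i, a) - v (k, a).
have E1 : \sum_i \sum_k beta i k * \sum_(a < n) (2 * d a i k * dv (i, a)) =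
    2 * \sum_k beta j k * d e j k.
  rewrite (bigD1 j)//= [X in _ + X]big1 ?addr0.
    rewrite mulr_sumr; apply: eq_bigr => k _; rewrite (bigD1 e)//= big1 ?addr0.
      by rewrite /dv eqxx mulr1; ring.
    by move=> a ae; rewrite /dv xpair_eqE eqxx/= eq_sym (negbTE ae) mulr0.
  move=> i ij; rewrite big1// => k _; rewrite big1 ?mulr0// => a _.
  by rewrite /dv xpair_eqE eq_sym (negbTE ij) mulr0.
(* [E1] collects the terms in which the derivative falls on the first end of the edge; exchanging
   the ends flips the sign of the difference, and symmetry of [beta] makes the two contributions
   opposite, so that their difference doubles. *)
have E2 : \sum_i \sum_k beta i k * \sum_(a < n) (2 * d a i k * dv (k, a)) =
    - (2 * \sum_k beta j k * d e j k).
  rewrite exchange_big -E1 -sumrN; apply: eq_bigr => i _.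
  rewrite -sumrN; apply: eq_bigr => k _; rewrite beta_sym -mulrN -sumrN; congr (_ * _).
  by apply: eq_bigr => a _; rewrite /d; ring.
rewrite -mulr_sumr.
transitivity (4^-1 * (2 * \sum_k beta j k * d e j k - - (2 * \sum_k beta j k * d e j k))).
  congr (_ * _); rewrite -{1}E1 -E2 -sumrB; apply: eq_bigr => i _.
  rewrite -sumrB; apply: eq_bigr => k _; rewrite -mulrBr -sumrB; congr (_ * _).
  by apply: eq_bigr => a _; rewrite /d; ring.
by rewrite /d; field.
Qed.

Lemma half_sq_dfwith u j e (t : R) :
  half_sq (dfwith u (j, e) t) = dfwith (half_sq u) j
    (2^-1 * (t ^+ 2 + \sum_(a < n | a != e) u (j, a) ^+ 2)).
Proof.
apply/funext => i; rewrite /half_sq; case: dfwithP => [|k jk].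
  rewrite (bigD1 e)//= dfwithin; congr (_ * (_ + _)); apply: eq_bigr => a ae.
  by rewrite dfwithout// xpair_eqE eqxx/= eq_sym.
by congr (_ * _); apply: eq_bigr => a _; rewrite dfwithout// xpair_eqE negb_and jk.
Qed.

(** The derivative of t^2 / 2 is t: this is what couples the factor u_j^1 to the local time
    derivative in the generator. *)
Lemma is_derive_half_sq (f : (L -> R) -> R) u j e (t : R) : (forall l, pderivable j f l) ->
  is_derive t 1 (fun s => f (half_sq (dfwith u (j, e) s)))
    (t * pderiv j f (half_sq (dfwith u (j, e) t))).
Proof.
move=> df; pose S := \sum_(a < n | a != e) u (j, a) ^+ 2.
pose g (s : R) := 2^-1 * (s ^+ 2 + S).
have dg : is_derive t 1 g t.
  have H : is_derive t 1 g (2^-1 * (2 * t + 0)).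
    have := is_deriveX 2 (is_derive_id t 1).
    rewrite expr1 => H2; apply: is_deriveZ; apply: is_deriveD.
    by apply: is_derive_eq H2 _; rewrite /GRing.scale/= mulr1.
  by apply: is_derive_eq H _; field.
rewrite (_ : (fun s => _) = (fun s => f (dfwith (half_sq u) j s)) \o g); last first.
  by apply/funext => s /=; rewrite half_sq_dfwith.
rewrite mulrC; apply: is_derive1_comp.
by rewrite half_sq_dfwith; exact: pderivable_is_derive.
Qed.

End derivatives.

Lemma Rintegral_sum d (T : measurableType d) (R : realType) (mu : {measure set T -> \bar R})
    (D : set T) (J : Type) (s : seq J) (F : J -> T -> R) : measurable D ->
  (forall j, mu.-integrable D (fun x => (F j x)%:E)) ->
  mu.-integrable D (fun x => (\sum_(j <- s) F j x)%:E) /\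
  \int[mu]_(x in D) (\sum_(j <- s) F j x) = \sum_(j <- s) \int[mu]_(x in D) F j x.
Proof.
move=> mD iF; elim: s => [|j s [IH1 IH2]].
  rewrite big_nil; under eq_fun do rewrite big_nil; split; first exact: integrable0.
  under eq_Rintegral do rewrite big_nil.
  by rewrite /Rintegral (_ : (fun=> _) = cst 0%E) ?integral0.
split.
  have := integrableD mD (iF j) IH1.
  by congr (integrable _ _ _); apply/funext => x /=; rewrite big_cons EFinD.
under eq_Rintegral do rewrite big_cons.
by rewrite big_cons -IH2 (RintegralD mD (iF j) IH1).
Qed.

(** * The Ward identity for functions decaying on the orthant *)

Section ward_identity.
Context {R : realType} {L : finType} (beta : L -> L -> R) (n : nat).
Hypothesis beta_sym : forall i j, beta i j = beta j i.
Hypothesis beta_ge0 : forall i j, 0 <= beta i j.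
Hypothesis beta_connected : forall i j, connect (fun i j => 0 < beta i j) i j.
Implicit Types (u : L * 'I_n -> R) (h : (L -> R) -> R).

Lemma borel_half_sq h : borel h -> borel (fun u => h (half_sq u)).
Proof.
move=> mh; apply: (borel_comp (phi := @half_sq R L n)) => // i.
apply: measurable_funM => //; apply: measurable_sum => a.
by apply: measurable_funX; exact: measurable_coord.
Qed.

Lemma borel_weight : borel (fun u : L * 'I_n -> R => expR (- energy beta u)).
Proof.
apply: measurableT_comp => //; apply: measurableT_comp => //.
apply: measurable_funM => //; apply: measurable_sum => i; apply: measurable_sum => j.
apply: measurable_funM => //; apply: measurable_sum => a; apply: measurable_funX.
by apply: measurable_funB; exact: measurable_coord.
Qed.

Lemma borel_weighted (F : (L * 'I_n -> R) -> R) h : borel F -> borel h ->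
  borel (fun u => F u * h (half_sq u) * expR (- energy beta u)).
Proof.
move=> mF mh; apply: measurable_funM; last exact: borel_weight.
by apply: measurable_funM => //; exact: borel_half_sq.
Qed.

Lemma rapidly_decreasing_weighted (F : (L * 'I_n -> R) -> R) h k :
  poly_bounded F -> orthant_decay k h ->
  rapidly_decreasing (fun u => F u * h (half_sq u) * expR (- energy beta u)).
Proof.
move=> pF dh.
have := rapidly_decreasingM pF (rapidly_decreasing_weight beta_ge0 beta_connected n dh).
by congr rapidly_decreasing; apply/funext => u /=; rewrite mulrA.
Qed.

Lemma bracket_integrable_decay (F : (L * 'I_n -> R) -> R) h k :
  borel F -> poly_bounded F -> borel h -> orthant_decay k h ->
  bracket_integrable beta (fun u => F u * h (half_sq u)).
Proof.
move=> mF pF mh dh; apply: (rapidly_decreasing_integrable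
  (F := fun u => F u * h (half_sq u) * expR (- energy beta u))).
  exact: borel_weighted.
exact: rapidly_decreasing_weighted dh.
Qed.

Lemma bracket_integrableD (F G : (L * 'I_n -> R) -> R) :
  bracket_integrable beta F -> bracket_integrable beta G ->
  bracket_integrable beta (F \+ G).
Proof.
move=> iF iG; have := integrableD measurableT iF iG.
by congr (integrable _ _ _); apply/funext => t /=; rewrite mulrDl EFinD.
Qed.

Lemma bracketD (F G : (L * 'I_n -> R) -> R) :
  bracket_integrable beta F -> bracket_integrable beta G ->
  bracket beta (F \+ G) = bracket beta F + bracket beta G.
Proof.
move=> iF iG; rewrite /bracket -RintegralD//.
by apply: eq_Rintegral => t _ /=; rewrite mulrDl.
Qed.

Lemma bracket_integrableZ (F : (L * 'I_n -> R) -> R) a :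
  bracket_integrable beta F -> bracket_integrable beta (fun u => a * F u).
Proof.
move=> iF; have := integrableZl measurableT a iF.
by congr (integrable _ _ _); apply/funext => t /=; rewrite -mulrA EFinM.
Qed.

Lemma bracketZ (a : R) (F : (L * 'I_n -> R) -> R) : bracket_integrable beta F ->
  bracket beta (fun u => a * F u) = a * bracket beta F.
Proof.
move=> iF; rewrite /bracket -RintegralZl//.
by apply: eq_Rintegral => t _; rewrite mulrA.
Qed.

Lemma bracket_integrable_sum (J : Type) (s : seq J) (F : J -> (L * 'I_n -> R) -> R) :
  (forall j, bracket_integrable beta (F j)) ->
  bracket_integrable beta (fun u => \sum_(j <- s) F j u) /\
  bracket beta (fun u => \sum_(j <- s) F j u) = \sum_(j <- s) bracket beta (F j).
Proof.
move=> iF; have [iS ES] := Rintegral_sum s measurableT iF; split.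
  by move: iS; congr (integrable _ _ _); apply/funext => t /=; rewrite mulr_suml.
by rewrite -ES; apply: eq_Rintegral => t _; rewrite mulr_suml.
Qed.

(** Self-adjointness of the graph Laplacian. With x = u^1 and y = f it moves the gradient of the
    energy onto [f], where it becomes the jump part of the generator. *)
Lemma sum_conductance (x y : L -> R) :
  \sum_j x j * (\sum_i beta j i * (y i - y j)) =
  - \sum_j (\sum_i beta j i * (x j - x i)) * y j.
Proof.
apply/eqP; rewrite -subr_eq0 opprK -big_split /=; apply/eqP.
rewrite (eq_bigr (fun j => \sum_i (beta j i * (x j * y i) - beta j i * (x i * y j)))).
  under eq_bigr do rewrite sumrB; rewrite sumrB [X in _ - X]exchange_big -sumrB big1// => i _.
  by rewrite -sumrB big1// => j _; rewrite beta_sym; ring.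
by move=> j _; rewrite mulr_sumr mulr_suml -big_split; apply: eq_bigr => i _ /=; ring.
Qed.

Variables (e : 'I_n) (f : L -> (L -> R) -> R) (rho : (L * 'I_n -> R) -> R).
Hypothesis df : forall j l, pderivable j (f j) l.
Hypothesis mf : forall j, borel (f j).
Hypothesis mdf : forall j, borel (pderiv j (f j)).
Hypothesis kf : forall j, exists k, orthant_decay k (f j).
Hypothesis kdf : forall j, exists k, orthant_decay k (pderiv j (f j)).
Hypothesis drho : forall j u, pderivable (j, e) rho u.
Hypothesis mrho : borel rho.
Hypothesis mdrho : forall j, borel (pderiv (j, e) rho).
Hypothesis prho : poly_bounded rho.
Hypothesis pdrho : forall j, poly_bounded (pderiv (j, e) rho).

Let prho_coord c : poly_bounded (fun u => rho u * u c).
Proof. exact: poly_boundedM prho (poly_bounded_coord c). Qed.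

Let mrho_coord c : borel (fun u => rho u * u c).
Proof. by apply: measurable_funM => //; exact: measurable_coord. Qed.

Let int_rho_f c j : bracket_integrable beta (fun u => rho u * u c * f j (half_sq u)).
Proof. by have [k kfj] := kf j; exact: bracket_integrable_decay kfj. Qed.

Let int_rho_df c j :
  bracket_integrable beta (fun u => rho u * u c * pderiv j (f j) (half_sq u)).
Proof. by have [k kfj] := kdf j; exact: bracket_integrable_decay kfj. Qed.

Lemma ward_integrable_pderiv j :
  bracket_integrable beta (fun u => pderiv (j, e) rho u * f j (half_sq u)).
Proof. by have [k kfj] := kf j; exact: bracket_integrable_decay kfj. Qed.

Lemma ward_integrable_generator j : bracket_integrable beta
  (fun u => rho u * u (j, e) * generator beta f j (half_sq u)).
Proof.
rewrite (_ : (fun u => _) = (fun u => \sum_i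
    (beta j i * (rho u * u (j, e) * f i (half_sq u)) +
     - beta j i * (rho u * u (j, e) * f j (half_sq u)))) \+
    (fun u => rho u * u (j, e) * pderiv j (f j) (half_sq u))); last first.
  apply/funext => u /=; rewrite /generator mulrDr mulr_sumr; congr (_ + _).
  by apply: eq_bigr => i _; ring.
apply: bracket_integrableD => //; apply: (bracket_integrable_sum _ _).1 => i.
by apply: bracket_integrableD; exact: bracket_integrableZ.
Qed.

(** The function whose u_j^1-derivative is integrated; the three terms of [dG] come from [rho], from
    [f] and from the Gaussian weight. *)
Let G j u := rho u * f j (half_sq u) * expR (- energy beta u).
Let dG j u :=
  pderiv (j, e) rho u * f j (half_sq u) * expR (- energy beta u) +
  rho u * u (j, e) * pderiv j (f j) (half_sq u) * expR (- energy beta u) -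
  (\sum_i beta j i * (u (j, e) - u (i, e))) * rho u * f j (half_sq u) * expR (- energy beta u).

Let is_derive_G j u (t : R) : is_derive t 1 (fun s => G j (dfwith u (j, e) s))
  (dG j (dfwith u (j, e) t)).
Proof.
have d1 := pderivable_is_derive u t (@drho j).
have d2 := is_derive_half_sq u e t (@df j).
have d3 : is_derive t 1 (fun s => expR (- energy beta (dfwith u (j, e) s)))
    (expR (- energy beta (dfwith u (j, e) t)) *
     - (\sum_i beta j i * (dfwith u (j, e) t (j, e) - dfwith u (j, e) t (i, e)))).
  apply: (is_derive1_comp (f := expR)).
  exact: (is_deriveN (is_derive_energy beta_sym u j e t)).
have H := is_deriveM (is_deriveM d1 d2) d3.
apply: is_derive_eq H _; rewrite /dG.
set v := dfwith u (j, e) t; have vt : v (j, e) = t by rewrite /v dfwithin.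
rewrite vt /GRing.scale/= !fctE -/v. ring.
Qed.

Lemma sum_bracket_ward :
  - (\sum_j bracket beta (fun u => rho u * u (j, e) * generator beta f j (half_sq u))) =
  \sum_j bracket beta (fun u => pderiv (j, e) rho u * f j (half_sq u)).
Proof.
have pG j u : pderivable (j, e) (G j) u.
  by have [] := is_derive_G j u (u (j, e)).
have pdG j : pderiv (j, e) (G j) = dG j.
  apply/funext => u; rewrite /pderiv derive1E.
  have [_] := is_derive_G j u (u (j, e)).
  by rewrite dfwith_id.
have int_dG j : (@lebesgue_tuple R _).-integrable setT (fun t => (dG j (coords t))%:E) /\
    \int[@lebesgue_tuple R _]_t dG j (coords t) = 0.
  have [k kfj] := kf j; have [k' kdfj] := kdf j.
  pose b u := - (\sum_i beta j i * (u (j, e) - u (i, e))).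
  have mb : borel b.
    apply: measurable_funN; apply: measurable_sum => i; apply: measurable_funM => //.
    by apply: measurable_funB; exact: measurable_coord.
  have pb : poly_bounded b.
    rewrite (_ : b = (fun u => \sum_i (- beta j i) * (u (j, e) + (-1) * u (i, e)))).
      apply: poly_bounded_sum => i; apply: poly_boundedM; first exact: poly_bounded_cst.
      apply: poly_boundedD; first exact: poly_bounded_coord.
      by apply: poly_boundedM; [exact: poly_bounded_cst|exact: poly_bounded_coord].
    by apply/funext => u; rewrite /b -sumrN; apply: eq_bigr => i _; ring.
  have dGE : dG j = (fun u => pderiv (j, e) rho u * f j (half_sq u) * expR (- energy beta u) +
      rho u * u (j, e) * pderiv j (f j) (half_sq u) * expR (- energy beta u) +
      b u * rho u * f j (half_sq u) * expR (- energy beta u)).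
    by apply/funext => u; rewrite /dG /b !mulNr.
  have mdG : borel (dG j).
    rewrite dGE; apply: measurable_funD; last first.
      by apply: (@borel_weighted (fun u => b u * rho u)) => //; exact: measurable_funM.
    apply: measurable_funD; first exact: (borel_weighted (mdrho j) (mf j)).
    exact: (borel_weighted (mrho_coord (j, e)) (mdf j)).
  have rdG : rapidly_decreasing (dG j).
    rewrite dGE; apply: rapidly_decreasingD; last first.
      by apply: (@rapidly_decreasing_weighted (fun u => b u * rho u)) kfj; exact: poly_boundedM.
    apply: rapidly_decreasingD; first exact: rapidly_decreasing_weighted kfj.
    exact: rapidly_decreasing_weighted kdfj.
  split; first exact: rapidly_decreasing_integrable.
  rewrite -pdG; apply: integral_pderiv_eq0; rewrite ?pdG//.
    exact: (borel_weighted mrho (mf j)).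
  exact: rapidly_decreasing_weighted kfj.
have [iA sA] := bracket_integrable_sum (index_enum L) ward_integrable_generator.
have [iB sB] := bracket_integrable_sum (index_enum L) ward_integrable_pderiv.
rewrite -sA -sB; apply/eqP; rewrite -subr_eq0 -opprD oppr_eq0 -bracketD//; apply/eqP.
(* Both sides of the identity have been brought together. The integrands match pointwise after
   summing over j, since [sum_conductance] redistributes terms between different j; each [dG j] then
   integrates to zero. *)
transitivity (\int[@lebesgue_tuple R _]_t \sum_j dG j (coords t)).
  apply: eq_Rintegral => t _ /=; set u := coords t; rewrite -big_split mulr_suml/=.
  have := sum_conductance (fun j => u (j, e)) (fun j => f j (half_sq u)).
  move=> /(congr1 (fun z => rho u * expR (- energy beta u) * z)) /eqP.
  rewrite -subr_eq0 mulrN opprK !mulr_sumr -big_split /= => /eqP E.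
  apply/eqP; rewrite -subr_eq0 -sumrB -[X in _ == X]E; apply/eqP.
  by apply: eq_bigr => j _; rewrite /dG /generator; ring.
have [_ ->] := Rintegral_sum (index_enum L) measurableT (fun j => (int_dG j).1).
by rewrite big1// => j _; have [] := int_dG j.
Qed.

End ward_identity.

Section smooth_functions.
Context {R : realType} {I : finType}.
Implicit Types (g : (I -> R) -> R).

Lemma smooth_pderivable g i x : smooth g -> pderivable i g x.
Proof. by move=> sg; have [_] := sg [::]; exact. Qed.

Lemma smooth_borel_pderivs g (s : seq I) : smooth g -> borel (pderivs s g).
Proof. by move=> sg; have [cg _] := sg s; exact: borel_continuous. Qed.

Lemma moderate_growth_poly_bounded g (s : seq I) :
  moderate_growth g -> poly_bounded (pderivs s g).
Proof.
(* The exponent [q] is an arbitrary real, so |q| is rounded up to a natural number; 1 + |x| <= 2 (1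
   + |x|^2) then yields the factor 2^N. *)
move=> [q [C gC]]; pose N := (Num.truncn `|q|).+1.
exists N, (`|C (size s)| * 2 ^+ N) => x.
apply: (@le_trans _ _ (nabla_norm (size s) g x)).
  rewrite /nabla_norm -sqrtr_sqr ler_wsqrtr// (bigD1 (in_tuple s))//= lerDl.
  by apply: sumr_ge0 => t _; exact: sqr_ge0.
have e0 : 0 <= enorm x by exact: sqrtr_ge0.
apply: (le_trans (gC (size s) x)).
apply: (le_trans (ler_wpM2r (powR_ge0 _ _) (ler_norm _))).
rewrite -mulrA ler_wpM2l// -exprMn.
apply: (@le_trans _ _ ((1 + enorm x) `^ N%:R)).
  apply: ler_powR; first by rewrite lerDl.
  by rewrite (le_trans (ler_norm q))// ltW// truncnS_gt.
rewrite powR_mulrn ?addr_ge0// lerXn2r ?nnegrE ?addr_ge0 ?mulr_ge0 ?(ltW (japanese_gt0 x))//.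
have S0 : 0 <= \sum_i x i ^+ 2 by apply: sumr_ge0 => i _; exact: sqr_ge0.
have := sqr_sqrtr S0; rewrite -/(enorm x) /japanese => <-.
by have := sqr_ge0 (enorm x - 1); rewrite !expr2; nra.
Qed.

End smooth_functions.

Lemma ward_identity (R : realType) (L : finType) (beta : L -> L -> R)
    (beta_sym : forall i j, beta i j = beta j i)
    (beta_ge0 : forall i j, 0 <= beta i j)
    (beta_connected : forall i j, connect (fun i j => 0 < beta i j) i j)
    (n : nat) (e : 'I_n) (f : L -> (L -> R) -> R) (rho : (L * 'I_n -> R) -> R) :
  (forall i, smooth (f i)) -> rapid_decay f -> smooth rho -> moderate_growth rho ->
  [/\ forall j, bracket_integrable beta
        (fun u => rho u * u (j, e) * generator beta f j (half_sq u)),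
      forall j, bracket_integrable beta
        (fun u => pderiv (j, e) rho u * f j (half_sq u)) &
      - (\sum_j bracket beta
           (fun u => rho u * u (j, e) * generator beta f j (half_sq u))) =
      \sum_j bracket beta
        (fun u => pderiv (j, e) rho u * f j (half_sq u))].
Proof.
move=> sf rf srho mrho.
have df j l : pderivable j (f j) l by exact: smooth_pderivable.
have mf j : borel (f j) by exact: (smooth_borel_pderivs [::] (sf j)).
have mdf j : borel (pderiv j (f j)) by exact: (smooth_borel_pderivs [:: j] (sf j)).
have kf j : exists k, orthant_decay k (f j).
  by have [k [_ /(_ sf [::])]] := rf j; exists k; exact: decays_in_orthant.
have kdf j : exists k, orthant_decay k (pderiv j (f j)).
  by have [k [_ /(_ sf [:: j])]] := rf j; exists k; exact: decays_in_orthant.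
have drho j u : pderivable (j, e) rho u by exact: smooth_pderivable.
have mrho0 : borel rho by exact: (smooth_borel_pderivs [::] srho).
have mdrho j : borel (pderiv (j, e) rho) by exact: (smooth_borel_pderivs [:: (j, e)] srho).
have prho : poly_bounded rho by exact: (moderate_growth_poly_bounded [::] mrho).
have pdrho j : poly_bounded (pderiv (j, e) rho).
  exact: (moderate_growth_poly_bounded [:: (j, e)] mrho).
split.
- by move=> j; exact: ward_integrable_generator.
- by move=> j; exact: ward_integrable_pderiv.
- exact: sum_bracket_ward.
Qed.

(** * The resolvent of the killed walk *)

Lemma Rintegral_dominated_cvg d (T : measurableType d) (R : realType)
    (mu : {measure set T -> \bar R}) (D : set T) (f_ : nat -> T -> R) (f g : T -> R) :
  measurable D -> (forall n, measurable_fun D (f_ n)) ->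
  (forall x, D x -> f_ n x @[n --> \oo] --> f x) ->
  mu.-integrable D (fun x => (g x)%:E) ->
  (forall n x, D x -> `|f_ n x| <= g x) ->
  mu.-integrable D (fun x => (f x)%:E) /\
  \int[mu]_(x in D) f_ n x @[n --> \oo] --> \int[mu]_(x in D) f x.
Proof.
move=> mD mf_ f_f ig f_g.
have mf : measurable_fun D f by exact: (measurable_fun_cvg mf_ f_f).
have [] := @dominated_convergence _ _ _ mu D mD (fun n x => (f_ n x)%:E)
  (fun x => (f x)%:E) (fun x => (g x)%:E).
- by move=> n; apply/measurable_EFinP.
- exact/measurable_EFinP.
- apply: aeW => x Dx; apply: cvg_EFin; first exact: nearW.
  exact: f_f.
- exact: ig.
- by apply: aeW => x n Dx; rewrite abse_EFin lee_fin; exact: f_g.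
move=> if_ _ cf; split => //.
rewrite /Rintegral; apply: fine_cvg; rewrite fineK//.
exact: (integrable_fin_num mD if_).
Qed.

Lemma Rintegral_lebesgue_shift (R : realType) (f : R -> R) (a : R) :
  measurable_fun [set: R] f ->
  \int[lebesgue_measure]_t f (t + a) = \int[lebesgue_measure]_t f t.
Proof.
move=> mf; rewrite /Rintegral; congr fine.
have mEf : measurable_fun [set: R] (EFin \o f) by exact/measurable_EFinP.
rewrite integralE [RHS]integralE.
rewrite -(@ge0_integral_lebesgue_shift _ (EFin \o f)^\+%E a)//; last exact: measurable_funepos.
rewrite -(@ge0_integral_lebesgue_shift _ (EFin \o f)^\-%E a)//; last exact: measurable_funeneg.
by congr (_ - _)%E; apply: eq_integral => x _; rewrite ?funeposE ?funenegE.
Qed.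

Lemma Rintegral_finite_range d (T : measurableType d) (R : realType) (P : probability T R)
    (F : finType) (Y : T -> F) (h : F -> R) :
  (forall y, measurable (Y @^-1` [set y])) ->
  P.-integrable setT (fun w => (h (Y w))%:E) /\
  \int[P]_w h (Y w) = \sum_y h y * fine (P (Y @^-1` [set y])).
Proof.
move=> mY.
have hY w : h (Y w) = \sum_y h y * \1_(Y @^-1` [set y]) w.
  rewrite (bigD1 (Y w))//= indicE mem_set// mulr1 big1 ?addr0// => y yw.
  by rewrite indicE memNset ?mulr0//= => /esym/eqP; rewrite (negbTE yw).
have i1 y : P.-integrable setT (fun w => (\1_(Y @^-1` [set y]) w)%:E).
  exact: integrable_indic.
have iF y : P.-integrable setT (fun w => (h y * \1_(Y @^-1` [set y]) w)%:E).
  by have := integrableZl measurableT (h y) (i1 y).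
have [iS ES] := Rintegral_sum (index_enum F) measurableT iF.
under eq_Rintegral do rewrite hY; split.
  by move: iS; congr (integrable _ _ _); apply/funext => w; rewrite hY.
rewrite ES; apply: eq_bigr => y _; rewrite (RintegralZl _ measurableT (i1 y)).
by rewrite /Rintegral integral_indic// setIT.
Qed.

(** * Sampling on a grid of mesh 1 / (N + 1) *)

Section grid.
Context {R : realType}.

Definition grid_index (N : nat) (t : R) : nat := Num.truncn (t * N.+1%:R).

Lemma measurable_grid_index N (m : nat) : measurable (grid_index N @^-1` [set m]).
Proof.
have mf : measurable_fun [set: R] (fun t => (grid_index N t)%:R : R).
  apply: nondecreasing_measurable => // x y xy.
  by rewrite ler_nat /grid_index le_truncn// ler_wpM2r.
rewrite -[X in measurable X]setTI.
rewrite (_ : _ @^-1` _ = (fun t => (grid_index N t)%:R : R) @^-1` [set m%:R]).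
  exact: (mf measurableT).
by apply/seteqP; split => t /= => [->//|/eqP]; rewrite eqr_nat => /eqP.
Qed.

Lemma measurable_nat_index d (T : measurableType d) (k : T -> nat) (c : nat -> T -> R) :
  (forall m, measurable (k @^-1` [set m])) ->
  (forall m, measurable_fun [set: T] (c m)) ->
  measurable_fun [set: T] (fun x => c (k x) x).
Proof.
move=> mk mc _ Y mY; rewrite setTI.
rewrite (_ : _ @^-1` Y = \bigcup_m ((k @^-1` [set m]) `&` (c m @^-1` Y))).
  apply: bigcupT_measurable => m; apply: measurableI => //.
  by rewrite -[X in measurable X]setTI; exact: mc.
apply/seteqP; split=> [x Yx|x [m _ [/= <-]]]//.
by exists (k x).
Qed.

Lemma grid_index_itv N t : 0 <= t ->
  (grid_index N t)%:R / N.+1%:R <= t < (grid_index N t).+1%:R / N.+1%:R.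
Proof.
move=> t0; rewrite ler_pdivrMr// ltr_pdivlMr//.
by apply: truncn_itv; rewrite mulr_ge0.
Qed.

Lemma grid_index_def N t (m : nat) :
  m%:R / N.+1%:R <= t < m.+1%:R / N.+1%:R -> grid_index N t = m.
Proof. by rewrite ler_pdivrMr// ltr_pdivlMr// => H; exact: truncn_def. Qed.

Lemma Rintegral_grid N (c : nat -> R) (K : nat) :
  lebesgue_measure.-integrable `[0, K%:R / N.+1%:R[ (fun s : R => (c (grid_index N s))%:E) /\
  \int[lebesgue_measure]_(s in `[0, K%:R / N.+1%:R[) c (grid_index N s) =
  N.+1%:R^-1 * \sum_(m < K) c m.
Proof.
have mc : measurable_fun [set: R] (fun s : R => c (grid_index N s)).
  apply: (measurable_nat_index (c := fun m _ => c m)) => //.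
  exact: measurable_grid_index.
have ic (J : nat) : lebesgue_measure.-integrable `[0, J%:R / N.+1%:R[
    (fun s : R => (c (grid_index N s))%:E).
  have fin : (lebesgue_measure (`[0%R, (J%:R / N.+1%:R)%R[%classic : set R) < +oo)%E.
    by rewrite lebesgue_measure_itv/=; case: ifP => // _; rewrite -EFinB ltry.
  apply: measurable_bounded_integrable => //.
  - exact: measurable_funTS.
  exists (\sum_(m < J) `|c m|); split; first exact: num_real.
  move=> x xJ s; rewrite /= in_itv/= => /andP[s0 sJ].
  apply: le_trans (ltW xJ).
  have sJ' : (grid_index N s < J)%N.
    by rewrite /grid_index truncn_lt_nat ?mulr_ge0// -ltr_pdivlMr.
  rewrite (bigD1 (Ordinal sJ'))//= lerDl.
  by apply: sumr_ge0.
split=> //; elim: K => [|K IH].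
  by rewrite mul0r set_itv_ge ?bnd_simp// Rintegral_set0 big_ord0 mulr0.
have KK : K%:R / N.+1%:R <= K.+1%:R / N.+1%:R :> R by rewrite ler_pM2r// ler_nat.
have K0 : 0 <= K%:R / N.+1%:R :> R by rewrite divr_ge0.
have := ic K.+1.
rewrite (@itv_bndbnd_setU _ _ _ (BLeft (K%:R / N.+1%:R)))//= => iU.
rewrite Rintegral_setU//=; last first.
  apply/disj_setPS => y [/=]; rewrite 2!in_itv/= => /andP[_ yx] /andP[].
  by rewrite leNgt yx.
rewrite IH big_ord_recr/= mulrDr; congr (_ + _).
rewrite (@eq_Rintegral _ _ _ _ _ (fun=> c K)); last first.
  by move=> s; rewrite inE/= in_itv/= => H; rewrite (grid_index_def H).
rewrite Rintegral_cst//.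
transitivity (c K * fine (lebesgue_measure
  (`[(K%:R / N.+1%:R)%R, (K.+1%:R / N.+1%:R)%R[%classic : set R))) => //.
rewrite lebesgue_measure_itv/= lte_fin ltr_pM2r// ltr_nat ltnSn/=.
by rewrite -mulrBl -natrB// subSnn mul1r mulrC.
Qed.
End grid.

Section jump_process_theory.
Context {R : realType} {L : finType} (beta : L -> L -> R).
Context d {W : measurableType d} (P : L -> probability W R) (X : R -> W -> L).
Hypothesis JP : jump_process beta P X.

Definition transition (h : R) (i k : L) : R := fine (P i (X h @^-1` [set k])).

Lemma sum_transition (h : R) i : 0 <= h -> \sum_k transition h i k = 1.
Proof.
move=> h0; have [_] := Rintegral_finite_range (P i) (fun=> 1)
  (fun k => jp_measurable JP k h0).
under eq_bigr do rewrite mul1r.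
move=> <-; rewrite Rintegral_cst// mul1r.
by have /= -> := @probability_setT _ _ _ (P i).
Qed.

Lemma transition_ge0 (h : R) i k : 0 <= transition h i k.
Proof. exact: fine_ge0. Qed.

Lemma transition0 i k : transition 0 i k = (i == k)%:R.
Proof.
have ii : transition 0 i i = 1 by rewrite /transition (jp_start JP).
have [<-//|ik] := eqVneq i k.
apply/eqP; rewrite eq_le transition_ge0 andbT.
have := sum_transition i (lexx 0); rewrite (bigD1 i)//= ii => /eqP.
rewrite -subr_eq0 addrAC subrr add0r => /eqP S0; rewrite -[leRHS]S0.
rewrite (bigD1 k) 1?eq_sym//= lerDl; apply: sumr_ge0 => m _; exact: transition_ge0.
Qed.

Definition discounted_step (a : L -> R) (h : R) (phi : L -> R) : L -> R :=
  fun i => a i * \sum_k transition h i k * phi k.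

(** The values at the grid times form a random vector of finite range, so the expectations are
    finite sums. The Markov property, conditioned on the whole sampled past, replaces the last
    transition by one application of [discounted_step] to [phi]. *)
Lemma expect_grid (a phi : L -> R) (h : R) (K : nat) (j : L) : 0 <= h ->
  (P j).-integrable setT
    (fun w => ((\prod_(m < K) a (X (m%:R * h) w)) * phi (X (K%:R * h) w))%:E) /\
  \int[P j]_w ((\prod_(m < K) a (X (m%:R * h) w)) * phi (X (K%:R * h) w)) =
  iter K (discounted_step a h) phi j.
Proof.
move=> h0; have t0 (m : nat) : 0 <= m%:R * h by rewrite mulr_ge0.
pose Y (K : nat) w : {ffun 'I_K -> L} * L := ([ffun m : 'I_K => X (m%:R * h) w], X (K%:R * h) w).
pose past (K : nat) (x : {ffun 'I_K -> L}) :=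
  [seq ((nat_of_ord m)%:R * h, x m) | m <- enum 'I_K].
have YE K' x i : Y K' @^-1` [set (x, i)] =
    [set w | forall p, p \in past K' x -> X p.1 w = p.2] `&` X (K'%:R * h) @^-1` [set i].
  apply/seteqP; split => w /= [].
    by move=> <- <-; split=> // p /mapP[m _ ->]; rewrite /= ffunE.
  move=> Hp <-; congr pair; apply/ffunP => m; rewrite ffunE.
  by apply: (Hp (m%:R * h, x m)); apply/mapP; exists m => //; rewrite mem_enum.
have mY K' y : measurable (Y K' @^-1` [set y]).
  case: y => x i; rewrite YE; apply: measurableI; last exact: (jp_measurable JP).
  rewrite (_ : [set w | _] = \bigcap_(m in [set: 'I_K']) (X (m%:R * h) @^-1` [set x m])).
    by apply: fin_bigcap_measurable => // m _; exact: (jp_measurable JP).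
  apply/seteqP; split => w /= Hw => [m _|p /mapP[m _ ->]/=]; last exact: Hw.
  by apply: (Hw (m%:R * h, x m)); apply/mapP; exists m => //; rewrite mem_enum.
have EY K' phi' : (fun w => (\prod_(m < K') a (X (m%:R * h) w)) * phi' (X (K'%:R * h) w)) =
    (fun w => (fun y : {ffun 'I_K' -> L} * L => (\prod_(m < K') a (y.1 m)) * phi' y.2) (Y K' w)).
  by apply/funext => w /=; congr (_ * _); apply: eq_bigr => m _; rewrite ffunE.
split.
  have [+ _] := Rintegral_finite_range (P j)
    (fun y : {ffun 'I_K -> L} * L => (\prod_(m < K) a (y.1 m)) * phi y.2) (mY K).
  by congr (integrable _ _ _); apply/funext => w; rewrite (congr1 (fun F => F w) (EY K phi)).
elim: K phi => [|K IH] phi.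
  under eq_Rintegral do rewrite big_ord0 mul1r mul0r.
  rewrite (Rintegral_finite_range _ _ (fun k => jp_measurable JP k (lexx 0))).2 /=.
  rewrite (bigD1 j)//= -/(transition 0 j j) transition0 eqxx mulr1 big1 ?addr0// => k kj.
  by rewrite -/(transition 0 j k) transition0 eq_sym (negbTE kj) mulr0.
(* The last time step is absorbed into the terminal function, which is why the induction is over all
   [phi]. *)
rewrite iterSr -IH.
pose Y' w := (Y K w, X (K.+1%:R * h) w).
have Y'E y k : Y' @^-1` [set (y, k)] = Y K @^-1` [set y] `&` X (K.+1%:R * h) @^-1` [set k].
  apply/seteqP; split => w; last by move=> [<- <-].
  by move=> E; split; [exact: (congr1 fst E)|exact: (congr1 snd E)].
have mY' y : measurable (Y' @^-1` [set y]).
  by case: y => y k; rewrite Y'E; apply: measurableI => //; exact: (jp_measurable JP).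
pose hY (y : {ffun 'I_K -> L} * L) := (\prod_(m < K) a (y.1 m)) * discounted_step a h phi y.2.
pose hY' (y : ({ffun 'I_K -> L} * L) * L) := (\prod_(m < K) a (y.1.1 m)) * a y.1.2 * phi y.2.
transitivity (\int[P j]_w hY' (Y' w)).
  apply: eq_Rintegral => w _ /=; rewrite big_ord_recr/=; congr (_ * _ * _).
  by apply: eq_bigr => m _; rewrite ffunE.
transitivity (\int[P j]_w hY (Y K w)); last by rewrite EY.
rewrite (Rintegral_finite_range (P j) hY' mY').2 (Rintegral_finite_range (P j) hY (mY K)).2.
rewrite (eq_bigr (fun y : ({ffun 'I_K -> L} * L) * L => hY' y *
    (fine (P j (Y K @^-1` [set y.1])) * transition h y.1.2 y.2))); last first.
  move=> [[x i] k] _ /=; congr (_ * _); rewrite /transition -fineM; last 2 first.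
  - exact: fin_num_measure.
  - apply: fin_num_measure; exact: (jp_measurable JP).
  congr fine; rewrite YE -(jp_markov JP)//.
    by rewrite Y'E YE (_ : K%:R * h + h = K.+1%:R * h)// -[K.+1]addn1 natrD mulrDl mul1r.
  move=> p /mapP[m _ ->] /=; rewrite t0/= ler_wpM2r// ler_nat.
  exact/ltnW.
rewrite -(pair_bigA _ (fun (y : {ffun 'I_K -> L} * L) (k : L) => hY' (y, k) *
    (fine (P j (Y K @^-1` [set y])) * transition h y.2 k)))/=.
apply: eq_bigr => y _; rewrite /hY /hY' /discounted_step !mulr_sumr mulr_suml.
by apply: eq_bigr => k _; ring.
Qed.

End jump_process_theory.

Lemma lebesgue_itvcc_fin (R : realType) (a b : R) :
  (lebesgue_measure (`[a, b]%classic : set R) < +oo)%E.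
Proof. by rewrite lebesgue_measure_itv/=; case: ifP => // _; rewrite -EFinB ltry. Qed.

Lemma integrable_itvcc_cst (R : realType) (a b c : R) :
  lebesgue_measure.-integrable (`[a, b]%classic : set R) (fun=> c%:E).
Proof.
apply: measurable_bounded_integrable => //; first exact: lebesgue_itvcc_fin.
exists `|c|; split; first exact: num_real.
by move=> x x1 s _ /=; rewrite ltW.
Qed.

(** * Occupation times as limits of Riemann sums *)

Section occupation_times.
Context {R : realType} {L : finType} (beta : L -> L -> R).
Context d {W : measurableType d} (P : L -> probability W R) (X : R -> W -> L).
Hypothesis JP : jump_process beta P X.

Lemma near_right_eq w (s : R) : 0 <= s ->
  exists2 e : R, 0 < e & forall r, s < r -> r < s + e -> X r w = X s w.
Proof.
move=> s0; have [e /= e0 H] := jp_right_continuous JP w s0.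
exists e => // r sr rse; apply: H => //=.
by rewrite distrC gtr0_norm ?subr_gt0// ltrBlDl.
Qed.

Lemma grid_right w (s : R) : 0 <= s ->
  \forall N \near \oo, X ((grid_index N s).+1%:R / N.+1%:R) w = X s w.
Proof.
move=> s0; have [e e0 He] := near_right_eq w s0.
have : \forall N \near \oo, (N.+1%:R^-1 : R) < e.
  have /cvgrPdist_lt /(_ e e0) := @cvg_harmonic R.
  by apply: filterS => N; rewrite /= sub0r normrN ger0_norm.
move=> H; apply: filterS H => N Ne.
have /andP[g1 g2] := grid_index_itv N s0.
apply: He => //; rewrite -[_.+1]addn1 natrD mulrDl mul1r.
by rewrite ler_ltD.
Qed.

Lemma measurable_path_grid N (w : W) (g : L -> R) :
  measurable_fun [set: R] (fun s : R => g (X ((grid_index N s).+1%:R / N.+1%:R) w)).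
Proof.
apply: (measurable_nat_index (c := fun m _ => g (X (m.+1%:R / N.+1%:R) w))) => //.
exact: measurable_grid_index.
Qed.

Lemma cvg_path_grid w (s : R) (g : L -> R) : 0 <= s ->
  g (X ((grid_index N s).+1%:R / N.+1%:R) w) @[N --> \oo] --> g (X s w).
Proof.
move=> s0; apply: cvg_near_cst.
by apply: filterS (grid_right w s0) => N ->.
Qed.

Definition occupation (t : R) (w : W) (i : L) : R :=
  \int[lebesgue_measure]_(s in `[0, t]) (X s w == i)%:R.

(** A Riemann sum over left end points that counts the cell of [t] in full. With this choice the
    discount factors sampled along the grid multiply exactly to exp(- lam . grid_occupation). *)
Definition grid_occupation (N : nat) (t : R) (w : W) (i : L) : R :=
  N.+1%:R^-1 * \sum_(m < (grid_index N t).+1) (X (m%:R / N.+1%:R) w == i)%:R.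

Lemma integrable_occupation (t : R) w i :
  lebesgue_measure.-integrable `[0, t] (fun s : R => ((X s w == i)%:R : R)%:E) /\
  \int[lebesgue_measure]_(s in `[0, t])
     (X ((grid_index N s).+1%:R / N.+1%:R) w == i)%:R @[N --> \oo] --> occupation t w i.
Proof.
pose g (k : L) : R := (k == i)%:R.
apply: (@Rintegral_dominated_cvg _ _ R lebesgue_measure `[0, t]%classic
  (fun N s => g (X ((grid_index N s).+1%:R / N.+1%:R) w)) (fun s => g (X s w)) (fun=> 1)) => //.
- by move=> N; apply: measurable_funTS; exact: (measurable_path_grid N w g).
- move=> s /=; rewrite in_itv /= => /andP[s0 _].
  exact: (@cvg_path_grid w s g s0).
- exact: integrable_itvcc_cst.
- by move=> N s _; rewrite /g; case: (_ == _); rewrite ?normr1 ?normr0.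
Qed.

(** Right continuity controls the integral [I_] of right end point values. The left end point sum
    has the same terms shifted by one index: it gains the term at time 0 and lacks the incomplete
    last cell. Both corrections lie between 0 and the mesh, so the two quantities differ by at most
    the mesh. *)
Lemma cvg_grid_occupation (t : R) w i : 0 <= t ->
  grid_occupation N t w i @[N --> \oo] --> occupation t w i.
Proof.
have arith (b S J x : R) : 0 <= J <= b -> 0 <= x <= b ->
    S + J - b <= x + S <= S + J + b.
  by move=> /andP[? ?] /andP[? ?]; apply/andP; split; lra.
move=> t0; have [_ cI] := integrable_occupation t w i.
set I_ := (fun N : nat => \int[_]_(_ in _) _) in cI.
pose h (N : nat) : R := N.+1%:R^-1.
have h0 N : 0 < h N by rewrite invr_gt0.
have IE N : I_ N - h N <= grid_occupation N t w i <= I_ N + h N.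
  have [g1 g2] := andP (grid_index_itv N t0).
  set K := grid_index N t in g1 g2 *.
  pose c (m : nat) : R := (X (m.+1%:R / N.+1%:R) w == i)%:R.
  have c01 m : 0 <= c m <= 1 by rewrite /c; case: (_ == _); rewrite ?lexx ?ler01.
  have [_ SE] := Rintegral_grid N c K.
  have mc : measurable_fun [set: R] (fun s : R => c (grid_index N s)).
    exact: (measurable_path_grid N w (fun k => (k == i)%:R)).
  have iU : lebesgue_measure.-integrable `[0, t] (fun s : R => (c (grid_index N s))%:E).
    apply: measurable_bounded_integrable => //.
    - exact: lebesgue_itvcc_fin.
    - exact: measurable_funTS.
    exists 1; split; first exact: num_real.
    move=> x x1 s _ /=; have /andP[? ?] := c01 (grid_index N s).
    by rewrite ger0_norm// (le_trans _ (ltW x1)).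
  have I_E : I_ N = h N * (\sum_(m < K) c m) +
      \int[lebesgue_measure]_(s in `[(K%:R / N.+1%:R), t]) c (grid_index N s).
    rewrite -SE -Rintegral_setU//=.
    - by rewrite -itv_bndbnd_setU// bnd_simp// divr_ge0.
    - by rewrite -itv_bndbnd_setU// bnd_simp// divr_ge0.
    - apply/disj_setPS => y [/=]; rewrite 2!in_itv/= => /andP[_ yx] /andP[].
      by rewrite leNgt yx.
  have J0 : 0 <= \int[lebesgue_measure]_(s in `[(K%:R / N.+1%:R), t]) c (grid_index N s).
    by apply: Rintegral_ge0 => s _; have /andP[] := c01 (grid_index N s).
  have Jh : \int[lebesgue_measure]_(s in `[(K%:R / N.+1%:R), t]) c (grid_index N s) <= h N.
    have sub : `[K%:R / N.+1%:R, t]%classic `<=` (`[0%R, t]%classic : set R).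
      by apply: subset_itvr; rewrite bnd_simp divr_ge0.
    apply: (@le_trans _ _ (\int[lebesgue_measure]_(s in `[(K%:R / N.+1%:R), t]) 1)).
      apply: le_Rintegral => //; first by apply: integrableS iU.
        exact: integrable_itvcc_cst.
      by move=> s _; have /andP[] := c01 (grid_index N s).
    rewrite Rintegral_cst// mul1r.
    have -> : fine (lebesgue_measure (`[K%:R / N.+1%:R, t]%classic : set R)) = t - K%:R / N.+1%:R.
      rewrite lebesgue_measure_itv/= lte_fin; case: ltP => //= tK.
      by apply/esym/eqP; rewrite subr_eq0 eq_le tK g1.
    rewrite lerBlDl ltW// (lt_le_trans g2)// -[_.+1]addn1 natrD mulrDl mul1r//.
  have GE : grid_occupation N t w i = h N * (X 0 w == i)%:R + h N * (\sum_(m < K) c m).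
    rewrite /grid_occupation -/K -mulrDr big_ord_recl mul0r; congr (_ * (_ + _)).
  have X0 : 0 <= h N * (X 0 w == i)%:R <= h N.
    by case: (_ == _); rewrite ?mulr0 ?mulr1 ?lexx ?(ltW (h0 N)).
  by rewrite GE I_E; apply: arith => //; rewrite J0.
apply: (@squeeze_cvgr _ _ _ _ (fun N => I_ N - h N) (fun N => I_ N + h N)).
- by apply: nearW => N; exact: IE.
- by rewrite -[X in _ --> X]subr0; apply: cvgB => //; exact: cvg_harmonic.
- by rewrite -[X in _ --> X]addr0; apply: cvgD => //; exact: cvg_harmonic.
Qed.

End occupation_times.

Lemma integrable_expRN (R : realType) (mu : R) : 0 < mu ->
  lebesgue_measure.-integrable (`[0, +oo[%classic : set R) (fun t => (expR (- mu * t))%:E).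
Proof.
move=> mu0.
have I1 : lebesgue_measure.-integrable (`[0, +oo[%classic : set R) (EFin \o exponential_pdf mu).
  by apply: integrableS (integrable_exponential_pdf mu0).
have mI : measurable (`[0, +oo[%classic : set (measurableTypeR R)) by exact: measurable_itv.
have := integrableZl mI mu^-1 I1.
apply: eq_integrable => // t /[!inE]/= /[!in_itv]/= /andP[t0 _].
rewrite exponential_pdfE// -EFinM mulrA mulVf ?gt_eqF// mul1r.
by rewrite mulNr.
Qed.

Lemma cvg_derive_harmonic (R : realType) (f : R -> R) (x df : R) : is_derive x 1 f df ->
  n.+1%:R * (f (x + n.+1%:R^-1) - f x) @[n --> \oo] --> df.
Proof.
move=> [dG <-].
have /cvg_at_rightP := cvg_dnbhs_at_right dG.
move=> /(_ (fun n => n.+1%:R^-1)) /=.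
have h0 : (forall n, 0 < n.+1%:R^-1 :> R) /\ (n.+1%:R^-1 : R) @[n --> \oo] --> (0 : R).
  by split=> [n|]; [rewrite invr_gt0 ltr0n|exact: cvg_harmonic].
move=> /(_ h0); apply: cvg_trans; apply: near_eq_cvg; apply: nearW => n.
by rewrite invrK /= /shift /= [_ *: 1]mulr1 [_ + x]addrC.
Qed.

Lemma cvg_expRN_quotient (R : realType) (c : R) :
  n.+1%:R * (1 - expR (- c / n.+1%:R)) @[n --> \oo] --> c.
Proof.
have H : is_derive (0 : R) 1 (fun t => - expR (- c * t)) c.
  have H1 : is_derive (0 : R) 1 (fun t : R => - c * t) (- c).
    have := is_deriveZ (- c) (is_derive_id (0 : R) 1).
    by rewrite /GRing.scale/= mulr1.
  have H2 := is_deriveN (is_derive1_comp (is_derive_expR (- c * 0)) H1).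
  by apply: is_derive_eq H2 _; rewrite mulr0 expR0 mul1r opprK.
have := cvg_derive_harmonic H; apply: cvg_trans; apply: near_eq_cvg; apply: nearW => n /=.
by rewrite add0r mulr0 expR0 opprK [- _ + 1]addrC.
Qed.

Lemma cvg_sum_seq (R : realType) (T : Type) (s : seq T) (Q : pred T)
    (u : T -> nat -> R) (l : T -> R) :
  (forall i, Q i -> u i n @[n --> \oo] --> l i) ->
  \sum_(i <- s | Q i) u i n @[n --> \oo] --> \sum_(i <- s | Q i) l i.
Proof.
move=> ul; elim: s => [|i s IH].
  by rewrite big_nil; under eq_fun do rewrite big_nil; exact: cvg_cst.
rewrite big_cons; under eq_fun do rewrite big_cons; case: ifPn => // Qi.
by apply: cvgD; [exact: ul|].
Qed.

(** * The Feynman-Kac functional and the resolvent equation *)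

Section feynman_kac.
Context {R : realType} {L : finType} (beta : L -> L -> R).
Context d {W : measurableType d} (P : L -> probability W R) (X : R -> W -> L).
Hypothesis JP : jump_process beta P X.

Lemma measurable_process (t : R) (g : L -> R) : 0 <= t ->
  measurable_fun [set: W] (fun w => g (X t w)).
Proof.
(* Only measurability is extracted, so any law of the family will do; [X 0 point] supplies a state,
   as [L] carries no distinguished element. *)
move=> t0; have [/measurable_int + _] := Rintegral_finite_range (P (X 0 point)) g
  (fun k => jp_measurable JP k t0).
by move/measurable_EFinP.
Qed.

Lemma occupation_ge0 (t : R) w i : 0 <= occupation X t w i.
Proof. by apply: Rintegral_ge0 => s _. Qed.

Variables (lam phi : L -> R).

Definition discounted (t : R) (w : W) : R :=
  expR (- \sum_i lam i * occupation X t w i) * phi (X t w).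

(* The path is sampled at the right end point of the grid cell of [t], because
   right continuity then gives convergence at every [t]. *)
Definition grid_discounted (N : nat) (t : R) (w : W) : R :=
  (\prod_(m < (grid_index N t).+1) expR (- lam (X (m%:R / N.+1%:R) w) / N.+1%:R)) *
  phi (X ((grid_index N t).+1%:R / N.+1%:R) w).

Lemma grid_discountedE N t w : grid_discounted N t w =
  expR (- \sum_i lam i * grid_occupation X N t w i) *
  phi (X ((grid_index N t).+1%:R / N.+1%:R) w).
Proof.
congr (_ * _); rewrite -expR_sum; congr expR.
rewrite /grid_occupation -sumrN.
rewrite (eq_bigr (fun i => \sum_(m < (grid_index N t).+1)
   - lam i * (X (m%:R / N.+1%:R) w == i)%:R / N.+1%:R)); last first.
  by move=> i _; rewrite !mulr_sumr -sumrN; apply: eq_bigr => m _; ring.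
rewrite exchange_big; apply: eq_bigr => m _ /=.
rewrite (bigD1 (X (m%:R / N.+1%:R) w))//= eqxx mulr1 big1 ?addr0// => i /negbTE.
by rewrite eq_sym => ->; rewrite mulr0 mul0r.
Qed.

Lemma cvg_grid_discounted t w : 0 <= t ->
  grid_discounted N t w @[N --> \oo] --> discounted t w.
Proof.
move=> t0; under eq_fun do rewrite grid_discountedE.
apply: cvgM; last exact: (cvg_path_grid JP).
apply: continuous_cvg; first exact: continuous_expR.
apply: cvgN; apply: cvg_sum_seq => i _.
by apply: cvgM; [exact: cvg_cst|exact: (cvg_grid_occupation JP)].
Qed.

Variable mu : R.
Hypothesis mu_ge0 : 0 <= mu.
Hypothesis lam_ge : forall i, mu <= lam i.

Let c := \sum_i `|phi i|.

Let phi_le i : `|phi i| <= c.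
Proof. by rewrite /c (bigD1 i)//= lerDl; apply: sumr_ge0. Qed.

Let c_ge0 : 0 <= c. Proof. by apply: sumr_ge0. Qed.

Lemma grid_discounted_le N t w : 0 <= t -> `|grid_discounted N t w| <= c * expR (- mu * t).
Proof.
move=> t0; rewrite normrM mulrC ler_pM//.
rewrite ger0_norm; last by apply: prodr_ge0 => m _; exact: expR_ge0.
apply: (@le_trans _ _ (\prod_(m < (grid_index N t).+1) expR (- mu / N.+1%:R))).
  apply: ler_prod => m _; rewrite expR_ge0/= ler_expR ler_pM2r ?invr_gt0//.
  by rewrite lerN2.
rewrite prodr_const card_ord -expRM_natl ler_expR mulNr mulrN mulNr lerN2.
(* The discount runs over [(grid_index N t).+1] cells, whose total length is at least [t]; this
   off-by-one gives the bound exp(- mu t) with no loss for any mesh. *)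
have /andP[_ /ltW g2] := grid_index_itv N t0.
by rewrite mulrCA ler_wpM2l.
Qed.

Definition grid_expect (N : nat) (t : R) : L -> R :=
  iter (grid_index N t).+1
    (discounted_step P X (fun i => expR (- lam i / N.+1%:R)) N.+1%:R^-1) phi.

Definition discounted_expect (t : R) (j : L) : R := \int[P j]_w discounted t w.

Lemma grid_expectE N t j : (P j).-integrable setT (fun w => (grid_discounted N t w)%:E) /\
  \int[P j]_w grid_discounted N t w = grid_expect N t j.
Proof.
exact: (expect_grid JP (fun i => expR (- lam i / N.+1%:R)) phi (grid_index N t).+1).
Qed.

Lemma cvg_grid_expect t j : 0 <= t ->
  (P j).-integrable setT (fun w => (discounted t w)%:E) /\
  grid_expect N t j @[N --> \oo] --> discounted_expect t j.
Proof.
move=> t0.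
have [i1 c1] : (P j).-integrable setT (fun w => (discounted t w)%:E) /\
    \int[P j]_w grid_discounted N t w @[N --> \oo] --> discounted_expect t j.
  apply: (@Rintegral_dominated_cvg _ _ R (P j) setT
    (fun N w => grid_discounted N t w) (discounted t) (fun=> c * expR (- mu * t))) => //.
  - by move=> N; have [/measurable_int/measurable_EFinP] := grid_expectE N t j.
  - by move=> w _; exact: cvg_grid_discounted.
  - exact: finite_measure_integrable_cst.
  - by move=> N w _; exact: grid_discounted_le.
split => //; move: c1; under eq_fun do rewrite (grid_expectE _ t j).2; exact.
Qed.

Lemma grid_expect_le N t j : 0 <= t -> `|grid_expect N t j| <= c * expR (- mu * t).
Proof.
move=> t0; have [i1 <-] := grid_expectE N t j.
apply: le_trans (le_normr_Rintegral measurableT i1) _.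
apply: (@le_trans _ _ (\int[P j]_w (c * expR (- mu * t)))).
  apply: le_Rintegral => //.
  - have := integrable_norm i1; exact.
  - exact: finite_measure_integrable_cst.
  - by move=> w _; exact: grid_discounted_le.
rewrite Rintegral_cst//; have /= -> := @probability_setT _ _ _ (P j).
by rewrite mulr1.
Qed.

Lemma measurable_grid_expect N j : measurable_fun [set: R] (fun t => grid_expect N t j).
Proof.
apply: (measurable_nat_index (c := fun m _ => iter m.+1
  (discounted_step P X (fun i => expR (- lam i / N.+1%:R)) N.+1%:R^-1) phi j)) => //.
exact: measurable_grid_index.
Qed.

Hypothesis mu_gt0 : 0 < mu.

Let nonneg : set R := `[0, +oo[%classic.

Lemma integrable_grid_expect N j :
  lebesgue_measure.-integrable nonneg (fun t => (grid_expect N t j)%:E).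
Proof.
have mN : measurable (nonneg : set (measurableTypeR R)) by exact: measurable_itv.
apply: (le_integrable mN _ _ (integrableZl mN c (integrable_expRN mu_gt0))).
  by apply/measurable_EFinP; apply: measurable_funTS; exact: measurable_grid_expect.
move=> t; rewrite /nonneg /= in_itv /= andbT => t0.
rewrite lee_fin; apply: le_trans (grid_expect_le N j t0) _.
exact: ler_norm.
Qed.

Definition resolvent (j : L) : R := \int[lebesgue_measure]_(t in nonneg) discounted_expect t j.

Definition grid_resolvent (N : nat) (j : L) : R :=
  \int[lebesgue_measure]_(t in nonneg) grid_expect N t j.

Lemma cvg_grid_resolvent j :
  lebesgue_measure.-integrable nonneg (fun t => (discounted_expect t j)%:E) /\
  grid_resolvent N j @[N --> \oo] --> resolvent j.
Proof.
apply: (@Rintegral_dominated_cvg _ _ R lebesgue_measure nonneg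
  (fun N t => grid_expect N t j) _ (fun t => c * expR (- mu * t))).
- exact: measurable_itv.
- by move=> N; apply: measurable_funTS; exact: measurable_grid_expect.
- by move=> t; rewrite /nonneg/= in_itv/= andbT => t0; exact: (cvg_grid_expect j t0).2.
- have mN : measurable (nonneg : set (measurableTypeR R)) by exact: measurable_itv.
  exact: (integrableZl mN c (integrable_expRN mu_gt0)).
- by move=> N t; rewrite /nonneg/= in_itv/= andbT => t0; exact: grid_expect_le.
Qed.

(** A discrete renewal equation: the first cell contributes its length times [M phi], and
    translating the remaining half-line back by one mesh turns it into one step [M] applied to the
    whole integral. *)
Lemma grid_resolventE N :
  let M := discounted_step P X (fun i => expR (- lam i / N.+1%:R)) N.+1%:R^-1 in
  forall j, grid_resolvent N j = N.+1%:R^-1 * M phi j + M (grid_resolvent N) j.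
Proof.
move=> M j; pose h : R := N.+1%:R^-1; have h0 : 0 < h by rewrite invr_gt0.
have mN : measurable (nonneg : set (measurableTypeR R)) by exact: measurable_itv.
have NE : nonneg = `[0, 1%:R / N.+1%:R[%classic `|` `[h, +oo[%classic.
  by rewrite /nonneg (@itv_bndbnd_setU _ _ _ (BLeft h)) ?bnd_simp ?(ltW h0)// mul1r.
have iN := integrable_grid_expect N j.
rewrite [LHS]/grid_resolvent [in LHS]NE Rintegral_setU//=; last 2 first.
- by rewrite -NE.
- apply/disj_setPS => y [/=]; rewrite 2!in_itv/= mul1r => /andP[_ yx] /andP[].
  by rewrite leNgt yx.
have [_ ->] := Rintegral_grid N (fun m => iter m.+1 M phi j) 1.
rewrite big_ord1 /=; congr (_ + _).
rewrite Rintegral_mkcond -(Rintegral_lebesgue_shift h); last first.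
  apply/(measurable_restrictT _ _).1 => //.
  by apply: measurable_funTS; exact: measurable_grid_expect.
transitivity (\int[lebesgue_measure]_(t in nonneg) (M (grid_expect N t) j)).
  rewrite [RHS]Rintegral_mkcond; apply: eq_Rintegral => t _.
  rewrite /patch /nonneg !mem_setE !in_itv/= !andbT lerDr; case: ifPn => // t0.
  rewrite /grid_expect -/M (_ : grid_index N (t + h) = (grid_index N t).+1)//.
  rewrite /grid_index mulrDl mulVf//; apply: truncn_def.
  have /andP[g1 g2] : (grid_index N t)%:R <= t * N.+1%:R < (grid_index N t).+1%:R.
    by apply: truncn_itv; rewrite mulr_ge0.
  rewrite -/(grid_index N t) -addn1 -[X in _ <= _ < X%:R]addn1 !natrD lerD2r ltrD2r.
  by rewrite g1 -(natrD _ _ 1) addn1.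
have iZ k : lebesgue_measure.-integrable nonneg
    (fun t => (transition P X h j k * grid_expect N t k)%:E).
  exact: (integrableZl mN _ (integrable_grid_expect N k)).
have [iS SE] := Rintegral_sum (index_enum L) mN iZ.
rewrite /M /discounted_step (RintegralZl _ mN iS) SE; congr (_ * _).
by apply: eq_bigr => k _; exact: (RintegralZl _ mN (integrable_grid_expect N k)).
Qed.

(** The renewal equation is multiplied by N + 1. Then (N + 1) (1 - a_j) tends to lam_j, the
    derivative of - exp(- lam_j t) at 0, and (N + 1) times the transition probability from j to k
    tends to the jump rate. *)
Lemma resolvent_eq j :
  lam j * resolvent j - \sum_k beta j k * (resolvent k - resolvent j) = phi j.
Proof.
pose a (N : nat) (i : L) : R := expR (- lam i / N.+1%:R).
pose h (N : nat) : R := N.+1%:R^-1.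
pose p N k := transition P X (h N) j k.
have h0 N : 0 < h N by rewrite invr_gt0.
pose V N k := grid_resolvent N k.
have cV k : V N k @[N --> \oo] --> resolvent k := (cvg_grid_resolvent k).2.
have ch : h N @[N --> \oo] --> (0 : R) by exact: cvg_harmonic.
(* Rates are prescribed off the diagonal only; the diagonal transition is eliminated because the
   rows sum to 1, which produces the differences of the Laplacian. *)
have sum_p N (x : L -> R) : \sum_k p N k * x k = x j + \sum_(k | k != j) p N k * (x k - x j).
  under [in RHS]eq_bigr do rewrite mulrBr; rewrite sumrB -mulr_suml.
  have := sum_transition JP j (ltW (h0 N)); rewrite (bigD1 j)//= => /eqP.
  rewrite -/(p N j) addrC eq_sym -subr_eq => /eqP pj.
  by rewrite (bigD1 j)//= -pj /p; ring.
have cp k : k != j -> N.+1%:R * p N k @[N --> \oo] --> beta j k.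
  move=> kj; have jk : j != k by rewrite eq_sym.
  have /cvg_at_rightP H := jp_rate JP jk; have := H h (conj h0 ch).
  by apply: cvg_trans; apply: near_eq_cvg; apply: nearW => N; rewrite /h invrK mulrC.
have cp0 k : k != j -> p N k @[N --> \oo] --> (0 : R).
  move=> kj; have H := cvgM ch (cp k kj); rewrite mul0r in H.
  rewrite (_ : (fun N => p N k) = h \* (fun N => N.+1%:R * p N k)); first exact: H.
  by apply/funext => N /=; rewrite mulKf ?gt_eqF.
have ca : a N j @[N --> \oo] --> (1 : R).
  rewrite -[X in _ --> X]expR0; apply: continuous_cvg; first exact: continuous_expR.
  by rewrite -(mulr0 (- lam j)); apply: cvgM => //; exact: cvg_cst.
have E N : N.+1%:R * (1 - a N j) * V N j -
    a N j * \sum_(k | k != j) N.+1%:R * p N k * (V N k - V N j) =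
    a N j * (phi j + \sum_(k | k != j) p N k * (phi k - phi j)).
  have := grid_resolventE N j; rewrite /discounted_step -/(a N j) -/(h N).
  rewrite -/(V N j) (sum_p N phi) (sum_p N (V N)) => VE.
  under [X in _ - _ * X]eq_bigr do rewrite -mulrA.
  rewrite -mulr_sumr mulrBr mulrBl mulr1 -[X in X * V N j - _]mul1r {1}VE /h.
  by field.
have clhs : N.+1%:R * (1 - a N j) * V N j -
    a N j * \sum_(k | k != j) N.+1%:R * p N k * (V N k - V N j) @[N --> \oo] -->
    lam j * resolvent j - 1 * \sum_(k | k != j) beta j k * (resolvent k - resolvent j).
  apply: cvgB; first by apply: cvgM => //; exact: cvg_expRN_quotient.
  apply: cvgM => //; apply: cvg_sum_seq => k kj; apply: cvgM; first exact: cp.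
  exact: cvgB.
have crhs : a N j * (phi j + \sum_(k | k != j) p N k * (phi k - phi j)) @[N --> \oo] -->
    1 * (phi j + \sum_(k | k != j) 0 * (phi k - phi j)).
  apply: cvgM => //; apply: cvgD; first exact: cvg_cst.
  by apply: cvg_sum_seq => k kj; apply: cvgM; [exact: cp0|exact: cvg_cst].
rewrite (funext E) in clhs; have := cvg_unique (@Rhausdorff R) clhs crhs.
rewrite !mul1r [X in _ = _ + X]big1 ?addr0 => [<-|k _]; last by rewrite mul0r.
by congr (_ - _); rewrite (bigD1 j)//= subrr mulr0 add0r.
Qed.

End feynman_kac.

(** * Joint measurability and Fubini in time and path *)

Section space_time.
Context {R : realType} {L : finType} (beta : L -> L -> R).
Context d {W : measurableType d} (P : L -> probability W R) (X : R -> W -> L).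
Hypothesis JP : jump_process beta P X.

Let RW : measurableType _ := (measurableTypeR R * W)%type.

(* [X t] is constrained only for [t >= 0]; measurability on the whole product
   space requires truncating the time at 0. *)
Let posr (z : RW) : R := Num.max z.1 0.

Let posr_ge0 z : 0 <= posr z. Proof. by rewrite le_max lexx orbT. Qed.

Let grid_posr N m : measurable ((fun z : RW => grid_index N (posr z)) @^-1` [set m]).
Proof.
have mp : measurable_fun [set: RW] posr.
  by apply: measurable_maxr => //; exact: measurable_fst.
rewrite -[X in measurable X]setTI.
exact: (mp measurableT _ (measurable_grid_index N m)).
Qed.

Let X_snd (m : nat) N (g : L -> R) : measurable_fun [set: RW] (fun z : RW => g (X (m%:R / N.+1%:R) z.2)).
Proof.
apply: (measurableT_comp (f := fun w => g (X (m%:R / N.+1%:R) w))); last exact: measurable_snd.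
by apply: (measurable_process JP); rewrite divr_ge0.
Qed.

Lemma measurable_path (g : L -> R) :
  measurable_fun [set: RW] (fun z : RW => g (X (Num.max z.1 0) z.2)).
Proof.
apply: (measurable_fun_cvg (h := fun N (z : RW) => g (X ((grid_index N (posr z)).+1%:R / N.+1%:R) z.2))).
  move=> N; apply: (measurable_nat_index (c := fun m (z : RW) => g (X (m.+1%:R / N.+1%:R) z.2))).
    exact: grid_posr.
  by move=> m; exact: (@X_snd m.+1 _ g).
by move=> z _; exact: (@cvg_path_grid _ _ _ _ _ _ _ JP z.2 _ g (posr_ge0 z)).
Qed.

Lemma measurable_space_time_occupation i :
  measurable_fun [set: RW] (fun z : RW => occupation X (Num.max z.1 0) z.2 i).
Proof.
apply: (measurable_fun_cvg (h := fun N (z : RW) => grid_occupation X N (posr z) z.2 i)).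
  move=> N; apply: (measurable_nat_index (c := fun m (z : RW) =>
      N.+1%:R^-1 * \sum_(a < m.+1) (X (a%:R / N.+1%:R) z.2 == i)%:R)) => m.
    exact: grid_posr.
  apply: measurable_funM => //; apply: measurable_sum => a.
  exact: (@X_snd a N (fun k => (k == i)%:R)).
by move=> z _; exact: (@cvg_grid_occupation _ _ _ _ _ _ _ JP _ z.2 i (posr_ge0 z)).
Qed.

End space_time.

Section integral_param.
Local Open Scope ereal_scope.
Context d1 d2 (T1 : measurableType d1) (T2 : measurableType d2) (R : realType).
Variable m2 : {sigma_finite_measure set T2 -> \bar R}.

Lemma measurable_Rintegral_param (F : T1 * T2 -> R) (D : set T2) : measurable D ->
  measurable_fun [set: T1 * T2] F ->
  measurable_fun [set: T1] (fun x => (\int[m2]_(y in D) F (x, y))%R).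
Proof.
move=> mD mF.
have mG : measurable_fun [set: T1 * T2] (fun z => (F z * \1_D z.2)%R).
  apply: measurable_funM => //.
  apply: (measurableT_comp (f := \1_D : T2 -> R)); last exact: measurable_snd.
  exact: measurable_indic.
have mG' : measurable_fun [set: T1 * T2] (fun z => (F z * \1_D z.2)%:E).
  exact/measurable_EFinP.
rewrite (_ : (fun x => _) = fine \o (fun x =>
    \int[m2]_y (fun z => (F z * \1_D z.2)%:E)^\+ (x, y) -
    \int[m2]_y (fun z => (F z * \1_D z.2)%:E)^\- (x, y))).
  apply: measurableT_comp => //; apply: emeasurable_funB.
    apply: (measurable_fun_fubini_tonelli_F (m2 := m2)) => //.
    exact: measurable_funepos.
  apply: (measurable_fun_fubini_tonelli_F (m2 := m2)) => //.
  exact: measurable_funeneg.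
apply/funext => x /=; rewrite Rintegral_mkcond /Rintegral integralE.
congr (fine (_ - _)); apply: eq_integral => y _.
  by rewrite !funeposE; congr (maxe _ _); rewrite /patch indicE; case: ifPn; rewrite (mulr1, mulr0).
by rewrite !funenegE; congr (maxe _ _); rewrite /patch indicE; case: ifPn; rewrite (mulr1, mulr0).
Qed.

End integral_param.

Section half_line_fubini.
Context {R : realType} d {W : measurableType d} (Q : probability W R).

Let RW : measurableType _ := (measurableTypeR R * W)%type.

Definition half_line : set (measurableTypeR R) := `[0, +oo[%classic.

Lemma measurable_half_line : measurable half_line.
Proof. exact: measurable_itv. Qed.

Lemma in_half_line t : half_line t <-> 0 <= t.
Proof. by rewrite /half_line/= in_itv/= andbT. Qed.

Definition space_time : set RW := half_line `*` [set: W].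

Lemma measurable_space_time : measurable space_time.
Proof. by apply: measurableX => //; exact: measurable_half_line. Qed.

Definition space_time_measure : set (measurableTypeR R * W)%type -> \bar R :=
  (@lebesgue_measure R \x Q)%E.

HB.instance Definition _ := Measure.on space_time_measure.

Let space_time_measure_sigma_finite : sigma_finite setT space_time_measure.
Proof.
exists (fun n : nat => (`[- n%:R, n%:R]%classic : set (measurableTypeR R)) `*` [set: W]).
  apply/seteqP; split => // -[t w] _; exists (Num.truncn `|t|).+1 => //; split => //=.
  by rewrite in_itv/= -ler_norml; exact/ltW/truncnS_gt.
move=> n; split; first by apply: measurableX.
rewrite /space_time_measure product_measure1E//.
have /= -> := @probability_setT _ _ _ Q.
rewrite mule1.
have -> : lebesgue_measure (`[- n%:R, n%:R]%classic : set (measurableTypeR R)) =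
  lebesgue_measure (`[- n%:R, n%:R]%classic : set R) by [].
by rewrite lebesgue_measure_itv/=; case: ifP => // _; rewrite -EFinB ltry.
Qed.

HB.instance Definition _ := Measure_isSigmaFinite.Build _ _ _ space_time_measure
  space_time_measure_sigma_finite.

Let restrict_space_time (F : RW -> R) : (fun z => ((F \_ space_time) z)%:E) =
  (fun z => (F z)%:E) \_ space_time.
Proof. by rewrite restrict_EFin. Qed.

Let patch_space_time (F : RW -> R) t w :
  (F \_ space_time) (t, w) = ((fun t => F (t, w)) \_ half_line) t.
Proof.
rewrite /patch; congr (if _ then _ else _); apply/idP/idP => /[!inE]; first by case.
by split.
Qed.

Lemma ge0_integral_space_time (F : RW -> R) : measurable_fun [set: RW] F ->
  (forall z, 0 <= F z) ->
  (\int[space_time_measure]_(z in space_time) (F z)%:E =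
  \int[lebesgue_measure]_(t in half_line) \int[Q]_w (F (t, w))%:E)%E.
Proof.
move=> mF F0; have mR : measurable_fun [set: RW] (F \_ space_time).
  apply/(measurable_restrictT _ _).1; first exact: measurable_space_time.
  exact: measurable_funTS.
rewrite integral_mkcond -restrict_space_time.
rewrite (@fubini_tonelli1 _ _ _ _ R lebesgue_measure Q (fun z => ((F \_ space_time) z)%:E)); last 2 first.
- exact/measurable_EFinP.
- by move=> z; rewrite lee_fin /patch; case: ifP.
rewrite [RHS]integral_mkcond; apply: eq_integral => t _; rewrite /fubini_F /=.
under eq_integral do rewrite patch_space_time.
by rewrite /patch; case: ifPn => // _; rewrite integral0.
Qed.

(** Fubini alone makes the sections integrable for almost every t. Integrability at every t >= 0
    makes the inner real-valued integral agree with the extended one at each time, with no default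
    value 0 interfering. *)
Lemma Rintegral_space_time (F : RW -> R) : measurable_fun [set: RW] F ->
  space_time_measure.-integrable space_time (fun z => (F z)%:E) ->
  (forall t, 0 <= t -> Q.-integrable setT (fun w => (F (t, w))%:E)) ->
  lebesgue_measure.-integrable half_line (fun t => (\int[Q]_w F (t, w))%:E) /\
  \int[lebesgue_measure]_(t in half_line) \int[Q]_w F (t, w) =
  \int[space_time_measure]_(z in space_time) F z.
Proof.
move=> mF iF iFt.
have iR : (@lebesgue_measure R \x Q)%E.-integrable setT (fun z => ((F \_ space_time) z)%:E).
  by rewrite restrict_space_time; apply/(integrable_mkcond _ _).1 => //; exact: measurable_space_time.
have FE : fubini_F Q (fun z => ((F \_ space_time) z)%:E) =
    (fun t => (\int[Q]_w F (t, w))%:E) \_ half_line.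
  apply/funext => t; rewrite /fubini_F.
  under eq_integral do rewrite patch_space_time.
  rewrite /patch; case: ifPn => [/[!inE]/in_half_line t0|_]; last by rewrite integral0.
  rewrite /Rintegral fineK//; exact: (integrable_fin_num measurableT (iFt t t0)).
have := integrable_fubini_F iR; have := integral12_prod_meas1 iR; rewrite FE => E1 I1.
split; first by apply/(integrable_mkcond _ measurable_half_line).2.
by rewrite /Rintegral [in LHS]integral_mkcond E1 [in RHS]integral_mkcond -restrict_space_time.
Qed.

End half_line_fubini.

(** * Decay of occupation times *)

Section resolvent_bounds.
Context {R : realType} {L : finType} (beta : L -> L -> R).
Context d {W : measurableType d} (P : L -> probability W R) (X : R -> W -> L).
Hypothesis JP : jump_process beta P X.

Let RW : measurableType _ := (measurableTypeR R * W)%type.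

Let max0 (t : R) : 0 <= t -> Num.max t 0 = t.
Proof. by move=> t0; apply: max_l. Qed.

Lemma measurable_discounted (lam phi : L -> R) :
  measurable_fun [set: RW] (fun z : RW => discounted X lam phi (Num.max z.1 0) z.2).
Proof.
apply: measurable_funM; last exact: (measurable_path JP).
apply: measurableT_comp => //; apply: measurable_funN; apply: measurable_sum => i.
by apply: measurable_funM => //; exact: (measurable_space_time_occupation JP).
Qed.

(** Absolute integrability on space-time follows from Tonelli applied with |phi| in place of [phi],
    whose iterated integral is already known to be finite; Fubini then gives the value. *)
Lemma integral_discounted (lam phi : L -> R) (mu : R) j : 0 < mu ->
  (forall i, mu <= lam i) ->
  (space_time_measure (P j)).-integrable (@space_time R d W)
    (fun z => (discounted X lam phi (Num.max z.1 0) z.2)%:E) /\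
  \int[space_time_measure (P j)]_(z in @space_time R d W)
    discounted X lam phi (Num.max z.1 0) z.2 = resolvent P X lam phi j.
Proof.
move=> mu0 lam_ge.
have int_abs : (space_time_measure (P j)).-integrable (@space_time R d W)
    (fun z => (discounted X lam phi (Num.max z.1 0) z.2)%:E).
  apply/integrableP; split.
    by apply/measurable_EFinP; apply: measurable_funTS; exact: measurable_discounted.
  have E z : `|(discounted X lam phi (Num.max z.1 0) z.2)%:E|%E =
      (discounted X lam (fun i => `|phi i|) (Num.max z.1 0) z.2)%:E.
    by rewrite abse_EFin /discounted normrM ger0_norm// expR_ge0.
  under eq_integral do rewrite E.
  rewrite ge0_integral_space_time; last 2 first.
  - exact: measurable_discounted.
  - by move=> z; rewrite mulr_ge0 ?expR_ge0.
  have [/integrableP[_]] := cvg_grid_resolvent JP (fun i => `|phi i|) (ltW mu0) lam_ge mu0 j.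
  move=> H _; apply: le_lt_trans H; rewrite le_eqVlt; apply/orP; left; apply/eqP.
  apply: eq_integral => t /[!inE]/in_half_line t0 /=.
  have [it _] := cvg_grid_expect JP (fun i => `|phi i|) (ltW mu0) lam_ge j t0.
  rewrite max0// -[LHS]fineK; last exact: (integrable_fin_num measurableT it).
  rewrite ger0_norm//; apply: Rintegral_ge0 => w _; by rewrite mulr_ge0 ?expR_ge0.
split => //; have [|_ <-] := Rintegral_space_time (measurable_discounted lam phi) int_abs.
  move=> t t0 /=; rewrite max0//.
  by have [] := cvg_grid_expect JP phi (ltW mu0) lam_ge j t0.
by apply: eq_Rintegral => t /[!inE]/in_half_line t0 /=; rewrite max0.
Qed.

Hypothesis beta_sym : forall i j, beta i j = beta j i.
Hypothesis beta_ge0 : forall i j, 0 <= beta i j.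
Hypothesis beta_connected : forall i j, connect (fun i j => 0 < beta i j) i j.

Lemma resolvent_ge0 (lam phi : L -> R) j : (forall i, 0 <= phi i) ->
  0 <= resolvent P X lam phi j.
Proof.
move=> phi0; apply: Rintegral_ge0 => t _; apply: Rintegral_ge0 => w _.
by rewrite mulr_ge0 ?expR_ge0.
Qed.

Lemma dirichlet_formE (x : L -> R) :
  dirichlet_form beta x = - (2 * \sum_j x j * (\sum_k beta j k * (x k - x j))).
Proof.
have S : \sum_j x j * (\sum_k beta j k * (x k - x j)) =
    \sum_j \sum_k beta j k * (x j * x k - x j ^+ 2).
  by apply: eq_bigr => j _; rewrite mulr_sumr; apply: eq_bigr => k _; ring.
have S' : \sum_j x j * (\sum_k beta j k * (x k - x j)) =
    \sum_j \sum_k beta j k * (x j * x k - x k ^+ 2).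
  rewrite S exchange_big; apply: eq_bigr => j _; apply: eq_bigr => k _ /=.
  by rewrite beta_sym; ring.
rewrite mulr_natl mulr2n {1}S S' /dirichlet_form -big_split -sumrN; apply: eq_bigr => j _ /=.
by rewrite -big_split -sumrN; apply: eq_bigr => k _ /=; ring.
Qed.

(* Testing the resolvent equation for [V] against [V] itself gives
   [s V_k^2 + D(V) / 2 <= \sum_i V_i], and the Poincare inequality bounds
   [\sum_i V_i^2] by a multiple of [1 / s] times the left-hand side. *)
Lemma resolvent_bound : exists2 B : R, 0 <= B & forall (s eps : R) k j, 0 < s <= 1 -> 0 < eps ->
  resolvent P X (fun i => eps + s * (i == k)%:R) (fun=> 1) j <= B / s.
Proof.
have [C C0 CP] := dirichlet_form_poincare beta_ge0 beta_connected.
pose l : R := #|L|%:R; have l0 : 0 <= l by rewrite ler0n.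
pose A := 2 * l + 4 * l * C.
have A0 : 0 <= A by rewrite addr_ge0 ?mulr_ge0.
exists (A * l); first exact: mulr_ge0.
move=> s eps k j /andP[s0 s1] e0.
pose lam i := eps + s * (i == k)%:R.
have lam_ge i : eps <= lam i by rewrite /lam lerDl mulr_ge0// ltW.
pose V := resolvent P X lam (fun=> 1).
have V0 i : 0 <= V i by apply: resolvent_ge0.
have VE i : lam i * V i - \sum_m beta i m * (V m - V i) = 1.
  exact: (resolvent_eq JP (fun=> 1) (ltW e0) lam_ge e0).
pose S := \sum_i V i.
have S0 : 0 <= S by apply: sumr_ge0.
have energy_le : s * V k ^+ 2 + 2^-1 * dirichlet_form beta V <= S.
  have -> : S = \sum_i lam i * V i ^+ 2 + 2^-1 * dirichlet_form beta V.
    rewrite dirichlet_formE mulrN mulKf// -sumrB; apply: eq_bigr => i _.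
    by rewrite -[LHS]mulr1 -(VE i); ring.
  rewrite lerD2r (bigD1 k)//= /lam eqxx mulr1.
  apply: (@le_trans _ _ ((eps + s) * V k ^+ 2)).
    by rewrite ler_wpM2r ?sqr_ge0// lerDr ltW.
  rewrite lerDl; apply: sumr_ge0 => i _; rewrite mulr_ge0 ?sqr_ge0//.
  by rewrite addr_ge0 ?mulr_ge0// ltW.
have D0 := dirichlet_form_ge0 beta_ge0 V.
(* V_i^2 <= 2 V_k^2 + 2 C D(V), while [energy_le] gives V_k^2 <= S / s and D(V) <= 2 S <= 2 S / s,
   the last step using s <= 1. Summing over i produces [A]. *)
have sq_le : \sum_i V i ^+ 2 <= A / s * S.
  apply: (@le_trans _ _ (\sum_(i : L) (2 * V k ^+ 2 + 2 * C * dirichlet_form beta V))).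
    apply: ler_sum => i _; have := CP V i k; have := sqr_ge0 (V i - 2 * V k).
    by rewrite !expr2; nra.
  rewrite sumr_const -[_ *+ #|_|]mulr_natl -/l.
  have Vk : V k ^+ 2 <= S / s.
    rewrite ler_pdivlMr// mulrC; apply: le_trans energy_le.
    by rewrite lerDl mulr_ge0// invr_ge0.
  have Ds : dirichlet_form beta V <= 2 * (S / s).
    have : dirichlet_form beta V <= 2 * S.
      have : 0 <= s * V k ^+ 2 by rewrite mulr_ge0 ?sqr_ge0// ltW.
      by move: energy_le => /[swap]; lra.
    move/le_trans; apply; rewrite ler_wpM2l// ler_pdivlMr//.
    by rewrite ler_piMr.
  rewrite (_ : A / s * S = l * (2 * (S / s) + 2 * C * (2 * (S / s)))); last by rewrite /A; ring.
  apply: ler_wpM2l => //; apply: lerD; first by rewrite ler_wpM2l.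
  by rewrite ler_wpM2l// mulr_ge0.
have [lA|lA] := eqVneq (A / s) 0.
  have : V j ^+ 2 <= 0.
    rewrite lA mul0r in sq_le; apply: le_trans sq_le.
    by rewrite (bigD1 j)//= lerDl; apply: sumr_ge0 => i _; exact: sqr_ge0.
  move=> H; rewrite -/(V j) (_ : V j = 0) ?divr_ge0 ?mulr_ge0 ?(ltW s0)//.
  by apply/eqP; rewrite -sqrf_eq0 eq_le H sqr_ge0.
pose c := A / s; have c0 : 0 < c by rewrite lt_def lA divr_ge0// ltW.
(* From 2 c V_i <= V_i^2 + c^2, summed over i, and [sq_le] comes 2 c S <= c S + l c^2, hence S <= l
   c = l A / s. This is the origin of the constant [A * l]; none of it depends on [eps]. *)
have Sle : S <= l * c.
  have : 2 * c * S <= \sum_i V i ^+ 2 + l * c ^+ 2.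
    rewrite (_ : l * c ^+ 2 = \sum_(i : L) c ^+ 2); last by rewrite sumr_const -mulr_natl.
    rewrite -big_split /S mulr_sumr; apply: ler_sum => i _ /=.
    by have := sqr_ge0 (V i - c); rewrite !expr2; nra.
  move: sq_le; rewrite -/c => H1 H2.
  have : c * S <= c * (l * c) by move: H1 H2; rewrite !expr2; lra.
  by rewrite ler_pM2l.
apply: (@le_trans _ _ S).
  by rewrite -/(V j) /S (bigD1 j)//= lerDl; apply: sumr_ge0.
by apply: (le_trans Sle); rewrite /c le_eqVlt; apply/orP; left; apply/eqP; ring.
Qed.

End resolvent_bounds.

Lemma integrable_fatou d (T : measurableType d) (R : realType)
    (mu : {measure set T -> \bar R}) (D : set T) (f_ : nat -> T -> R) (f : T -> R) (M : R) :
  measurable D -> (forall n, measurable_fun D (f_ n)) ->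
  (forall n x, D x -> 0 <= f_ n x) ->
  (forall x, D x -> f_ n x @[n --> \oo] --> f x) ->
  (forall n, \int[mu]_(x in D) (f_ n x)%:E <= M%:E)%E ->
  mu.-integrable D (fun x => (f x)%:E).
Proof.
move=> mD mf_ f_0 f_f f_M.
have mf : measurable_fun D f by exact: (measurable_fun_cvg mf_ f_f).
have Ef_f x : D x -> ((f_ n x)%:E @[n --> \oo] --> (f x)%:E)%E.
  by move=> Dx; apply: cvg_EFin; [exact: nearW|exact: f_f].
have f0 x : D x -> 0 <= f x.
  move=> Dx; rewrite -(cvg_lim (@Rhausdorff R) (f_f _ Dx)).
  apply: limr_ge; first by apply/cvg_ex; exists (f x); exact: f_f.
  by apply: nearW => n; exact: f_0.
apply/integrableP; split; first exact/measurable_EFinP.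
rewrite (eq_integral (fun x => limn_einf (fun n => (f_ n x)%:E))); last first.
  move=> x /[!inE] Dx; rewrite abse_EFin ger0_norm ?f0//.
  rewrite is_cvg_limn_einfE; last by apply/cvg_ex; exists (f x)%:E; exact: Ef_f.
  by apply/esym/cvg_lim => //; exact: Ef_f.
apply: (@le_lt_trans _ _ M%:E); last exact: ltry.
apply: le_trans (@fatou _ _ _ mu D mD (fun n x => (f_ n x)%:E) _ _) _.
- by move=> n; exact/measurable_EFinP.
- by move=> n x Dx; rewrite lee_fin f_0.
rewrite limn_einf_lim; apply: lime_le; first exact: is_cvg_einfs.
apply: nearW => n; apply: le_trans (f_M n).
by apply: ereal_inf_lbound; exists n => /=.
Qed.

(* If [2^(n-1) <= x <= 2^n], then the [n]-th term is comparable to [(1 + x)^-2]. *)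
Lemma inv_sqr_le_expR (R : realType) (N : nat) (x : R) : 0 <= x <= 2 ^+ N ->
  (1 + x) ^- 2 <= 4 * expR 1 * \sum_(n < N.+1) 4 ^- n * expR (- (2 ^- n * x)).
Proof.
have c0 : 0 <= 4 * expR 1 :> R by rewrite mulr_ge0 ?expR_ge0.
elim: N => [|N IH] /andP[x0 xN].
  rewrite big_ord_recl big_ord0 !expr0 invr1 mul1r addr0 mul1r -mulrA -expRD.
  apply: (@le_trans _ _ 1).
    by rewrite invf_le1 ?exprn_ege1// ?exprn_gt0 ?lerDl// ltr_pwDl.
  apply: (@le_trans _ _ 4); first by rewrite ler1n.
  rewrite ler_peMr// -[X in X <= _]expR0 ler_expR subr_ge0.
  by rewrite expr0 in xN.
rewrite big_ord_recr mulrDr /=; have [xN'|xN'] := leP x (2 ^+ N).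
  apply: (le_trans (IH _)); first by rewrite x0.
  by rewrite lerDl !mulr_ge0 ?expR_ge0 ?invr_ge0 ?exprn_ge0.
(* For 2^N < x <= 2^(N+1) the last term alone suffices: the factor 4 turns 4^-(N+1) into 4^-N, and
   the factor e compensates exp(- x / 2^(N+1)) >= exp(-1). *)
apply: (@le_trans _ _ (4 * expR 1 * (4 ^- N.+1 * expR (- (2 ^- N.+1 * x))))); last first.
  by rewrite lerDr mulr_ge0// sumr_ge0.
apply: (@le_trans _ _ (4 ^- N)).
  rewrite lef_pV2 ?posrE ?exprn_gt0 ?ltr_pwDl// (_ : 4 = 2 ^+ 2); last by rewrite -natrX.
  rewrite -exprM mulnC exprM lerXn2r ?nnegrE ?exprn_ge0 ?addr_ge0//.
  by apply: (le_trans (ltW xN')); rewrite lerDr.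
rewrite mulrACA -expRD exprS invfM mulrA mulfV// mul1r ler_peMr ?invr_ge0 ?exprn_ge0//.
by rewrite -[X in X <= _]expR0 ler_expR subr_ge0 mulrC ler_pdivrMr ?exprn_gt0// mul1r.
Qed.

Section occupation_decay.
Context {R : realType} {L : finType} (beta : L -> L -> R).
Context d {W : measurableType d} (P : L -> probability W R) (X : R -> W -> L).
Hypothesis JP : jump_process beta P X.
Hypothesis beta_sym : forall i j, beta i j = beta j i.
Hypothesis beta_ge0 : forall i j, 0 <= beta i j.
Hypothesis beta_connected : forall i j, connect (fun i j => 0 < beta i j) i j.

Let RW : measurableType _ := (measurableTypeR R * W)%type.
Let occ (z : RW) i := occupation X (Num.max z.1 0) z.2 i.

(** The resolvent bound with s = 2^-n says that exp(- 2^-n occ_k) has space-time integral at most B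
    2^n, uniformly in an extra killing rate eps. The weights 4^-n of the dyadic bound on (1 +
    occ_k)^-2 make the series converge, and Fatou removes the regularisation. *)
Lemma integrable_occupation_decay k j :
  (space_time_measure (P j)).-integrable (@space_time R d W)
    (fun z => ((1 + occupation X (Num.max z.1 0) z.2 k) ^- 2)%:E).
Proof.
have [B B0 BP] := resolvent_bound JP beta_sym beta_ge0 beta_connected.
have occ0 z i : 0 <= occ z i by exact: occupation_ge0.
have mocc i : measurable_fun [set: RW] (fun z => occ z i).
  exact: (measurable_space_time_occupation JP).
pose e (N : nat) : R := N.+1%:R^-1.
pose S z := \sum_i occ z i.
have S0 z : 0 <= S z by apply: sumr_ge0.
pose A (N : nat) := [set z : RW | occ z k <= 2 ^+ N].
(* The cutoff [A N] makes the finite dyadic sum applicable, and the factor exp(- S / (N + 1))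
   supplies the killing rate at every site that [integral_discounted] asks for. Both factors tend to
   1. *)
pose f_ N (z : RW) : R := \1_(A N) z * ((1 + occ z k) ^- 2 * expR (- (e N * S z))).
pose lam N (n : nat) i := e N + 2 ^- n * (i == k)%:R.
pose g N n (z : RW) : R := discounted X (lam N n) (fun=> 1) (Num.max z.1 0) z.2.
have f_g N z : f_ N z <= \sum_(n < N.+1) 4 * expR 1 * 4 ^- n * g N n z.
  have gE n : g N n z = expR (- (2 ^- n * occ z k)) * expR (- (e N * S z)).
    rewrite /g /discounted mulr1 -expRD; congr expR; rewrite -opprD; congr (- _).
    rewrite /lam; under eq_bigr do rewrite mulrDl.
    rewrite big_split -mulr_sumr addrC; congr (_ + _).
    rewrite (bigD1 k)//= eqxx mulr1 big1 ?addr0// => i /negbTE ->.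
    by rewrite mulr0 mul0r.
  have rhs0 n : 0 <= 4 * expR 1 * 4 ^- n * g N n z.
    by rewrite !mulr_ge0 ?expR_ge0 ?invr_ge0 ?exprn_ge0// gE mulr_ge0 ?expR_ge0.
  rewrite /f_ indicE; case: (boolP (z \in A N)) => [/[!inE] oN|_]; last first.
    by rewrite mul0r sumr_ge0.
  rewrite mul1r; have := @inv_sqr_le_expR R N (occ z k); rewrite occ0 oN => /(_ isT).
  move=> /(ler_wpM2r (expR_ge0 (- (e N * S z)))) /le_trans; apply.
  rewrite mulr_sumr mulr_suml; apply: ler_sum => n _; rewrite gE.
  by rewrite le_eqVlt; apply/orP; left; apply/eqP; ring.
have mD := @measurable_space_time R d W.
have mA N : measurable (A N).
  rewrite (_ : A N = (fun z => occ z k) @^-1` `]-oo, 2 ^+ N]); last first.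
    by apply/seteqP; split=> z /=; rewrite in_itv.
  by rewrite -[X in measurable X]setTI; exact: mocc.
have mS : measurable_fun [set: RW] S by apply: measurable_sum => i.
have minv : measurable_fun [set: RW] (fun z => (1 + occ z k) ^- 2).
  rewrite (_ : (fun z => _) = (fun z => ((1 + occ z k) `^ (-1)) ^+ 2)).
    apply: measurable_funX; apply: (measurableT_comp (@measurable_powR R (-1))).
    by apply: measurable_funD; [exact: measurable_cst|exact: mocc].
  by apply/funext => z; rewrite powR_inv1 ?addr_ge0// exprVn.
have mf_ N : measurable_fun (@space_time R d W) (f_ N).
  apply: measurable_funTS; apply: measurable_funM; first exact: (measurable_indic (mA N)).
  apply: measurable_funM; first exact: minv.
  apply: measurableT_comp => //; apply: measurable_funN.
  exact: measurable_funM.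
have e0 N : 0 < e N by rewrite invr_gt0.
have ig N n : (space_time_measure (P j)).-integrable (@space_time R d W) (fun z => (g N n z)%:E) /\
    \int[space_time_measure (P j)]_(z in @space_time R d W) g N n z <= B / 2 ^- n.
  have lam_ge i : e N <= lam N n i by rewrite lerDl mulr_ge0// invr_ge0 exprn_ge0.
  have [iD ->] := integral_discounted JP (fun=> 1) j (e0 N) lam_ge; split=> //.
  apply: BP => //; rewrite invr_gt0 exprn_gt0//= invf_le1 ?exprn_gt0//.
  by rewrite exprn_ege1// ler1n.
(* Term n is at most 4 e 4^-n B 2^n = 4 e B 2^-n, and the geometric series is below 2. *)
apply: (@integrable_fatou _ _ _ _ _ f_ _ (8 * expR 1 * B)) => //.
- by move=> N z _; rewrite /f_ !mulr_ge0// ?invr_ge0 ?expR_ge0// exprn_ge0// addr_ge0.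
- move=> z _; rewrite -[X in _ --> X]mul1r.
  apply: cvgM.
    have [m zm] : exists m : nat, occ z k <= m%:R.
      by exists (Num.truncn (occ z k)).+1; exact/ltW/truncnS_gt.
    apply: cvg_near_cst; exists m => // N /= mN.
    rewrite indicE mem_set// /A /= (le_trans zm)// (@le_trans _ _ (2 ^ N)%N%:R)//.
      by rewrite ler_nat (leq_trans mN)// ltnW// ltn_expl.
    by rewrite natrX.
  rewrite -[X in _ --> X]mulr1; apply: cvgM; first exact: cvg_cst.
  rewrite -[X in _ --> X]expR0; apply: continuous_cvg; first exact: continuous_expR.
  rewrite -oppr0 -(mul0r (S z)); apply: cvgN; apply: cvgM; last exact: cvg_cst.
  exact: cvg_harmonic.
- move=> N.
  have ic n : (space_time_measure (P j)).-integrable (@space_time R d W)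
      (fun z => (4 * expR 1 * 4 ^- n * g N n z)%:E).
    exact: (integrableZl mD (4 * expR 1 * 4 ^- n) (ig N n).1).
  have [iS ES] := Rintegral_sum (index_enum 'I_N.+1) mD (fun n => ic n).
  apply: (@le_trans _ _ (\int[space_time_measure (P j)]_(z in @space_time R d W)
      (\sum_(n < N.+1) 4 * expR 1 * 4 ^- n * g N n z)%:E)%E).
    apply: ge0_le_integral => //.
    - by move=> z _; rewrite lee_fin /f_ !mulr_ge0// ?invr_ge0 ?expR_ge0// exprn_ge0// addr_ge0.
    - by apply/measurable_EFinP; exact: mf_.
    - exact: measurable_int iS.
    - by move=> z _; rewrite lee_fin; exact: f_g.
  rewrite -[X in (X <= _)%E]fineK; last exact: (integrable_fin_num mD iS).
  rewrite lee_fin -/(Rintegral _ _ _) ES.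
  apply: (@le_trans _ _ (\sum_(n < N.+1) 4 * expR 1 * B * 2 ^- n)).
    apply: ler_sum => n _; rewrite (RintegralZl _ mD (ig N n).1).
    apply: (le_trans (ler_wpM2l _ (ig N n).2)).
      by rewrite !mulr_ge0 ?expR_ge0 ?invr_ge0 ?exprn_ge0.
    rewrite invrK le_eqVlt; apply/orP; left; apply/eqP.
    have -> : 4 ^+ n = 2 ^+ n * 2 ^+ n :> R by rewrite -exprMn -natrM.
    by field; rewrite expf_neq0.
  rewrite -mulr_sumr (_ : 8 * expR 1 * B = 4 * expR 1 * B * 2); last by ring.
  rewrite ler_wpM2l ?mulr_ge0 ?expR_ge0//.
  have -> : \sum_(n < N.+1) 2 ^- n = 2 - 2 ^- N :> R.
    elim: N {ic iS ES} => [|N IH]; first by rewrite big_ord_recl big_ord0 expr0 invr1 addr0; ring.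
    by rewrite big_ord_recr /= IH exprS; field; rewrite expf_neq0.
  by rewrite gerBl invr_ge0 exprn_ge0.
Qed.

End occupation_decay.

(** * The kernel K_i and its action on decaying functions *)

Section occupation_kernel.
Context {R : realType} {L : finType} (beta : L -> L -> R).
Context d {W : measurableType d} (P : L -> probability W R) (X : R -> W -> L).
Hypothesis JP : jump_process beta P X.
Hypothesis beta_sym : forall i j, beta i j = beta j i.
Hypothesis beta_ge0 : forall i j, 0 <= beta i j.
Hypothesis beta_connected : forall i j, connect (fun i j => 0 < beta i j) i j.
Implicit Types (h g : (L -> R) -> R) (l : L -> R).

Let RW : measurableType _ := (measurableTypeR R * W)%type.

Definition occupied (i : L) h l (z : RW) : R :=
  (X (Num.max z.1 0) z.2 == i)%:R * h (fun k => l k + occupation X (Num.max z.1 0) z.2 k).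

(** The [K_i h (j, l)] of the overview, written as one integral over space-time so that linearity,
    domination and limits are checked jointly in time and path; [walk_expect_kernel] returns to the
    iterated form. *)
Definition occupation_kernel (j i : L) h l : R :=
  \int[space_time_measure (P j)]_(z in @space_time R d W) occupied i h l z.

Let mD := @measurable_space_time R d W.

Lemma measurable_occupied i h l : borel h -> measurable_fun [set: RW] (occupied i h l).
Proof.
move=> mh; apply: measurable_funM.
  exact: (measurable_path JP (fun k => (k == i)%:R)).
apply: (@measurable_fun_borel R L _ RW
  (fun z k => l k + occupation X (Num.max z.1 0) z.2 k) h _ mh) => k.
by apply: measurable_funD; [exact: measurable_cst|exact: (measurable_space_time_occupation JP)].
Qed.

Lemma borel_occupation_kernel j i h : borel h -> borel (occupation_kernel j i h).
Proof.
move=> mh.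
suff mF : measurable_fun [set: (#|L|.-tuple R * RW)%type]
    (fun p => occupied i h (coords p.1) p.2).
  have := @measurable_Rintegral_param _ _ _ _ R (space_time_measure (P j)) _ _ mD mF.
  exact.
apply: measurable_funM.
  apply: (measurableT_comp (f := fun z : RW => (X (Num.max z.1 0) z.2 == i)%:R : R)); last first.
    exact: measurable_snd.
  exact: (measurable_path JP (fun k => (k == i)%:R)).
apply: (@measurable_fun_borel R L _ (#|L|.-tuple R * RW)%type (fun p k =>
  coords p.1 k + occupation X (Num.max p.2.1 0) p.2.2 k) h _ mh) => k.
apply: measurable_funD.
  apply: (measurableT_comp (f := fun t : #|L|.-tuple R => coords t k)); last exact: measurable_fst.
  exact: measurable_coord.
apply: (measurableT_comp (f := fun z : RW => occupation X (Num.max z.1 0) z.2 k)); last exact: measurable_snd.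
exact: (measurable_space_time_occupation JP).
Qed.

(** Both 1 + l_k and 1 + occupation_k are at most 1 + l_k + occupation_k. Of the N + 2 available
    powers, N are spent on decay in the initial local time and 2 on integrability over
    space-time. *)
Lemma occupied_le i h l k (N : nat) (C : R) z : (forall i, 0 <= l i) ->
  (forall m, (forall i, 0 <= m i) -> `|h m| * (1 + m k) ^+ (N + 2) <= C) ->
  `|occupied i h l z| <=
  C * (1 + l k) ^- N * (1 + occupation X (Num.max z.1 0) z.2 k) ^- 2.
Proof.
move=> l0 hC; set o := occupation X (Num.max z.1 0) z.2.
have o0 m : 0 <= o m by exact: occupation_ge0.
apply: (@le_trans _ _ `|h (fun k => l k + o k)|).
  rewrite normrM; case: (_ == _); rewrite ?normr1 ?normr0 ?mul1r ?mul0r//.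
rewrite ler_pdivlMr ?exprn_gt0 ?ltr_pwDl// ler_pdivlMr ?exprn_gt0 ?ltr_pwDl//.
apply: le_trans (hC (fun k => l k + o k) _); last by move=> m; rewrite addr_ge0.
rewrite -mulrA ler_wpM2l// mulrC exprD ler_pM ?exprn_ge0 ?addr_ge0//.
  by rewrite lerXn2r ?nnegrE ?addr_ge0// lerD2l lerDl.
by rewrite lerXn2r ?nnegrE ?addr_ge0// lerD2l lerDr.
Qed.

Let occ_decay k j := integrable_occupation_decay JP beta_sym beta_ge0 beta_connected k j.

Lemma integrable_occupied j i h l k : borel h -> orthant_decay k h ->
  (forall i, 0 <= l i) ->
  (space_time_measure (P j)).-integrable (@space_time R d W) (fun z => (occupied i h l z)%:E).
Proof.
move=> mh dh l0; have [C hC] := dh (0 + 2)%N.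
apply: (le_integrable mD _ _ (integrableZl mD C (occ_decay k j))).
  by apply/measurable_EFinP; apply: measurable_funTS; exact: measurable_occupied.
move=> z _; rewrite -EFinM !abse_EFin lee_fin.
apply: le_trans (occupied_le i z l0 hC) _.
by rewrite expr0 invr1 mulr1; exact: ler_norm.
Qed.

Lemma orthant_decay_kernel j i h k : borel h -> orthant_decay k h ->
  orthant_decay k (occupation_kernel j i h).
Proof.
move=> mh dh N; have [C hC] := dh (N + 2)%N.
pose q := \int[space_time_measure (P j)]_(z in @space_time R d W)
  (1 + occupation X (Num.max z.1 0) z.2 k) ^- 2.
exists (C * q) => l l0; have io := integrable_occupied j i mh dh l0.
have lN : 0 < (1 + l k) ^+ N by rewrite exprn_gt0// ltr_pwDl.
rewrite -ler_pdivlMr//; apply: le_trans (le_normr_Rintegral mD io) _.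
rewrite mulrAC -(RintegralZl _ mD (occ_decay k j)).
apply: le_Rintegral => //.
- exact: integrable_norm io.
- exact: (integrableZl mD (C * (1 + l k) ^- N) (occ_decay k j)).
- by move=> z _; exact: occupied_le.
Qed.

Lemma occupation_kernelD j i h g k k' l : borel h -> borel g ->
  orthant_decay k h -> orthant_decay k' g -> (forall i, 0 <= l i) ->
  occupation_kernel j i (h \+ g) l = occupation_kernel j i h l + occupation_kernel j i g l.
Proof.
move=> mh mg dh dg l0; rewrite /occupation_kernel -RintegralD//.
- by apply: eq_Rintegral => z _; rewrite /occupied mulrDr.
- exact: integrable_occupied dh l0.
- exact: integrable_occupied dg l0.
Qed.

Lemma occupation_kernelZ j i a h k l : borel h ->
  orthant_decay k h -> (forall i, 0 <= l i) ->
  occupation_kernel j i (fun m => a * h m) l = a * occupation_kernel j i h l.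
Proof.
move=> mh dh l0; rewrite /occupation_kernel -RintegralZl//.
  by apply: eq_Rintegral => z _; rewrite /occupied mulrCA.
exact: integrable_occupied dh l0.
Qed.

Lemma le_norm_occupation_kernel j i h g k l : borel h -> borel g ->
  orthant_decay k h -> orthant_decay k g -> (forall i, 0 <= l i) ->
  (forall m, (forall i, 0 <= m i) -> `|h m| <= g m) ->
  `|occupation_kernel j i h l| <= occupation_kernel j i g l.
Proof.
move=> mh mg dh dg l0 hg.
have io := integrable_occupied j i mh dh l0.
apply: le_trans (le_normr_Rintegral mD io) _; apply: le_Rintegral => //.
- exact: integrable_norm io.
- exact: integrable_occupied dg l0.
- move=> z _; rewrite normrM ger0_norm// ler_wpM2l// hg// => m.
  by rewrite addr_ge0// occupation_ge0.
Qed.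

Lemma cvg_occupation_kernel j i (h_ : nat -> (L -> R) -> R) h g k l :
  (forall n, borel (h_ n)) -> borel g -> orthant_decay k g -> (forall i, 0 <= l i) ->
  (forall n m, (forall i, 0 <= m i) -> `|h_ n m| <= g m) ->
  (forall m, (forall i, 0 <= m i) -> h_ n m @[n --> \oo] --> h m) ->
  occupation_kernel j i (h_ n) l @[n --> \oo] --> occupation_kernel j i h l.
Proof.
move=> mh mg dg l0 hg hh.
have lo0 (z : RW) m : 0 <= l m + occupation X (Num.max z.1 0) z.2 m.
  by rewrite addr_ge0// occupation_ge0.
apply: (@Rintegral_dominated_cvg _ _ _ _ _ (fun n z => occupied i (h_ n) l z)
  (occupied i h l) (occupied i g l) mD _ _ _ _).2.
- by move=> n; apply: measurable_funTS; exact: measurable_occupied.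
- by move=> z _; apply: cvgM; [exact: cvg_cst|exact: hh].
- exact: integrable_occupied dg l0.
- by move=> n z _; rewrite normrM ger0_norm// ler_wpM2l// hg.
Qed.

End occupation_kernel.

(** * From exponentials to Borel functions *)

Section bracket_convergence.
Context {R : realType} {L : finType} (beta : L -> L -> R) (n : nat).
Hypothesis beta_ge0 : forall i j, 0 <= beta i j.
Hypothesis beta_connected : forall i j, connect (fun i j => 0 < beta i j) i j.

Lemma le_orthant_decay (k : L) (h g : (L -> R) -> R) :
  (forall l, (forall i, 0 <= l i) -> `|h l| <= `|g l|) ->
  orthant_decay k g -> orthant_decay k h.
Proof.
move=> hg dg N; have [C gC] := dg N; exists C => l l0.
by apply: le_trans (gC l l0); rewrite ler_wpM2r ?hg// exprn_ge0// addr_ge0.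
Qed.

Lemma cvg_bracket (F : (L * 'I_n -> R) -> R) (h_ : nat -> (L -> R) -> R)
    (h g : (L -> R) -> R) (k : L) :
  borel F -> poly_bounded F -> (forall N, borel (h_ N)) -> borel g -> orthant_decay k g ->
  (forall N l, (forall i, 0 <= l i) -> `|h_ N l| <= g l) ->
  (forall l, (forall i, 0 <= l i) -> h_ N l @[N --> \oo] --> h l) ->
  bracket beta (fun u => F u * h_ N (half_sq u)) @[N --> \oo] -->
  bracket beta (fun u => F u * h (half_sq u)).
Proof.
move=> mF pF mh mg dg hg hh.
have ig := bracket_integrable_decay beta_ge0 beta_connected mF pF mg dg.
apply: (@Rintegral_dominated_cvg _ _ _ (@lebesgue_tuple R #|{: L * 'I_n}|) setT
  (fun N t => F (coords t) * h_ N (half_sq (coords t)) * expR (- energy beta (coords t)))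
  _ (fun t => `|F (coords t) * g (half_sq (coords t)) * expR (- energy beta (coords t))|)
  measurableT _ _ _ _).2.
- move=> N; exact: (borel_weighted beta mF (mh N)).
- move=> t _; apply: cvgM; last exact: cvg_cst.
  apply: cvgM; first exact: cvg_cst.
  by apply: hh => i; exact: half_sq_ge0.
- exact: (integrable_norm ig).
- move=> N t _; rewrite !normrM ler_wpM2r// ler_wpM2l//.
  have hsq i : 0 <= half_sq (coords t) i by exact: half_sq_ge0.
  by apply: le_trans (hg N _ hsq) _; exact: ler_norm.
Qed.

End bracket_convergence.

Section exponential_decay.
Context {R : realType} {L : finType}.
Implicit Types (lam l : L -> R).

Definition expL lam l : R := expR (- \sum_m lam m * l m).

Lemma expL_gt0 lam l : 0 < expL lam l. Proof. exact: expR_gt0. Qed.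

Lemma borel_expL lam : borel (expL lam).
Proof.
apply: measurableT_comp => //; apply: measurable_funN; apply: measurable_sum => m.
by apply: measurable_funM => //; exact: measurable_coord.
Qed.

Lemma expLD lam lam' l : expL (lam \+ lam') l = expL lam l * expL lam' l.
Proof.
rewrite /expL -expRD -opprD -big_split; congr (expR (- _)).
by apply: eq_bigr => m _ /=; rewrite mulrDl.
Qed.

Lemma expL_le1 lam l : (forall m, 0 <= lam m) -> (forall m, 0 <= l m) -> expL lam l <= 1.
Proof.
move=> lam0 l0; rewrite /expL -expR0 ler_expR oppr_le0.
by apply: sumr_ge0 => m _; rewrite mulr_ge0.
Qed.

Lemma orthant_decay_expL lam k : (forall m, 0 <= lam m) -> 1 <= lam k ->
  orthant_decay k (expL lam).
Proof.
move=> lam0 lamk N; exists (N.+1%:R ^+ N) => l l0.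
rewrite gtr0_norm ?expL_gt0//; apply: le_trans (ler_wpM2l (expR_ge0 _) (expR_ge_pow N (l0 k))) _.
rewrite mulrCA ler_piMr ?exprn_ge0// -expRD -[X in _ <= X]expR0 ler_expR addrC subr_le0.
rewrite (bigD1 k)//= -[X in X <= _]addr0 lerD//; first by rewrite ler_peMl.
by apply: sumr_ge0 => m _; rewrite mulr_ge0.
Qed.

Lemma pderivable_expL lam c k l : is_derive (l k) 1 (fun t => expL lam (dfwith l k t) * c)
  (- lam k * expL lam l * c).
Proof.
have dS (t : R) : is_derive t 1 (fun t => \sum_m lam m * dfwith l k t m) (lam k).
  have H : is_derive t 1 (fun t => \sum_m lam m * dfwith l k t m) (\sum_m lam m * (k == m)%:R).
    apply: is_derive_big_sum => m; apply: is_deriveZ; exact: is_derive_dfwith.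
  apply: is_derive_eq H _; rewrite (bigD1 k)//= eqxx mulr1 big1 ?addr0// => m.
  by rewrite eq_sym => /negbTE ->; rewrite mulr0.
have H := is_deriveZ c (is_derive1_comp (is_derive_expR _) (is_deriveN (dS (l k)))).
rewrite (_ : (fun t => _) = c \*: (expR \o - (fun t => \sum_m lam m * dfwith l k t m))); last first.
  by apply/funext => t; rewrite mulrC.
apply: is_derive_eq H _; rewrite /GRing.scale/= !fctE dfwith_id /expL; ring.
Qed.

End exponential_decay.

(** When the domain carries the sigma-algebra [S], every coordinate is measurable because half-lines
    generate the Borel sets of R; hence so is the identity into the tuples, which says that Borel
    sets belong to [S]. *)
Lemma measurable_tuple_ind (R : realType) (n : nat) (S : set (set (n.-tuple R))) :
  sigma_algebra setT S -> (forall i a, S [set t | tnth t i <= a]) ->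
  forall A : set (n.-tuple R), measurable A -> S A.
Proof.
move=> sS Shalf A mA.
pose T := g_sigma_algebraType S.
have SE : <<s S >> = S by exact: sigma_algebra_id.
have mid : measurable_fun [set: T] (id : T -> n.-tuple R).
  apply/measurable_fun_tnthP => i.
  apply: (measurability _ (RGenOInfty.measurableE R)).
  move=> _ [_ [a ->] <-]; rewrite setTI.
  rewrite (_ : _ @^-1` _ = ~` [set t : T | tnth t i <= a]).
    by apply: measurableC; apply: sub_sigma_algebra; exact: Shalf.
  by apply/seteqP; split => t /=; rewrite in_itv/= andbT ltNge => /negP.
have := mid measurableT A mA; rewrite setTI -[in X in _ -> X]SE; exact.
Qed.

Lemma bernoulli_ge (R : realType) (y : R) (M : nat) : 0 <= y <= 1 -> 1 - M%:R * y <= (1 - y) ^+ M.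
Proof.
move=> /andP[y0 y1]; elim: M => [|M IH]; first by rewrite mul0r subr0 expr0.
rewrite exprS; apply: (@le_trans _ _ ((1 - y) * (1 - M%:R * y))); last first.
  by rewrite ler_wpM2l// subr_ge0.
rewrite -subr_ge0 (_ : _ - _ = M%:R * y ^+ 2); first by rewrite mulr_ge0 ?sqr_ge0.
by rewrite -natr1; ring.
Qed.

(** Put y = exp(- n x) and let M be the exponent. If x <= a then M y >= n, so (1 - y)^M <= exp(- M
    y) <= 1 / (1 + n); the factor n in M is what settles the boundary case x = a. If x > a,
    Bernoulli bounds 1 - (1 - y)^M by M y, which still decays exponentially. *)
Lemma cvg_half_line_indicator (R : realType) (a x : R) : 0 <= a -> 0 <= x ->
  1 - (1 - expR (- (n%:R * x))) ^+ (Num.truncn (n%:R * expR (n%:R * a))).+1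
    @[n --> \oo] --> ((x <= a)%R%:R : R).
Proof.
move=> a0 x0; pose M (n : nat) := (Num.truncn (n%:R * expR (n%:R * a))).+1.
have y01 (n : nat) : 0 <= expR (- (n%:R * x)) <= 1.
  by rewrite expR_ge0 -[X in _ <= X]expR0 ler_expR oppr_le0 mulr_ge0.
have [xa|ax] := leP x a.
  rewrite -[X in _ --> X]subr0; apply: cvgB; first exact: cvg_cst.
  apply: (@squeeze_cvgr _ _ _ _ (fun=> 0) (fun n => n.+1%:R^-1)); last 2 first.
  - exact: cvg_cst.
  - exact: cvg_harmonic.
  apply: nearW => n; have /andP[y0 y1] := y01 n.
  rewrite exprn_ge0 ?subr_ge0//=.
  apply: (@le_trans _ _ (expR (- expR (- (n%:R * x))) ^+ M n)).
    by rewrite lerXn2r ?nnegrE ?subr_ge0 ?expR_ge0// expR_ge1Dx.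
  rewrite -expRM_natl mulrN [leLHS]expRN lef_pV2 ?posrE ?expR_gt0//.
  apply: (@le_trans _ _ (1 + (M n)%:R * expR (- (n%:R * x)))); last exact: expR_ge1Dx.
  rewrite -natr1 addrC lerD2l.
  apply: (@le_trans _ _ (n%:R * expR (n%:R * a) * expR (- (n%:R * x)))).
    rewrite -mulrA -expRD ler_peMr// -[X in X <= _]expR0 ler_expR -mulrBr.
    by rewrite mulr_ge0// subr_ge0.
  by rewrite ler_wpM2r ?expR_ge0// ltW// truncnS_gt.
pose dl := x - a; have dl0 : 0 < dl by rewrite subr_gt0.
(* For x > a one has M y <= (n + 1) exp(- n dl). The bound n + 1 <= (1 + 1 / dl) (1 + n dl) and
   [expR_ge_pow] at N = 2, with constant 3^2 = 9, then control (n + 1)^2 exp(- n dl). *)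
pose C := 9 * (1 + dl^-1) ^+ 2.
apply: (@squeeze_cvgr _ _ _ _ (fun=> 0) (fun n => C * n.+1%:R^-1)); last 2 first.
- exact: cvg_cst.
- rewrite -[X in _ --> X](mulr0 C); apply: cvgM; first exact: cvg_cst.
  exact: cvg_harmonic.
apply: nearW => n; have /andP[y0 y1] := y01 n.
rewrite subr_ge0 exprn_ile1 ?subr_ge0 ?gerBl//=.
apply: (@le_trans _ _ ((M n)%:R * expR (- (n%:R * x)))).
  by rewrite lerBlDl -lerBlDr bernoulli_ge// y01.
rewrite ler_pdivlMr//.
apply: (@le_trans _ _ (n.+1%:R ^+ 2 * expR (- (n%:R * dl)))).
  rewrite expr2 [leLHS]mulrC -mulrA ler_wpM2l//.
  apply: (@le_trans _ _ ((n%:R * expR (n%:R * a) + 1) * expR (- (n%:R * x)))).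
    rewrite ler_wpM2r ?expR_ge0// -natr1 lerD2r truncn_le mulr_ge0 ?expR_ge0//.
  rewrite mulrDl -mulrA -expRD mul1r -natr1 mulrDl mul1r lerD//.
    by rewrite /dl mulrBr opprB.
  by rewrite ler_expR lerN2 ler_wpM2l// lerBlDr lerDl.
apply: (@le_trans _ _ (((1 + dl^-1) ^+ 2 * (1 + n%:R * dl) ^+ 2) * expR (- (n%:R * dl)))).
  rewrite ler_wpM2r ?expR_ge0// -exprMn lerXn2r ?nnegrE ?mulr_ge0 ?addr_ge0 ?invr_ge0 ?mulr_ge0 ?(ltW dl0)//.
  rewrite -natr1 -subr_ge0 (_ : _ - _ = n%:R * dl + dl^-1).
    by rewrite addr_ge0 ?mulr_ge0 ?invr_ge0 ?(ltW dl0).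
  by field; rewrite gt_eqF.
have := @expR_ge_pow R 2 (n%:R * dl); rewrite mulr_ge0 ?(ltW dl0)// => /(_ isT) H.
apply: (@le_trans _ _ ((1 + dl^-1) ^+ 2 * (9 * expR (n%:R * dl)) * expR (- (n%:R * dl)))).
  rewrite ler_wpM2r ?expR_ge0// ler_wpM2l ?sqr_ge0//.
  by apply: (le_trans H); rewrite -natrX.
by rewrite -mulrA -(mulrA 9) -expRD subrr expR0 mulr1 /C mulrC.
Qed.

Import HBNNSimple.

(** * The integrated identity for one state i and one coordinate of decay k *)

Section occupation_identity.
Context {R : realType} {L : finType} (beta : L -> L -> R) (n : nat) (e : 'I_n).
Context d {W : measurableType d} (P : L -> probability W R) (X : R -> W -> L).
Hypothesis JP : jump_process beta P X.
Hypothesis beta_sym : forall i j, beta i j = beta j i.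
Hypothesis beta_ge0 : forall i j, 0 <= beta i j.
Hypothesis beta_connected : forall i j, connect (fun i j => 0 < beta i j) i j.
Variable rho : (L * 'I_n -> R) -> R.
Hypothesis drho : forall j u, pderivable (j, e) rho u.
Hypothesis mrho : borel rho.
Hypothesis mdrho : forall j, borel (pderiv (j, e) rho).
Hypothesis prho : poly_bounded rho.
Hypothesis pdrho : forall j, poly_bounded (pderiv (j, e) rho).
Variables i k : L.
Implicit Types (h g f : (L -> R) -> R) (l lam : L -> R).

Definition defect h : R :=
  bracket beta (fun u => rho u * u (i, e) * h (half_sq u)) -
  \sum_j bracket beta (fun u => pderiv (j, e) rho u * occupation_kernel P X j i h (half_sq u)).

Let prho_coord : poly_bounded (fun u => rho u * u (i, e)).
Proof. exact: poly_boundedM prho (poly_bounded_coord _). Qed.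

Let mrho_coord : borel (fun u => rho u * u (i, e)).
Proof. by apply: measurable_funM => //; exact: measurable_coord. Qed.

Let hsq (u : L * 'I_n -> R) j : 0 <= half_sq u j. Proof. exact: half_sq_ge0. Qed.

Let mK j h : borel h -> borel (occupation_kernel P X j i h).
Proof. exact: (borel_occupation_kernel JP). Qed.

Let dK j h : borel h -> orthant_decay k h -> orthant_decay k (occupation_kernel P X j i h).
Proof. exact: (orthant_decay_kernel JP). Qed.

Let int_coord h : borel h -> orthant_decay k h ->
  bracket_integrable beta (fun u => rho u * u (i, e) * h (half_sq u)).
Proof. exact: bracket_integrable_decay. Qed.

Let int_kernel j h : borel h -> orthant_decay k h -> bracket_integrable beta
  (fun u => pderiv (j, e) rho u * occupation_kernel P X j i h (half_sq u)).
Proof.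
by move=> mh dh; apply: (@bracket_integrable_decay _ _ _ _ _ _ _ _ k) => //; [exact: mK|exact: dK].
Qed.

Lemma cvg_defect (h_ : nat -> (L -> R) -> R) h g :
  (forall N, borel (h_ N)) -> borel g -> orthant_decay k g ->
  (forall N l, (forall i, 0 <= l i) -> `|h_ N l| <= g l) ->
  (forall l, (forall i, 0 <= l i) -> h_ N l @[N --> \oo] --> h l) ->
  defect (h_ N) @[N --> \oo] --> defect h.
Proof.
move=> mh mg dg hg hh.
have dh N : orthant_decay k (h_ N).
  apply: le_orthant_decay dg => l l0.
  by apply: le_trans (hg N l l0) _; exact: ler_norm.
apply: cvgB.
  exact: (@cvg_bracket _ _ _ _ beta_ge0 beta_connected _ _ _ _ _ mrho_coord prho_coord mh mg dg hg hh).
apply: cvg_sum_seq => j _.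
apply: (@cvg_bracket _ _ _ _ beta_ge0 beta_connected _
  (fun N => occupation_kernel P X j i (h_ N)) _ (occupation_kernel P X j i g) k) => //.
- by move=> N; exact: mK.
- exact: mK.
- exact: dK.
- move=> N l l0; exact: (@le_norm_occupation_kernel _ _ beta _ _ _ _ JP beta_sym beta_ge0
    beta_connected j i (h_ N) g k l (mh N) mg (dh N) dg l0 (hg N)).
- move=> l l0; exact: (@cvg_occupation_kernel _ _ beta _ _ _ _ JP beta_sym beta_ge0
    beta_connected _ _ _ _ _ _ _ mh mg dg l0 hg hh).
Qed.

Lemma defectD h g : borel h -> orthant_decay k h -> borel g -> orthant_decay k g ->
  defect (h \+ g) = defect h + defect g.
Proof.
move=> mh dh mg dg; rewrite /defect addrACA -opprD -big_split/=; congr (_ - _).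
  rewrite -bracketD; [|exact: int_coord|exact: int_coord].
  by congr (bracket _ _); apply/funext => u /=; rewrite mulrDr.
apply: eq_bigr => j _; rewrite -bracketD; [|exact: int_kernel|exact: int_kernel].
by congr (bracket _ _); apply/funext => u /=;
  rewrite (occupation_kernelD JP _ _ _ _ _ mh mg dh dg)// mulrDr.
Qed.

Lemma defectZ a h : borel h -> orthant_decay k h ->
  defect (fun l => a * h l) = a * defect h.
Proof.
move=> mh dh; rewrite /defect mulrBr mulr_sumr; congr (_ - _).
  rewrite -bracketZ; last exact: int_coord.
  by congr (bracket _ _); apply/funext => u /=; rewrite mulrCA.
apply: eq_bigr => j _; rewrite -bracketZ; last exact: int_kernel.
by congr (bracket _ _); apply/funext => u /=;
  rewrite (occupation_kernelZ JP _ _ _ _ _ _ mh dh)// mulrCA.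
Qed.

Lemma occupation_kernel_expL lam j l : (forall m, 1 <= lam m) ->
  occupation_kernel P X j i (expL lam) l =
  expL lam l * resolvent P X lam (fun m => (m == i)%:R) j.
Proof.
move=> lam1.
have [iD <-] := integral_discounted JP (fun m => (m == i)%:R) j ltr01 lam1.
rewrite -RintegralZl//; last exact: measurable_space_time.
apply: eq_Rintegral => z _; rewrite /occupied /discounted [RHS]mulrA mulrC; congr (_ * _).
rewrite -[RHS]expRD -opprD -big_split/=; congr (expR (- _)).
by apply: eq_bigr => m _; rewrite mulrDr.
Qed.

(** Rates bounded below by 1 provide a common killing rate for the resolvent and decay in every
    coordinate. They are enough, because every exponential met later carries a factor
    [expL (fun=> 1)]. *)
Lemma defect_expL lam : (forall m, 1 <= lam m) -> defect (expL lam) = 0.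
Proof.
move=> lam1; pose V := resolvent P X lam (fun m => (m == i)%:R).
have lam0 m : 0 <= lam m by apply: le_trans (lam1 m).
pose f (j : L) l := expL lam l * V j.
have df j l : is_derive (l j) 1 (fun t => f j (dfwith l j t)) (- lam j * f j l).
  by rewrite mulrA; exact: pderivable_expL.
have pf j : pderiv j (f j) = fun l => - lam j * f j l.
  by apply/funext => l; rewrite /pderiv derive1E; exact: derive_val.
have mf j : borel (f j) by apply: measurable_funM => //; exact: borel_expL.
have kf j : orthant_decay j (f j).
  move=> N; have [C dC] := orthant_decay_expL lam0 (lam1 j) N.
  exists (C * `|V j|) => l l0; rewrite normrM mulrAC ler_wpM2r//; exact: dC.
have genE j l : generator beta f j l = - (j == i)%:R * expL lam l.
  have RE := resolvent_eq JP (fun m => (m == i)%:R) ler01 lam1 ltr01 j.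
  rewrite /generator pf (eq_bigr (fun m => expL lam l * (beta j m * (V m - V j)))).
    by rewrite -mulr_sumr -RE /f /V; ring.
  by move=> m _; rewrite /f; ring.
have := @sum_bracket_ward _ _ _ _ beta_sym beta_ge0 beta_connected e f rho
  _ mf _ _ _ drho mrho mdrho prho pdrho.
rewrite /defect => W0; apply/eqP; rewrite subr_eq0; apply/eqP.
transitivity (\sum_j bracket beta (fun u => pderiv (j, e) rho u * f j (half_sq u))); last first.
  apply: eq_bigr => j _; congr (bracket _ _); apply/funext => u.
  by rewrite occupation_kernel_expL.
rewrite -W0.
- rewrite -sumrN (bigD1 i)//= [X in _ + X]big1 ?addr0.
    rewrite -mulN1r -bracketZ; last first.
      rewrite (_ : (fun u => _) = fun u => - 1 * (rho u * u (i, e) * expL lam (half_sq u))).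
        apply: bracket_integrableZ; apply: int_coord; first exact: borel_expL.
        exact: orthant_decay_expL.
      by apply/funext => u; rewrite genE eqxx /= mulr1n; ring.
    by congr (bracket _ _); apply/funext => u; rewrite genE eqxx /= mulr1n; ring.
  move=> j /negbTE ji; apply/eqP; rewrite oppr_eq0; apply/eqP.
  rewrite /bracket [LHS](_ : _ = \int[@lebesgue_tuple R #|{: L * 'I_n}|]_t 0).
    by rewrite Rintegral_cst ?mul0r.
  by apply: eq_Rintegral => t _; rewrite genE ji oppr0 !(mul0r, mulr0).
- by move=> j l; have := df j l => -[].
- by move=> j; rewrite pf; apply: measurable_funM => //; exact: mf.
- by move=> j; exists j.
- move=> j; exists j; rewrite pf => N; have [C dC] := kf j N.
  exists (`|lam j| * C) => l l0; rewrite normrM normrN -mulrA ler_wpM2l//; exact: dC.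
Qed.

(* Quantifying over [lam] makes the class stable under multiplication by
   exponentials. *)
Definition annihilated f := [/\ borel f, orthant_decay k f &
  forall lam, (forall m, 0 <= lam m) -> defect (fun l => expL lam l * f l) = 0].

Let mE lam f : borel f -> borel (fun l => expL lam l * f l).
Proof. by move=> mf; apply: measurable_funM => //; exact: borel_expL. Qed.

Let dE lam f : (forall m, 0 <= lam m) -> orthant_decay k f ->
  orthant_decay k (fun l => expL lam l * f l).
Proof.
move=> lam0; apply: le_orthant_decay => l l0.
by rewrite normrM (gtr0_norm (expL_gt0 _ _)) ler_piMl// expL_le1.
Qed.

Lemma annihilatedD f g : annihilated f -> annihilated g -> annihilated (f \+ g).
Proof.
move=> [mf df f0] [mg dg g0]; split.
- exact: measurable_funD.
- move=> N; have [C1 H1] := df N; have [C2 H2] := dg N; exists (C1 + C2) => l l0.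
  apply: le_trans (lerD (H1 l l0) (H2 l l0)); rewrite -mulrDl ler_wpM2r ?ler_normD//.
  by rewrite exprn_ge0// addr_ge0.
- move=> lam lam0; rewrite (_ : (fun l => _) =
    (fun l => expL lam l * f l) \+ (fun l => expL lam l * g l)).
    by rewrite defectD ?f0 ?g0 ?addr0//; [exact: mE|exact: dE|exact: mE|exact: dE].
  by apply/funext => l /=; rewrite mulrDr.
Qed.

Lemma annihilatedZ a f : annihilated f -> annihilated (fun l => a * f l).
Proof.
move=> [mf df f0]; split.
- by apply: measurable_funM.
- move=> N; have [C H] := df N; exists (`|a| * C) => l l0.
  by rewrite normrM -mulrA ler_wpM2l// H.
- move=> lam lam0; rewrite (_ : (fun l => _) = (fun l => a * (expL lam l * f l))).
    by rewrite defectZ ?f0 ?mulr0//; [exact: mE|exact: dE].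
  by apply/funext => l /=; rewrite mulrCA.
Qed.

Lemma annihilatedB f g : annihilated f -> annihilated g -> annihilated (f \- g).
Proof.
move=> af ag; rewrite (_ : f \- g = f \+ (fun l => - 1 * g l)).
  exact: (annihilatedD af (annihilatedZ (- 1) ag)).
by apply/funext => l /=; rewrite mulN1r.
Qed.

Lemma annihilated_sum (J : Type) (s : seq J) (a : J -> R) (f : J -> (L -> R) -> R) g :
  annihilated g -> (forall j, annihilated (f j)) ->
  annihilated (fun l => \sum_(j <- s) a j * f j l).
Proof.
move=> ag af; elim: s => [|j s IH].
  rewrite (_ : (fun l => _) = fun l => 0 * g l); first exact: annihilatedZ.
  by apply/funext => l; rewrite big_nil mul0r.
rewrite (_ : (fun l => _) = (fun l => a j * f j l) \+ (fun l => \sum_(j <- s) a j * f j l)).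
  exact: (annihilatedD (annihilatedZ (a j) (af j)) IH).
by apply/funext => l; rewrite big_cons.
Qed.

Lemma annihilated_expL kap f : (forall m, 0 <= kap m) -> annihilated f ->
  annihilated (fun l => expL kap l * f l).
Proof.
move=> kap0 [mf df f0]; split; [exact: mE|exact: dE|move=> lam lam0].
rewrite (_ : (fun l => _) = (fun l => expL (lam \+ kap) l * f l)).
  by apply: f0 => m; rewrite addr_ge0.
by apply/funext => l; rewrite expLD mulrA.
Qed.

Lemma annihilated_cvg (h_ : nat -> (L -> R) -> R) h g :
  (forall N, annihilated (h_ N)) -> borel h -> borel g -> orthant_decay k g ->
  (forall N l, (forall i, 0 <= l i) -> `|h_ N l| <= g l) ->
  (forall l, (forall i, 0 <= l i) -> h_ N l @[N --> \oo] --> h l) ->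
  annihilated h.
Proof.
move=> ah mh mg dg hg hh; split => //.
  apply: le_orthant_decay dg => l l0; apply: le_trans _ (ler_norm _).
  by apply: (cvgr_to_le (cvg_norm (hh l l0))); apply: nearW => N; exact: hg.
move=> lam lam0.
have mh_ N : borel (h_ N) by have [] := ah N.
apply: (@cvg_unique _ _ (defect (fun l => expL lam l * h_ N l) @[N --> \oo])).
- exact: norm_hausdorff.
- apply: (@cvg_defect _ _ g) => //.
  + by move=> N; exact: mE.
  + move=> N l l0; rewrite normrM (gtr0_norm (expL_gt0 _ _)).
    by apply: le_trans (hg N l l0); rewrite ler_piMl// expL_le1.
  + by move=> l l0; apply: cvgM; [exact: cvg_cst|exact: hh].
- rewrite (_ : (fun N => _) = fun=> 0); first exact: cvg_cst.
  by apply/funext => N; have [_ _ ->] := ah N.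
Qed.

(** With y = exp(- N l_m), stability under products with exponentials and under differences keeps (1
    - y)^M f in the class, and f - (1 - y)^M f converges to the truncated function, dominated by
    |f|. *)
Lemma annihilated_half_line m a f : annihilated f ->
  annihilated (fun l => (l m <= a)%R%:R * f l).
Proof.
move=> af; have [mf df _] := af.
have mind : borel (fun l => (l m <= a)%R%:R * f l).
  apply: measurable_funM => //.
  apply: (measurableT_comp (f := fun x : R => (x <= a)%R%:R : R)); last exact: measurable_coord.
  rewrite (_ : (fun x : R => _) = \1_`]-oo, a]); first exact: measurable_indic.
  by apply/funext => x; rewrite indicE mem_setE in_itv.
have mnf : borel (fun l => `|f l|) by apply: measurableT_comp.
have dnf : orthant_decay k (fun l => `|f l|).
  by apply: le_orthant_decay df => l _; rewrite normr_id.
(* For a < 0 the indicator vanishes on the orthant, where all limits are tested, so the zero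
   sequence serves as approximation. *)
have [a0|a0] := leP 0 a; last first.
  apply: (@annihilated_cvg (fun=> fun l => 0 * f l) _ (fun l => `|f l|)
    (fun=> annihilatedZ 0 af) mind mnf dnf).
  - by move=> _ l _; rewrite mul0r normr0.
  - move=> l l0; rewrite leNgt (lt_le_trans a0)//; exact: cvg_cst.
pose y (N : nat) l : R := expR (- (N%:R * l m)).
have yE N l : y N l = expL (fun q => N%:R * (q == m)%:R) l.
  rewrite /y /expL (bigD1 m)//= eqxx mulr1 big1 ?addr0// => q /negbTE ->.
  by rewrite mulr0 mul0r.
have ypow N M : annihilated (fun l => (1 - y N l) ^+ M * f l).
  elim: M => [|M IH].
    by rewrite (_ : (fun l => _) = f)//; apply/funext => l; rewrite expr0 mul1r.
  rewrite (_ : (fun l => _) = (fun l => (1 - y N l) ^+ M * f l) \-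
      (fun l => y N l * ((1 - y N l) ^+ M * f l))).
    apply: (annihilatedB IH).
    rewrite [X in annihilated (fun l => X l * _)](_ : _ = expL (fun q => N%:R * (q == m)%:R)).
      by apply: annihilated_expL => // q; rewrite mulr_ge0.
    by apply/funext => l; rewrite yE.
  by apply/funext => l /=; rewrite exprS; ring.
pose M (N : nat) := (Num.truncn (N%:R * expR (N%:R * a))).+1.
apply: (@annihilated_cvg (fun N => f \- (fun l => (1 - y N l) ^+ M N * f l)) _
  (fun l => `|f l|) (fun N => annihilatedB af (ypow N (M N))) mind mnf dnf).
- move=> N l l0 /=; rewrite -[X in X - _]mul1r -mulrBl normrM ler_piMl//.
  have y0 : 0 <= y N l by exact: expR_ge0.
  have y1 : y N l <= 1 by rewrite /y -expR0 ler_expR oppr_le0 mulr_ge0.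
  have p0 : 0 <= (1 - y N l) ^+ M N by rewrite exprn_ge0// subr_ge0.
  have p1 : (1 - y N l) ^+ M N <= 1 by rewrite exprn_ile1// ?subr_ge0// gerBl.
  by rewrite ger0_norm ?subr_ge0// gerBl.
- move=> l l0; rewrite (_ : (fun N => _) = fun N => (1 - (1 - y N l) ^+ M N) * f l).
    by apply: cvgM; [exact: cvg_half_line_indicator|exact: cvg_cst].
  by apply/funext => N /=; rewrite mulrBl mul1r.
Qed.

Let tup l : #|L|.-tuple R := [tuple l (enum_val q) | q < #|L|].

Let tup_coords (t : #|L|.-tuple R) : tup (coords t) = t.
Proof. by apply: eq_from_tnth => q; rewrite tnth_mktuple /coords enum_valK. Qed.

Let coords_tup l : coords (tup l) = l.
Proof. by apply/funext => q; rewrite /coords tnth_mktuple enum_rankK. Qed.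

Let borel_tup (G : #|L|.-tuple R -> R) : measurable_fun setT G -> borel (fun l => G (tup l)).
Proof.
move=> mG; rewrite /borel (_ : _ \o _ = G)//.
by apply/funext => t /=; rewrite tup_coords.
Qed.

(** The sets whose indicator multiplies the whole class into itself form a sigma-algebra. Because
    [S] quantifies over every [f], multiplications can be iterated: finite intersections come for
    free, and a countable union is reached through the products of the 1 - 1_{F_j}. *)
Lemma annihilated_indic (A : set (#|L|.-tuple R)) f : measurable A -> annihilated f ->
  annihilated (fun l => \1_A (tup l) * f l).
Proof.
move=> mA; move: f.
pose S (A : set (#|L|.-tuple R)) := measurable A /\
  forall f, annihilated f -> annihilated (fun l => \1_A (tup l) * f l).
suff: S A by case.
move: A mA; apply: (@measurable_tuple_ind R #|L| S); last first.
  move=> q a; split.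
    rewrite -[X in measurable X]setTI.
    have := @measurable_tnth _ R #|L| q measurableT `]-oo, a]%classic (measurable_itv _).
    by congr (measurable (_ `&` _)); apply/seteqP; split => t /=; rewrite in_itv.
  move=> f af; have := annihilated_half_line (enum_val q) a af.
  congr annihilated; apply/funext => l.
  rewrite indicE; congr ((nat_of_bool _)%:R * _).
  by apply/idP/idP; rewrite ?inE /= tnth_mktuple.
split.
- split; first exact: measurable0.
  move=> f af; rewrite indic0; have := annihilatedZ 0 af; congr annihilated; exact/funext.
- move=> A [mA SA]; split; first by rewrite setTD; exact: measurableC.
  move=> f af; have := annihilatedB af (SA f af).
  congr annihilated; apply/funext => l /=.
  rewrite setTD !indicE in_setC; case: (_ \in _); rewrite ?mul1r ?mul0r ?subr0 ?subrr//.
move=> F SF; have mF : measurable (\bigcup_j F j).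
  by apply: bigcup_measurable => j _; have [] := SF j.
split; first exact: mF.
move=> f af; have [mf df _] := af.
pose p N l : R := \prod_(j < N) (1 - \1_(F j) (tup l)).
have p01 N l : 0 <= p N l <= 1.
  rewrite /p; apply/andP; split.
    by apply: prodr_ge0 => j _; rewrite subr_ge0 indicE lern1 leq_b1.
  by apply: prodr_ile1 => j _; rewrite subr_ge0 gerBl indicE lern1 leq_b1 ler0n.
suff ac : annihilated (fun l => (1 - \1_(\bigcup_j F j) (tup l)) * f l).
  have := annihilatedB af ac; congr annihilated; apply/funext => l /=; ring.
apply: (@annihilated_cvg (fun N l => p N l * f l) _ (fun l => `|f l|)).
- elim=> [|N IH].
    by move: af; congr annihilated; apply/funext => l; rewrite /p big_ord0 mul1r.
  have := annihilatedB IH ((SF N).2 _ IH).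
  congr annihilated; apply/funext => l /=; rewrite [in RHS]/p big_ord_recr/= -/(p N l); ring.
- apply: measurable_funM => //; apply: measurable_funB => //.
  by apply: borel_tup; exact: measurable_indic.
- exact: measurableT_comp.
- by apply: le_orthant_decay df => l _; rewrite normr_id.
- by move=> N l _; have /andP[p0 p1] := p01 N l; rewrite normrM ger0_norm// ler_piMl.
- move=> l _; apply: cvgM; last exact: cvg_cst.
  apply: cvg_near_cst.
  have [[j _ Fj]|nF] := pselect ((\bigcup_j F j) (tup l)).
    near=> N; have jN : (j < N)%N by near: N; exact: nbhs_infty_gt.
    rewrite indicE mem_set; last by exists j.
    by rewrite /p (bigD1 (Ordinal jN))//= indicE mem_set// subrr mul0r.
  apply: nearW => N; rewrite indicE memNset// subr0 /p big1// => j _.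
  by rewrite indicE memNset ?subr0// => Fj; apply: nF; exists (val j).
Unshelve. all: by end_near.
Qed.

(** A simple function need not decay, so the approximation is made on the quotient of [h] by f0 =
    exp(- sum l): increasing simple functions times [f0] lie in the class and are dominated by [h]
    itself once [h] is nonnegative. *)
Lemma annihilated_decay h : borel h -> orthant_decay k h -> annihilated h.
Proof.
pose f0 := expL (fun=> 1 : R) : (L -> R) -> R.
have f0_gt0 l : 0 < f0 l by exact: expL_gt0.
have mf0 : borel f0 by exact: borel_expL.
have af0 : annihilated f0.
  split => //; first exact: orthant_decay_expL.
  move=> lam lam0; rewrite (_ : (fun l => _) = expL (lam \+ fun=> 1)).
    by apply: defect_expL => m; rewrite lerDr.
  by apply/funext => l; rewrite expLD.
wlog h0 : h / forall l, 0 <= h l => [wh mh dh|mh dh].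
  have mmax (g : (L -> R) -> R) : borel g -> borel (fun l => Num.max (g l) 0).
    by move=> mg; apply: measurable_maxr.
  have aP : annihilated (fun l => Num.max (h l) 0).
    apply: wh; [by move=> l; rewrite le_max lexx orbT|exact: mmax|].
    apply: le_orthant_decay dh => l _; rewrite ger0_norm ?le_max ?lexx ?orbT//.
    by rewrite ge_max ler_norm normr_ge0.
  have aN : annihilated (fun l => Num.max (- h l) 0).
    apply: wh; [by move=> l; rewrite le_max lexx orbT|by apply: mmax; exact: measurable_funN|].
    apply: le_orthant_decay dh => l _; rewrite ger0_norm ?le_max ?lexx ?orbT//.
    by rewrite ge_max -normrN ler_norm normr_ge0.
  have := annihilatedB aP aN; congr annihilated; apply/funext => l /=.
  have [hl|/ltW hl] := leP (h l) 0; last by rewrite max_r ?oppr_le0// subr0.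
  by rewrite max_l ?oppr_ge0// sub0r opprK.
pose q (t : #|L|.-tuple R) : R := h (coords t) / f0 (coords t).
have mq : measurable_fun [set: #|L|.-tuple R] (EFin \o q).
  apply/measurable_EFinP; rewrite (_ : q = (h \o coords) \* (expL (fun=> - 1) \o coords)).
    by apply: measurable_funM => //; exact: borel_expL.
  apply/funext => t /=; rewrite /q /f0 /expL -expRN -sumrN; congr (_ * expR (- _)).
  by apply: eq_bigr => m _; rewrite mul1r mulN1r.
have q0 t : [set: #|L|.-tuple R] t -> (0%:E <= (EFin \o q) t)%E.
  by move=> _; rewrite lee_fin divr_ge0// ltW.
pose s N := nnsfun_approx measurableT mq N.
have sq l : s N (tup l) @[N --> \oo] --> h l / f0 l.
  have := cvg_nnsfun_approx measurableT mq q0 (x := tup l) Logic.I.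
  by rewrite /= /q coords_tup => /fine_cvgP[].
have sle N l : s N (tup l) <= h l / f0 l.
  have nd : nondecreasing_seq (fun N => s N (tup l)).
    by move=> N1 N2 /(nd_nnsfun_approx measurableT mq)/lefP; exact.
  rewrite -(cvg_lim _ (sq l))//; apply: (nondecreasing_cvgn_le nd).
  by apply/cvg_ex; exists (h l / f0 l).
apply: (@annihilated_cvg (fun N l => s N (tup l) * f0 l) h h _ mh mh dh).
- move=> N; have ms (y : R) : measurable (s N @^-1` [set y]) by exact: measurable_funPTI.
  have := @annihilated_sum R (finmap.enum_fset (fset_set (range (s N)))) id _ _ af0
    (fun y => annihilated_indic (ms y) af0).
  congr annihilated; apply/funext => l.
  rewrite fimfunE fsbig_finite//= mulr_suml; apply: eq_bigr => y _.
  by rewrite mulrA.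
- move=> N l l0; rewrite ger0_norm ?mulr_ge0 ?(ltW (f0_gt0 _))//.
  by rewrite -ler_pdivlMr.
- move=> l l0; rewrite -[X in _ --> X](divfK (lt0r_neq0 (f0_gt0 l))).
  by apply: cvgM; [exact: sq|exact: cvg_cst].
Qed.

Lemma sum_bracket_kernel h : borel h -> orthant_decay k h ->
  bracket beta (fun u => rho u * u (i, e) * h (half_sq u)) =
  \sum_j bracket beta (fun u => pderiv (j, e) rho u * occupation_kernel P X j i h (half_sq u)).
Proof.
(* Taking lam = 0 in the definition of the class removes the auxiliary exponential. *)
move=> mh dh; have [_ _ /(_ (fun=> 0) (fun=> lexx 0))] := annihilated_decay mh dh.
rewrite (_ : (fun l => _) = h); first by move/eqP; rewrite subr_eq0 => /eqP.
apply/funext => l; rewrite /expL big1 ?oppr0 ?expR0 ?mul1r// => m _; exact: mul0r.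
Qed.

End occupation_identity.

(** * From the kernels back to expectations of the walk *)

Section walk.
Context {R : realType} {L : finType} (beta : L -> L -> R).
Context d {W : measurableType d} (P : L -> probability W R) (X : R -> W -> L).
Hypothesis JP : jump_process beta P X.
Hypothesis beta_sym : forall i j, beta i j = beta j i.
Hypothesis beta_ge0 : forall i j, 0 <= beta i j.
Hypothesis beta_connected : forall i j, connect (fun i j => 0 < beta i j) i j.
Variable f : L -> (L -> R) -> R.
Hypothesis mf : forall i, borel (f i).
Hypothesis kf : forall i, exists k, orthant_decay k (f i).

Let RW : measurableType _ := (measurableTypeR R * W)%type.

Lemma walk_expectE j l t : walk_expect P X j l f t =
  \int[P j]_w f (X t w) (local_time X l t w).
Proof. by rewrite /walk_expect unlock. Qed.

(** At each space-time point exactly one term of the sum over i is active, the one with i = X_t.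
    Each term is integrable through the coordinate in which its own [f i] decays, so the coordinates
    need not agree. *)
Lemma walk_expect_kernel j l : (forall i, 0 <= l i) ->
  walk_integrable P X j l f /\
  \int[lebesgue_measure]_(t in `[0, +oo[) walk_expect P X j l f t =
  \sum_i occupation_kernel P X j i (f i) l.
Proof.
move=> l0; pose F (z : RW) : R := \sum_(i : L) occupied X i (f i) l z.
have mF : measurable_fun [set: RW] F.
  by apply: measurable_sum => i; exact: (measurable_occupied JP).
have io i : (space_time_measure (P j)).-integrable (@space_time R d W)
    (fun z => (occupied X i (f i) l z)%:E).
  by have [k dk] := kf i; exact: (integrable_occupied JP beta_sym beta_ge0 beta_connected j i (mf i) dk l0).
have [iF EF] := Rintegral_sum (enum L) (@measurable_space_time R d W) io.
have FE t w : 0 <= t -> F (t, w) = f (X t w) (local_time X l t w).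
  move=> t0; rewrite /F (bigD1 (X t w))//= /occupied/= max_l// eqxx mul1r.
  by rewrite big1 ?addr0// => i /negbTE iX; rewrite eq_sym iX mul0r.
(* Decay of order 0 is boundedness on the orthant; it gives integrability over paths at every fixed
   time, as both [walk_integrable] and Fubini require. *)
have /choice[C hC] : forall i, exists C : R, forall m, (forall i, 0 <= m i) -> `|f i m| <= C.
  move=> i; have [k dk] := kf i; have [C hC] := dk 0%N; exists C => m m0.
  by have := hC m m0; rewrite expr0 mulr1.
have iFt t : 0 <= t -> (P j).-integrable setT (fun w => (F (t, w))%:E).
  move=> t0; apply: (le_integrable measurableT _ _
    (finite_measure_integrable_cst (P j) (\sum_i `|C i|) measurableT)).
    by apply/measurable_EFinP; exact: measurable_fun_pair2 t mF.
  move=> w _; rewrite /= lee_fin [leRHS]ger0_norm ?sumr_ge0// FE//.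
  apply: le_trans (hC _ _ _) _; first by move=> i; rewrite addr_ge0// occupation_ge0.
  by rewrite (bigD1 (X t w))//= ler_wpDr ?sumr_ge0// ler_norm.
have iF' : (space_time_measure (P j)).-integrable (@space_time R d W) (fun z => (F z)%:E).
  by move: iF; congr (integrable _ _ _); apply/funext => z; rewrite /F big_enum.
have [it Et] := Rintegral_space_time mF iF' iFt.
have wE t : 0 <= t -> \int[P j]_w F (t, w) = walk_expect P X j l f t.
  by move=> t0; rewrite walk_expectE; apply: eq_Rintegral => w _; rewrite FE.
split; last first.
  rewrite -[RHS](big_enum _ _ _ (fun i => occupation_kernel P X j i (f i) l)) -EF.
  transitivity (\int[space_time_measure (P j)]_(z in @space_time R d W) F z); last first.
    by apply: eq_Rintegral => z _; rewrite /F big_enum.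
  rewrite -Et; apply: eq_Rintegral => t; rewrite inE => /in_half_line t0.
  by rewrite wE.
split.
  move=> t t0; have := iFt t t0; congr (integrable _ _ _); apply/funext => w.
  by rewrite FE.
apply: eq_integrable it; first exact: measurable_half_line.
by move=> t; rewrite inE => /in_half_line t0; rewrite wE.
Qed.

End walk.

Lemma integrated_ward_identity (R : realType) (L : finType) (beta : L -> L -> R)
    (beta_sym : forall i j, beta i j = beta j i)
    (beta_ge0 : forall i j, 0 <= beta i j)
    (beta_connected : forall i j, connect (fun i j => 0 < beta i j) i j)
    (n : nat) (e : 'I_n) (d : measure_display) (W : measurableType d)
    (P : L -> probability W R) (X : R -> W -> L) (JP : jump_process beta P X)
    (f : L -> (L -> R) -> R) (rho : (L * 'I_n -> R) -> R) :
  (forall i, borel (f i)) -> rapid_decay f -> smooth rho -> moderate_growth rho ->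
  [/\ forall j, bracket_integrable beta
        (fun u => rho u * u (j, e) * f j (half_sq u)),
      forall j (u : L * 'I_n -> R), walk_integrable P X j (half_sq u) f,
      forall j, bracket_integrable beta
        (fun u => pderiv (j, e) rho u *
           \int[lebesgue_measure]_(t in `[0, +oo[)
             walk_expect P X j (half_sq u) f t) &
      \sum_j bracket beta (fun u => rho u * u (j, e) * f j (half_sq u)) =
      \sum_j bracket beta
        (fun u => pderiv (j, e) rho u *
           \int[lebesgue_measure]_(t in `[0, +oo[)
             walk_expect P X j (half_sq u) f t)].
Proof.
move=> mf rf srho mrho.
have kf i : exists k, orthant_decay k (f i).
  by have [k [dk _]] := rf i; exists k; exact: decays_in_orthant.
have drho j u : pderivable (j, e) rho u by exact: smooth_pderivable.
have mrho0 : borel rho by exact: (smooth_borel_pderivs [::] srho).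
have mdrho j : borel (pderiv (j, e) rho) by exact: (smooth_borel_pderivs [:: (j, e)] srho).
have prho : poly_bounded rho by exact: (moderate_growth_poly_bounded [::] mrho).
have pdrho j : poly_bounded (pderiv (j, e) rho).
  exact: (moderate_growth_poly_bounded [:: (j, e)] mrho).
have walk j (u : L * 'I_n -> R) := walk_expect_kernel JP beta_sym beta_ge0 beta_connected mf kf j
  (fun i => half_sq_ge0 u i).
have KE j : (fun u : L * 'I_n -> R => pderiv (j, e) rho u *
      \int[lebesgue_measure]_(t in `[0, +oo[) walk_expect P X j (half_sq u) f t) =
    (fun u => \sum_i pderiv (j, e) rho u * occupation_kernel P X j i (f i) (half_sq u)).
  by apply/funext => u; rewrite (walk j u).2 mulr_sumr.
have iK j i : bracket_integrable beta
    (fun u => pderiv (j, e) rho u * occupation_kernel P X j i (f i) (half_sq u)).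
  have [k dk] := kf i; apply: (bracket_integrable_decay beta_ge0 beta_connected (k := k)) => //.
    exact: (borel_occupation_kernel JP).
  exact: (orthant_decay_kernel JP).
split.
- move=> j; have [k dk] := kf j.
  apply: (bracket_integrable_decay beta_ge0 beta_connected (k := k)) => //.
    by apply: measurable_funM => //; exact: measurable_coord.
  exact: poly_boundedM prho (poly_bounded_coord _).
- by move=> j u; exact: (walk j u).1.
- by move=> j; rewrite KE; exact: (bracket_integrable_sum _ (iK j)).1.
- rewrite [RHS](eq_bigr (fun j => \sum_i bracket beta
      (fun u => pderiv (j, e) rho u * occupation_kernel P X j i (f i) (half_sq u)))).
    rewrite exchange_big; apply: eq_bigr => i _ /=; have [k dk] := kf i.
    exact: (sum_bracket_kernel JP beta_sym beta_ge0 beta_connected drho mrho0 mdrho prho pdrho i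
      (mf i) dk).
  by move=> j _; rewrite KE; exact: (bracket_integrable_sum _ (iK j)).2.
Qed.

Theorem lemma2p1 (R : realType) (L : finType) (beta : L -> L -> R)
    (beta_sym : forall i j, beta i j = beta j i)
    (beta_ge0 : forall i j, 0 <= beta i j)
    (beta_connected : forall i j, connect (fun i j => 0 < beta i j) i j)
    (n : nat) (n_gt0 : (0 < n)%N) :
  let e1 : 'I_n := Ordinal n_gt0 in
  (forall (f : L -> (L -> R) -> R) (rho : (L * 'I_n -> R) -> R),
    (forall i, smooth (f i)) -> rapid_decay f ->
    smooth rho -> moderate_growth rho ->
    [/\ forall j, bracket_integrable beta
          (fun u => rho u * u (j, e1) * generator beta f j (half_sq u)),
        forall j, bracket_integrable beta
          (fun u => pderiv (j, e1) rho u * f j (half_sq u)) &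
        - (\sum_j bracket beta
             (fun u => rho u * u (j, e1) * generator beta f j (half_sq u))) =
        \sum_j bracket beta
          (fun u => pderiv (j, e1) rho u * f j (half_sq u))]) /\
  (forall (d : measure_display) (W : measurableType d)
      (P : L -> probability W R) (X : R -> W -> L),
    jump_process beta P X ->
    forall (f : L -> (L -> R) -> R) (rho : (L * 'I_n -> R) -> R),
    (forall i, borel (f i)) -> rapid_decay f ->
    smooth rho -> moderate_growth rho ->
    [/\ forall j, bracket_integrable beta
          (fun u => rho u * u (j, e1) * f j (half_sq u)),
        forall j (u : L * 'I_n -> R), walk_integrable P X j (half_sq u) f,
        forall j, bracket_integrable beta
          (fun u => pderiv (j, e1) rho u *
             \int[lebesgue_measure]_(t in `[0, +oo[)
               walk_expect P X j (half_sq u) f t) &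
        \sum_j bracket beta (fun u => rho u * u (j, e1) * f j (half_sq u)) =
        \sum_j bracket beta
          (fun u => pderiv (j, e1) rho u *
             \int[lebesgue_measure]_(t in `[0, +oo[)
               walk_expect P X j (half_sq u) f t)]).
Proof.
move=> e1; split=> [f rho|d W P X JP f rho].
  exact: ward_identity.
exact: integrated_ward_identity.
Qed.
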